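(* Let $n\ge2$, let $\Omega\subset\mathbb{R}^n$ be a bounded $C^2$ domain, let $q\in C^1(\Omega)$, $q:\Omega\to(1,\infty)$, satisfy $n<q_-=\inf_{x\in\Omega}q(x)<\infty$ (the case $\sup_\Omega q=\infty$ is allowed), and let $\varphi\in W^{1,q}(\Omega)$ satisfy $\int_\Omega\frac{|\nabla\varphi|^q}{q}dx<\infty$. Let $u_q$ be the unique weak solution, in the sense specified in the context, of the problem $$\begin{cases}-\Delta_{q(x)}u(x)=-\operatorname{div}\big(|\nabla u(x)|^{q(x)-2}\nabla u(x)\big)=0, & x\in\Omega,\\ u(x)=\varphi(x), & x\in\partial\Omega.\end{cases}$$ Then $u_q$ is also a viscosity solution of this problem.
   Context: Variable exponent spaces. For a Borel measurable $q:\Omega\to[1,\infty)$ (possibly unbounded), $L^q(\Omega)$ is the set of measurable $f$ with $\int_\Omega|\lambda f(x)|^{q(x)}dx<\infty$ for some $\lambda>0$; $W^{1,q}(\Omega)$ is the set of $f\in L^q(\Omega)$ whose first-order weak derivatives also lie in $L^q(\Omega)$. Put $\rho_q(f)=\int_\Omega \frac{|f(x)|^{q(x)}}{q(x)}dx$ and $\rho_{1,q}(f)=\rho_q(f)+\rho_q(|\nabla f|)$. Modular topology. A set $A\subseteq W^{1,q}(\Omega)$ is $\rho_{1,q}$-closed iff whenever $(f_k)\subseteq A$, $f\in W^{1,q}(\Omega)$ and $\rho_{1,q}(f_k-f)\to0$, then $f\in A$. These are the closed sets of a topology; $\rho_{1,q}$-closures are taken in it. $W^{1,q}_{comp}(\Omega)$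 is the set of $v\in W^{1,q}(\Omega)$ with compact support in $\Omega$, and $U^{1,q}_0(\Omega)$ is the $\rho_{1,q}$-closure of $W^{1,q}_{comp}(\Omega)$ in $W^{1,q}(\Omega)$. Weak solution. The weak solution $u_q$ is the unique $u\in W^{1,q}(\Omega)$ such that: (a) $u-\varphi\in U_0^{1,q}(\Omega)$; (b) $\int_\Omega|\nabla u|^{q-2}\nabla u\cdot\nabla\phi\,dx=0$ for all $\phi\in W^{1,q}_{comp}(\Omega)$; (c) $\int_\Omega \frac{|\nabla u|^{q}}{q}dx<\infty$; (d) $\int_\Omega|\nabla u|^{q-2}\nabla u\cdot\nabla(u+v-\varphi)\,dx\le0$ for every $v\in U_0^{1,q}(\Omega)$ with $\int_\Omega\frac{|\nabla(v-\varphi)|^q}{q}dx<\infty$. Viscosity solutions. For an equation $F(x,\nabla u,D^2u)=0$ in $\Omega$ with boundary condition $u=\varphi$ on $\partial\Omega$: a lower semicontinuous $u$ on $\overline\Omega$ is a viscosity supersolution if $u\ge\varphi$ on $\partial\Omega$ and for every $\phi\in C^2(\Omega)$ such that $u-\phi$ has a strict minimum at a point $x_0\in\Omega$, one has $F(x_0,\nabla\phi(x_0),D^2\phi(x_0))\ge0$. An upper semicontinuous $u$ is a viscosity subsolution if $u\le\varphi$ on $\partial\Omega$ and for every $\phi\in C^2(\Omega)$ such that $u-\phi$ has a strict maximum at $x_0\in\Omega$, one has $F(x_0,\nabla\phi(x_0),D^2\phi(x_0))\le0$. A viscosity solution is both. Here $F(x,\nabla\phi,D^2\phi)$ is the expanded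 expression of $-\Delta_{q(x)}\phi$: $$-|\nabla\phi|^{q(x)-2}\Delta\phi-(q(x)-2)|\nabla\phi|^{q(x)-4}\Delta_\infty\phi-|\nabla\phi|^{q(x)-2}\ln(|\nabla\phi|)\langle\nabla\phi,\nabla q(x)\rangle,$$ with $\Delta_\infty\phi=\sum_{i,j=1}^n\phi_{x_i}\phi_{x_j}\phi_{x_ix_j}$, and the expression taken to be $0$ where $\nabla\phi=0$. Boundary values of $u_q$ and $\varphi$ are those of their continuous representatives on $\overline\Omega$ (which exist since $W^{1,q}(\Omega)\subset W^{1,q_-}(\Omega)$ and $q_->n$). *)

(* Defs.v *)
From HB Require Import structures.
From mathcomp Require Import all_boot all_order all_algebra.
From mathcomp Require Import all_classical all_reals all_analysis.

Set Implicit Arguments.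
Unset Strict Implicit.
Unset Printing Implicit Defensive.

Import Order.TTheory GRing.Theory Num.Theory.
Import numFieldNormedType.Exports.

Local Open Scope classical_set_scope.
Local Open Scope ring_scope.

(* The points of R^n are the row vectors 'rV[R]_n.  The library equips them with
   the topology of the sup norm, which is the usual one, but with neither a
   Euclidean norm, nor a sigma-algebra, nor a Lebesgue measure. *)

Section borel_rV.
Context {R : realType} {n : nat}.

Let coord (i : 'I_n) (x : 'rV[R]_n) : measurableTypeR R := x ord0 i.

(* The sigma-algebra generated by the coordinates, that is the Borel one. *)
Definition measurable_rV : set (set 'rV[R]_n) := g_sigma_preimage coord.

Let rV_set0 : measurable_rV set0.
Proof. exact: sigma_algebra0. Qed.

Let rV_setC A : measurable_rV A -> measurable_rV (~` A).
Proof. exact: sigma_algebraC. Qed.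

Let rV_bigcup (F : (set 'rV[R]_n)^nat) : (forall i, measurable_rV (F i)) ->
  measurable_rV (\bigcup_i (F i)).
Proof. exact: sigma_algebra_bigcup. Qed.

Definition rV_display : measure_display := sigma_display measurable_rV.

HB.instance Definition _ := @isMeasurable.Build rV_display
  'rV[R]_n measurable_rV rV_set0 rV_setC rV_bigcup.

Lemma measurable_coord (i : 'I_n) :
  measurable_fun [set: 'rV[R]_n] (fun x : 'rV[R]_n => x ord0 i).
Proof.
move=> _ Y mY; rewrite setTI; apply: sub_sigma_algebra => /=.
rewrite -bigcup_seq/=; exists i => /=; first by rewrite mem_index_enum.
by exists Y => //; rewrite setTI.
Qed.

Lemma measurable_fun_coordP d (T : measurableType d) (f : T -> 'rV[R]_n) :
  (forall i, measurable_fun [set: T] (fun t => f t ord0 i)) ->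
  measurable_fun [set: T] f.
Proof.
move=> mf.
suff: g_sigma_preimage (fun i => coord i \o f) `<=` measurable.
  rewrite g_sigma_preimage_comp => sub _ A mA.
  by apply: sub; exists A.
apply: smallest_sub; first exact: sigma_algebra_measurable.
rewrite -bigcup_seq/=; apply: bigcup_sub => i _ A [B mB <-].
exact: mf.
Qed.

End borel_rV.

Section lebesgue_rV.
Context {R : realType}.

Definition rV_cons n (p : measurableTypeR R * 'rV[R]_n) : 'rV[R]_n.+1 :=
  row_mx (p.1 : R)%:M p.2 : 'rV[R]_(1 + n).

Definition rV_uncons n (x : 'rV[R]_n.+1) : measurableTypeR R * 'rV[R]_n :=
  (x ord0 ord0, \row_i x ord0 (lift ord0 i)).

Lemma rV_consE0 n p : @rV_cons n p ord0 ord0 = p.1.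
Proof.
have -> : (ord0 : 'I_n.+1) = lshift n (ord0 : 'I_1) by exact/val_inj.
by apply: etrans (row_mxEl _ _ _ _) _; rewrite mxE eqxx mulr1n.
Qed.

Lemma rV_consES n p i : @rV_cons n p ord0 (lift ord0 i) = p.2 ord0 i.
Proof.
have -> : lift ord0 i = rshift 1 i by exact/val_inj.
exact: row_mxEr.
Qed.

Lemma rV_consK n : cancel (@rV_cons n) (@rV_uncons n).
Proof.
move=> [a v]; rewrite /rV_uncons rV_consE0; congr pair.
by apply/rowP => i; rewrite mxE rV_consES.
Qed.

Lemma measurable_rV_cons n : measurable_fun setT (@rV_cons n).
Proof.
apply: measurable_fun_coordP => i.
have [j ->|->] := unliftP ord0 i.
  rewrite (_ : (fun _ => _) = (fun x : 'rV[R]_n => x ord0 j) \o snd).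
    by apply: measurableT_comp => //; exact: measurable_coord.
  by apply/funext => p /=; rewrite rV_consES.
rewrite (_ : (fun _ => _) = fst); first exact: measurable_fst.
by apply/funext => p /=; rewrite rV_consE0.
Qed.

Lemma measurable_rV_uncons n : measurable_fun setT (@rV_uncons n).
Proof.
apply/measurable_fun_pairP; split => /=.
  exact: (@measurable_coord R n.+1 ord0).
apply: measurable_fun_coordP => i.
rewrite (_ : (fun _ => _) = fun x : 'rV[R]_n.+1 => x ord0 (lift ord0 i)).
  exact: measurable_coord.
by apply/funext => x /=; rewrite mxE.
Qed.

Section step.
Context {n : nat} (mu : {sigma_finite_measure set 'rV[R]_n -> \bar R}).

Definition lebesgue_rV_succ : set 'rV[R]_n.+1 -> \bar R :=
  pushforward (@lebesgue_measure R \x mu)%E (@rV_cons n).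

Let measurable_preimage A : measurable A -> measurable (@rV_cons n @^-1` A).
Proof.
by move=> mA; rewrite -[X in measurable X]setTI; exact: measurable_rV_cons.
Qed.

Let succ0 : (lebesgue_rV_succ set0 = 0)%E.
Proof. by rewrite /lebesgue_rV_succ /pushforward preimage_set0 measure0. Qed.

Let succ_ge0 A : (0 <= lebesgue_rV_succ A)%E.
Proof. by rewrite /lebesgue_rV_succ /pushforward; exact: measure_ge0. Qed.

Let succ_sigma_additive : semi_sigma_additive lebesgue_rV_succ.
Proof.
move=> F mF tF mUF; rewrite /lebesgue_rV_succ /pushforward preimage_bigcup.
apply: measure_semi_sigma_additive.
- by move=> k; exact: measurable_preimage.
- apply/trivIsetP => /= i j _ _ ij; rewrite -preimage_setI.
  by move/trivIsetP : tF => /(_ _ _ _ _ ij) ->//; rewrite preimage_set0.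
- by rewrite -preimage_bigcup; exact: measurable_preimage.
Qed.

HB.instance Definition _ := isMeasure.Build _ _ _ lebesgue_rV_succ
  succ0 succ_ge0 succ_sigma_additive.

Let sigma_finite_succ : sigma_finite setT lebesgue_rV_succ.
Proof.
have /sigma_finiteP[F [TF ndF Foo]] := sigma_finiteT (@lebesgue_measure R).
have /sigma_finiteP[G [TG ndG Goo]] := sigma_finiteT mu.
exists (fun k => @rV_uncons n @^-1` (F k `*` G k)).
  apply/esym; rewrite -preimage_bigcup -subTset => x _ /=.
  case: (@rV_uncons n x) => a v.
  have [i _ Fia] : (\bigcup_k F k) a by rewrite -TF.
  have [j _ Gjv] : (\bigcup_k G k) v by rewrite -TG.
  exists (maxn i j) => //; split.
  - by move: a Fia; exact/subsetPset/ndF/leq_maxl.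
  - by move: v Gjv; exact/subsetPset/ndG/leq_maxr.
move=> k; have [mF Fk] := Foo k; have [mG Gk] := Goo k; split.
  rewrite -[X in measurable X]setTI; apply: measurable_rV_uncons => //.
  exact: measurableX.
rewrite /lebesgue_rV_succ /pushforward -comp_preimage.
rewrite (_ : _ \o _ = id) ?preimage_id; last by apply/funext; exact: rV_consK.
by rewrite product_measure1E// lte_mul_pinfty// ge0_fin_numE.
Qed.

HB.instance Definition _ := Measure_isSigmaFinite.Build _ _ _
  lebesgue_rV_succ sigma_finite_succ.

End step.

(* R^0 is a point, and R^n.+1 is the product of R and R^n. *)
Fixpoint lebesgue_rV n : {sigma_finite_measure set 'rV[R]_n -> \bar R} :=
  if n is m.+1 then lebesgue_rV_succ (lebesgue_rV m)
  else dirac (0 : 'rV[R]_0).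

End lebesgue_rV.

Section euclidean.
Context {R : realType} {n : nat}.
Implicit Types (u v : 'rV[R]_n) (f : 'rV[R]_n -> R).

Definition dotv u v : R := \sum_(i < n) u ord0 i * v ord0 i.

(* The Euclidean norm; `|v| is the sup norm. *)
Definition enorm v : R := Num.sqrt (dotv v v).

Definition partial (i : 'I_n) f : 'rV[R]_n -> R :=
  fun x => 'D_(delta_mx ord0 i) f x.

Definition partials (s : seq 'I_n) f : 'rV[R]_n -> R := foldr partial f s.

Definition grad f (x : 'rV[R]_n) : 'rV[R]_n := \row_i partial i f x.

Definition hessian f (x : 'rV[R]_n) : 'M[R]_n :=
  \matrix_(i, j) partial i (partial j f) x.

(* f is of class C^k on the open set A: its partial derivatives of order at most
   k exist and are continuous at every point of A. *)
Definition Ck (k : nat) (A : set 'rV[R]_n) f : Prop :=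
  forall (s : seq 'I_n) (x : 'rV[R]_n), A x ->
    ((size s <= k)%N -> {for x, continuous (partials s f)}) /\
    ((size s < k)%N ->
      forall i, derivable (partials s f) x (delta_mx ord0 i)).

Definition boundary (A : set 'rV[R]_n) : set 'rV[R]_n := closure A `\` A°.

Definition supported_in (Omega : set 'rV[R]_n) f : Prop :=
  exists2 K, compact K & K `<=` Omega /\ forall x, ~ K x -> f x = 0.

Definition Cc_infty (Omega : set 'rV[R]_n) f : Prop :=
  (forall k, Ck k setT f) /\ supported_in Omega f.

End euclidean.

(* Near each boundary point, Omega is the part of R^n lying strictly above
   (b = false) or strictly below (b = true) the graph of a C^2 function of all
   the coordinates but the i-th. *)
Definition C2_boundary {R : realType} {n : nat} (Omega : set 'rV[R]_n) : Prop :=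
  forall x0, boundary Omega x0 ->
    exists (i : 'I_n) (b : bool) (g : 'rV[R]_n.-1 -> R), Ck 2 setT g /\
      \forall x \near x0, Omega x <->
        (if b then x ord0 i < g (col' i x) else g (col' i x) < x ord0 i).

Section variable_exponent_spaces.
Context {R : realType} {n : nat}.
Variables (Omega : set 'rV[R]_n) (q : 'rV[R]_n -> R).

Local Notation mu := (@lebesgue_rV R n).

(* Elements of function spaces are Borel functions on R^n, of which only the
   values on Omega matter, up to a null set. *)
Implicit Types (f g u v phi : 'rV[R]_n -> R) (G : 'rV[R]_n -> 'rV[R]_n).

Definition loc_integrable f : Prop :=
  measurable_fun Omega f /\
  forall K, compact K -> K `<=` Omega -> mu.-integrable K (EFin \o f).

Definition is_weak_gradient f G : Prop :=
  [/\ loc_integrable f,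
      (forall i, loc_integrable (fun x => G x ord0 i)) &
      forall (psi : 'rV[R]_n -> R) (i : 'I_n), Cc_infty Omega psi ->
        (\int[mu]_(x in Omega) (f x * partial i psi x)%:E =
         - \int[mu]_(x in Omega) (G x ord0 i * psi x)%:E)%E].

(* Weak gradients agree almost everywhere on Omega, so which one is selected does
   not matter. *)
Definition wgrad f : 'rV[R]_n -> 'rV[R]_n :=
  xget (fun=> 0) [set G | is_weak_gradient f G].

Definition Lq f : Prop :=
  measurable_fun Omega f /\
  exists2 lambda : R, 0 < lambda &
    (\int[mu]_(x in Omega) (`|lambda * f x| `^ q x)%:E < +oo)%E.

Definition W1q : set ('rV[R]_n -> R) :=
  [set f | [/\ Lq f, exists G, is_weak_gradient f G &
               forall i, Lq (fun x => wgrad f x ord0 i)]].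

Definition rho f : \bar R :=
  (\int[mu]_(x in Omega) (`|f x| `^ q x / q x)%:E)%E.

Definition rho_grad f : \bar R := rho (fun x => enorm (wgrad f x)).

Definition rho1 f : \bar R := (rho f + rho_grad f)%E.

Definition rho1_closed (A : set ('rV[R]_n -> R)) : Prop :=
  A `<=` W1q /\
  forall (f_ : nat -> 'rV[R]_n -> R) f,
    (forall k, A (f_ k)) -> W1q f ->
    (fun k => rho1 (f_ k \- f)) @ \oo --> 0%E -> A f.

Definition rho1_closure (A : set ('rV[R]_n -> R)) : set ('rV[R]_n -> R) :=
  smallest rho1_closed A.

(* The support of v is understood up to null sets. *)
Definition W1q_comp : set ('rV[R]_n -> R) :=
  [set v | W1q v /\ exists2 K, compact K & K `<=` Omega /\
    {ae mu, forall x, Omega x -> ~ K x -> v x = 0}].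

Definition U1q0 : set ('rV[R]_n -> R) := rho1_closure W1q_comp.

Definition flux u (x : 'rV[R]_n) : 'rV[R]_n :=
  enorm (wgrad u x) `^ (q x - 2) *: wgrad u x.

(* The integral in the last clause takes values in the extended reals: since
   rho_grad u and rho_grad (v - phi) are finite, Young's inequality shows that the
   negative part of the integrand is integrable, but the positive part need not
   be when q is unbounded. *)
Definition weak_solution phi u : Prop :=
  W1q u /\
  [/\ U1q0 (u \- phi),
      (forall psi, W1q_comp psi ->
        \int[mu]_(x in Omega) (dotv (flux u x) (wgrad psi x))%:E = 0)%E,
      (rho_grad u < +oo)%E &
      forall v, U1q0 v -> (rho_grad (v \- phi)%R < +oo)%E ->
        (\int[mu]_(x in Omega)
          (dotv (flux u x) (wgrad (u \+ v \- phi)%R x))%:E <= 0)%E].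

Definition continuous_representative u ubar : Prop :=
  {within closure Omega, continuous ubar} /\
  {ae mu, forall x, Omega x -> ubar x = u x}.

End variable_exponent_spaces.

Section viscosity.
Context {R : realType} {n : nat}.
Variable Omega : set 'rV[R]_n.
Variable F : 'rV[R]_n -> 'rV[R]_n -> 'M[R]_n -> R.
Implicit Types (u g phi : 'rV[R]_n -> R).

Definition strict_min u (x0 : 'rV[R]_n) : Prop :=
  Omega x0 /\ forall x, Omega x -> x != x0 -> u x0 < u x.

Definition strict_max u (x0 : 'rV[R]_n) : Prop :=
  Omega x0 /\ forall x, Omega x -> x != x0 -> u x < u x0.

Definition lsc_on (A : set 'rV[R]_n) u : Prop :=
  lower_semicontinuous (fun x : subspace A => (u x)%:E).

Definition usc_on (A : set 'rV[R]_n) u : Prop := lsc_on A (\- u).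

Definition viscosity_supersolution g u : Prop :=
  [/\ lsc_on (closure Omega) u,
      (forall x, boundary Omega x -> g x <= u x) &
      forall phi x0, Ck 2 Omega phi -> strict_min (u \- phi) x0 ->
        0 <= F x0 (grad phi x0) (hessian phi x0)].

Definition viscosity_subsolution g u : Prop :=
  [/\ usc_on (closure Omega) u,
      (forall x, boundary Omega x -> u x <= g x) &
      forall phi x0, Ck 2 Omega phi -> strict_max (u \- phi) x0 ->
        F x0 (grad phi x0) (hessian phi x0) <= 0].

Definition viscosity_solution g u : Prop :=
  viscosity_supersolution g u /\ viscosity_subsolution g u.

End viscosity.

Section qx_laplacian.
Context {R : realType} {n : nat}.

(* The infinity-Laplacian of a function of gradient p and Hessian X. *)
Definition infty_laplacian (p : 'rV[R]_n) (X : 'M[R]_n) : R :=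
  \sum_(i < n) \sum_(j < n) p ord0 i * p ord0 j * X i j.

Definition minus_qx_laplacian (q : 'rV[R]_n -> R)
    (x p : 'rV[R]_n) (X : 'M[R]_n) : R :=
  if p == 0 then 0 else
    - (enorm p `^ (q x - 2) * \tr X)
    - (q x - 2) * enorm p `^ (q x - 4) * infty_laplacian p X
    - enorm p `^ (q x - 2) * ln (enorm p) * dotv p (grad q x).

End qx_laplacian.

(* Main.v *)
(* Let V = |grad phi|^(q-2) grad phi, so that the expanded operator at phi is - div V.
   Suppose that ubar - phi has a strict minimum at x0 and that div V(x0) > 0, hence
   grad phi(x0) <> 0.  For small m > 0 the function w = phi + (ubar - phi)(x0) + m - ubar
   is positive at x0 and negative on a sphere around it, and eta = (w^+)^2 / 2, cut to
   the ball, is an admissible test function of gradient w^+ grad w.  Integrating V by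
   parts and testing the equation of u with eta gives
     int eta div V = - int w^+ (V - |grad u|^(q-2) grad u) . (grad phi - grad u) <= 0
   by monotonicity of a |-> |a|^(r-2) a, whereas eta div V > 0 around x0.
   Subsolutions follow by changing the signs of u and phi.

   For the boundary values, the functions of W^{1,q} whose extension by zero is weakly
   differentiable on R^n contain those of compact support and form a modular closed set,
   because modular convergence implies L^1 convergence even if q is unbounded; so
   u - phi is among them.  If its continuous representative were c <> 0 at a boundary
   point, testing the extension with a bump of size h there, whose slope integrates to
   a quantity of order |c| h^(n-1) on the side of the domain, would give, for
   n < p < inf q and every e > 0,
     |c| h^(n-1) <= C (e h^(n-1) + e^(1-p) h^(p-1)),
   which is false for small e and then small h. *)
Require Import Defs.
From mathcomp Require Import all_boot all_order all_algebra.
From mathcomp Require Import all_classical all_reals all_analysis.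
From mathcomp Require Import measurable_realfun ring lra.

Import Order.TTheory GRing.Theory Num.Theory.
Import numFieldNormedType.Exports.

Set Implicit Arguments.
Unset Strict Implicit.
Unset Printing Implicit Defensive.

Local Open Scope classical_set_scope.
Local Open Scope ring_scope.

(** * Borel sets and Lebesgue measure of R^n *)

Section row_vectors.
Context {R : realType} {n : nat}.
Implicit Types (x y v : 'rV[R]_n) (r : R) (A U : set 'rV[R]_n).

(** The test function is (w^+)^2 / 2 rather than w^+ because s |-> (s^+)^2 / 2 has a Lipschitz
    derivative: a second-order expansion of difference quotients yields its weak gradient w^+ grad w
    without mollification, and the extra factor w^+ >= 0 leaves the monotonicity argument intact.
    The expansion error is an integral of squared increments of w, while grad w is only known to be
    integrable; the increment is therefore used a second time, as a test function whose sup norm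
    tends to 0 because w is continuous. Weak derivatives are tested on products of one-variable
    smooth functions. These are stable under partial derivatives and translations, have explicit
    primitives in each direction, and their sums approximate every continuous compactly supported
    function uniformly. Balls are those of the sup norm, that is boxes, so their supports fit these
    products. An unbounded q is harmless in the interior, being bounded on compact balls. It matters
    for the modular closure, where large exponents are confined to a set of small measure. *)

Lemma coord_le_norm x (i : 'I_n) : `|x ord0 i| <= `|x|.
Proof.
rewrite [leRHS]/Num.norm /= mx_normrE; apply/bigmax_geP; right => /=.
by exists (ord0, i).
Qed.

Lemma rV_norm_le x r : 0 <= r -> (forall i, `|x ord0 i| <= r) -> `|x| <= r.
Proof.
move=> r0 H; rewrite [leLHS]/Num.norm /= mx_normrE; apply/bigmax_leP; split=> //.
by move=> [i j] _ /=; rewrite (ord1 i).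
Qed.

Lemma rV_norm_lt x r : 0 < r -> (forall i, `|x ord0 i| < r) -> `|x| < r.
Proof.
move=> r0 H; rewrite [ltLHS]/Num.norm /= mx_normrE; apply/bigmax_ltP; split=> //.
by move=> [i j] _ /=; rewrite (ord1 i).
Qed.

Lemma rV_nbhsP x U : nbhs x U <-> exists2 r, 0 < r & forall y, `|x - y| < r -> U y.
Proof.
split=> [/nbhs_ballP[r /= r0 H]|[r r0 H]].
  by exists r => // y xy; apply: H; rewrite -ball_normE.
apply/nbhs_ballP; exists r => //= y; rewrite -ball_normE /=; exact: H.
Qed.

Lemma coord_continuous_rV (i : 'I_n) : continuous (fun x => x ord0 i).
Proof. by move=> x; exact: coord_continuous. Qed.

Definition box (a b : 'I_n -> R) : set 'rV[R]_n :=
  [set x | forall i, a i < x ord0 i < b i].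

Lemma open_box a b : open (box a b).
Proof.
rewrite openE => x xab; rewrite /interior.
have := @filter_forall _ _ (fun i (y : 'rV[R]_n) => a i < y ord0 i < b i) (nbhs x) _.
apply => i.
have : nbhs (x ord0 i) [set t | a i < t < b i].
  have := xab i => /andP[h1 h2].
  have xi : x ord0 i \in `]a i, b i[ by rewrite in_itv/= h1.
  by apply: filterS (near_in_itvoo xi) => t; rewrite in_itv.
exact: coord_continuous_rV.
Qed.

Lemma boxI a b c d :
  box a b `&` box c d = box (fun i => Num.max (a i) (c i)) (fun i => Num.min (b i) (d i)).
Proof.
apply/seteqP; split=> x.
  move=> [h1 h2] i; have /andP[? ?] := h1 i; have /andP[? ?] := h2 i.
  by rewrite gt_max lt_min; apply/andP; split; apply/andP.
by move=> H; split=> i; have := H i; rewrite gt_max lt_min => /andP[/andP[? ?] /andP[? ?]]; apply/andP.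
Qed.

Lemma bigcup_box : \bigcup_(k in [set: nat]) box (fun=> - k%:R) (fun=> k%:R) = setT.
Proof.
apply/seteqP; split=> // x _; exists (Num.bound `|x|) => // i.
rewrite -ltr_norml; apply: le_lt_trans (coord_le_norm _ _) _; exact: archi_boundP.
Qed.

Let boxes : set (set 'rV[R]_n) := [set A | exists a b, A = box a b].

Lemma measurable_box a b : measurable (box a b).
Proof.
rewrite (_ : box a b = \bigcap_(i in [set: 'I_n]) ((fun x : 'rV[R]_n => x ord0 i) @^-1` `]a i, b i[)).
  apply: fin_bigcap_measurable => // i _; rewrite -[X in measurable X]setTI.
  by apply: measurable_coord => //; exact: measurable_itv.
by apply/seteqP; split=> x H i; [move=> _|have := H i Logic.I]; rewrite /= in_itv/=; [exact: H|].
Qed.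

(** A half-space x_i > c is a countable union of open boxes. Boxes form a pi-system of finite
    measure, so this is what uniqueness of measures and Dynkin arguments need. *)
Lemma measurable_rVE : measurable = <<s boxes >>.
Proof.
apply/seteqP; split; last first.
  apply: smallest_sub; first exact: sigma_algebra_measurable.
  by move=> _ [a [b ->]]; exact: measurable_box.
apply: smallest_sub; first exact: smallest_sigma_algebra.
rewrite -bigcup_seq; apply: bigcup_sub => i _ _ [B mB <-]; rewrite setTI.
have sb : sigma_algebra setT (<<s boxes >>) := smallest_sigma_algebra _ _.
suff : @measurable _ (measurableTypeR R) `<=` [set B | <<s boxes >> ((fun x : 'rV[R]_n => x ord0 i) @^-1` B)].
  by apply.
rewrite RGenOInfty.measurableE; apply: smallest_sub.
  split => /=.
  - by rewrite preimage_set0; exact: sigma_algebra0.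
  - move=> A hA; rewrite setTD -preimage_setC -[X in <<s _ >> X]setTD.
    exact: sigma_algebraCD.
  - by move=> F hF; rewrite preimage_bigcup; exact: sigma_algebra_bigcup.
move=> _ [c ->] /=.
rewrite (_ : _ @^-1` _ = \bigcup_k (box (fun j => if j == i then c else - k%:R) (fun=> k%:R))).
  by apply: sigma_algebra_bigcup => k; apply: sub_sigma_algebra; do 2 eexists.
apply/seteqP; split=> x /=; rewrite in_itv/= andbT.
  move=> cx; exists (Num.bound `|x|) => // j.
  have := archi_boundP (normr_ge0 x) => /(le_lt_trans (coord_le_norm x j)).
  by rewrite ltr_norml; case: eqP => [->|_] /andP[h1 h2]; apply/andP.
by move=> [k _ /(_ i)]; rewrite eqxx => /andP[].
Qed.

Lemma open_measurable_rV U : open U -> measurable U.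
Proof.
move=> oU.
(* An open set is the union of the boxes with rational corners that it contains, a countable
   family. *)
pose B (p : 'rV[rat]_n * 'rV[rat]_n) := box (fun i => ratr (p.1 ord0 i)) (fun i => ratr (p.2 ord0 i)).
rewrite (_ : U = \bigcup_p (if `[< B p `<=` U >] then B p else set0)).
  apply: countable_bigcupT_measurable => // p.
  by case: ifP => _ //; exact: measurable_box.
apply/seteqP; split=> x.
  move=> Ux; have /rV_nbhsP[r r0 H] := open_nbhs_nbhs (conj oU Ux).
  have /choice[c Hc] : forall i, exists c : rat, x ord0 i - r < ratr c < x ord0 i.
    move=> i; have [c] := @rat_in_itvoo _ (x ord0 i - r) (x ord0 i) ltac:(lra).
    by rewrite in_itv/=; exists c.
  have /choice[d Hd] : forall i, exists d : rat, x ord0 i < ratr d < x ord0 i + r.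
    move=> i; have [d] := @rat_in_itvoo _ (x ord0 i) (x ord0 i + r) ltac:(lra).
    by rewrite in_itv/=; exists d.
  exists (\row_i c i, \row_i d i) => //.
  case: asboolP => [_|].
    by move=> i /=; rewrite !mxE; move: (Hc i) (Hd i) => /andP[_ ->] /andP[->].
  case=> y By; apply: H; apply: rV_norm_lt => // i; rewrite !mxE.
  move: (By i); rewrite /= !mxE; move: (Hc i) (Hd i) => /andP[? ?] /andP[? ?] /andP[? ?].
  by rewrite ltr_norml; apply/andP; split; lra.
by move=> [p _]; case: asboolP => // pU; exact: pU.
Qed.

Lemma closed_measurable_rV U : closed U -> measurable U.
Proof. by move=> cU; rewrite -(setCK U); apply: measurableC; apply: open_measurable_rV; exact: closed_openC. Qed.

Lemma continuous_measurable_rV U (f : 'rV[R]_n -> R) : measurable U ->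
  {within U, continuous f} -> measurable_fun U f.
Proof.
move=> mU /continuousP cf; apply: (measurability _ (RGenOpens.measurableE R)).
move=> _ [_ [a [b ->] <-]].
have /cf/open_subspaceP[V oV VE] : open `]a, b[%classic by exact: interval_open.
rewrite setIC -VE.
by apply: measurableI => //; exact: open_measurable_rV.
Qed.

End row_vectors.

(** * Lebesgue measure of boxes and translation invariance *)

Section lebesgue_box.
Context {R : realType}.

Lemma lebesgue_box n (a b : 'I_n -> R) :
  lebesgue_rV n (box a b) = (\prod_(i < n) Num.max 0 (b i - a i))%:E.
Proof.
elim: n a b => [|n IH] a b.
  rewrite big_ord0 (_ : box a b = setT) /= ?diracT//.
  by apply/seteqP; split=> // x _ [].
rewrite /= /lebesgue_rV_succ /pushforward.
rewrite (_ : _ @^-1` _ = `]a ord0, b ord0[%classic `*`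
    box (fun i => a (lift ord0 i)) (fun i => b (lift ord0 i))).
  rewrite product_measure1E//; last exact: measurable_box.
  rewrite [X in (X * _)%E]lebesgue_measure_itv/= IH big_ord_recl EFinM; congr (_ * _)%E.
  rewrite lte_fin /Num.max subr_gt0; case: ifP => // _.
apply/seteqP; split=> -[t x] /=.
  move=> H; split; first by have := H ord0; rewrite rV_consE0 in_itv.
  by move=> i; have := H (lift ord0 i); rewrite rV_consES.
move=> [h1 h2] i; have [j ->|->] := unliftP ord0 i.
  by rewrite rV_consES; exact: h2.
by rewrite rV_consE0; move: h1; rewrite in_itv.
Qed.

Context {n : nat}.
Local Notation mu := (@lebesgue_rV R n).
Implicit Types (A D U : set 'rV[R]_n).

Lemma lebesgue_box_lty (a b : 'I_n -> R) : (mu (box a b) < +oo)%E.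
Proof. by rewrite lebesgue_box ltry. Qed.

Lemma bounded_lebesgue_lty A : measurable A -> bounded_set A -> (mu A < +oo)%E.
Proof.
move=> mA [M [Mr MA]]; have M1 : M < M + 1 by rewrite ltrDl.
apply: le_lt_trans (lebesgue_box_lty (fun=> - (M + 2)) (fun=> M + 2)).
apply: le_measure; rewrite ?inE//; first exact: measurable_box.
move=> x Ax i; rewrite -ltr_norml; apply: le_lt_trans (coord_le_norm _ _) _.
by apply: le_lt_trans (MA _ M1 _ Ax) _; lra.
Qed.

Lemma compact_measurable_rV A : compact A -> measurable A.
Proof. by move=> cA; apply: closed_measurable_rV; apply: compact_closed. Qed.

Lemma open_lebesgue_gt0 U : open U -> U !=set0 -> (0 < mu U)%E.
Proof.
move=> oU [x Ux]; have /rV_nbhsP[r r0 H] := open_nbhs_nbhs (conj oU Ux).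
pose B := box (fun i => x ord0 i - r) (fun i => x ord0 i + r).
apply: (@lt_le_trans _ _ (mu B)).
  rewrite lebesgue_box lte_fin; apply: prodr_gt0 => i _.
  by rewrite lt_max; apply/orP; right; lra.
apply: le_measure; rewrite ?inE; [exact: measurable_box|exact: open_measurable_rV|].
move=> y By; apply: H; apply: rV_norm_lt => // i; rewrite !mxE.
by have := By i => /andP[? ?]; rewrite ltr_norml; apply/andP; split; lra.
Qed.

Lemma measurable_shift (v : 'rV[R]_n) D : measurable_fun D (fun x => x + v).
Proof.
apply: measurable_funTS; apply: measurable_fun_coordP => i.
under eq_fun do rewrite mxE.
by apply: measurable_funD => //; exact: measurable_coord.
Qed.

(** Both measures agree on boxes, a generating pi-system that exhausts the space by sets of finite
    measure; uniqueness of measures does the rest. *)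
Lemma lebesgue_shift (v : 'rV[R]_n) A : measurable A ->
  pushforward mu (fun x => x + v) A = mu A.
Proof.
move=> mA; apply/esym.
pose f : 'rV[R]_n -> 'rV[R]_n := fun x => x + v.
have mf : measurable_fun setT f by exact: measurable_shift.
pose mf_mixin := isMeasurableFun.Build _ _ _ _ _ mf.
pose mf_pack : {mfun _ >-> _} := MeasurableFun.Pack (MeasurableFun.Class mf_mixin).
apply: (measure_unique [set B | exists a b, B = box a b] (fun k => box (fun=> - k%:R) (fun=> k%:R)) _ _ _ _ mu (pushforward mu mf_pack)) => //.
- exact: measurable_rVE.
- by move=> _ _ [a [b ->]] [c [d ->]]; rewrite boxI; do 2 eexists.
- by move=> k; do 2 eexists.
- exact: bigcup_box.
- move=> _ [a [b ->]]; change (mu (box a b) = mu (f @^-1` box a b)).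
  rewrite (_ : _ @^-1` _ = box (fun i => a i - v ord0 i) (fun i => b i - v ord0 i)).
    rewrite !lebesgue_box; congr (_%:E); apply: eq_bigr => i _; congr Num.max; ring.
  apply/seteqP; split=> x /= H i; have := H i; rewrite /f /= mxE => /andP[? ?]; apply/andP; split; lra.
- by move=> k; exact: lebesgue_box_lty.
Qed.

Lemma integral_shift (v : 'rV[R]_n) (f : 'rV[R]_n -> \bar R) :
  measurable_fun setT f -> mu.-integrable setT (fun x => f (x + v)) ->
  (\int[mu]_x f (x + v)%R = \int[mu]_x f x)%E.
Proof.
move=> mf intf.
rewrite -[RHS](_ : \int[pushforward mu (fun x : 'rV[R]_n => (x + v)%R)]_x f x = _)%E; last first.
  by apply: eq_measure_integral => [|? A mA _]; [exact: measurable_shift|exact: lebesgue_shift].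
by rewrite (integral_pushforward (measurable_shift v (D:=setT))).
Qed.

Lemma integrable_shift (v : 'rV[R]_n) (f : 'rV[R]_n -> \bar R) :
  mu.-integrable setT f -> mu.-integrable setT (fun x => f (x + v)).
Proof.
move=> /integrableP[mf foo]; apply/integrableP; split.
  by apply: measurableT_comp => //; exact: measurable_shift.
move: foo; congr (_ < _)%E.
have mf' : measurable_fun setT (abse \o f) by exact: measurableT_comp.
rewrite -[LHS](_ : \int[pushforward mu (fun x : 'rV[R]_n => (x + v)%R)]_x `|f x| = _)%E; last first.
  by apply: eq_measure_integral => [|? A mA _]; [exact: measurable_shift|exact: lebesgue_shift].
by rewrite (ge0_integral_pushforward (measurable_shift v (D:=setT))).
Qed.

End lebesgue_box.

(** * Smooth functions *)

Section derive_pointwise.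
Context {R : realType} {V : normedModType R}.
Implicit Types (f g : V -> R) (x v : V).

Lemma is_deriveD_fun f g x v df dg : is_derive x v f df -> is_derive x v g dg ->
  is_derive x v (fun y => f y + g y) (df + dg).
Proof. by move=> hf hg; exact: is_deriveD. Qed.

Lemma is_deriveM_fun f g x v df dg : is_derive x v f df -> is_derive x v g dg ->
  is_derive x v (fun y => f y * g y) (f x * dg + g x * df).
Proof. by move=> hf hg; exact: is_deriveM. Qed.

Let growth_line f x v (t : R) :
  (fun h : R => h^-1 *: (((fun t : R => f (t *: v + x)) \o shift t) (h *: (1 : R)) - f (t *: v + x))) =
  (fun h : R => h^-1 *: ((f \o shift (t *: v + x)) (h *: v) - f (t *: v + x))).
Proof. by apply/funext => h /=; rewrite [h *: 1]mulr1 scalerDl addrA. Qed.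

(** Reduces directional derivatives to one-variable ones along a line, where the mean value theorem
    and the one-variable chain rule apply. *)
Lemma is_derive_line f x v (t df : R) :
  is_derive t 1 (fun s : R => f (s *: v + x)) df <-> is_derive (t *: v + x) v f df.
Proof.
have E1 : derivable (fun s : R => f (s *: v + x)) t 1 = derivable f (t *: v + x) v.
  by rewrite /derivable growth_line.
have E2 : 'D_1 (fun s : R => f (s *: v + x)) t = 'D_v f (t *: v + x).
  by rewrite /derive growth_line.
by split=> -[d dE]; apply: DeriveDef; [rewrite -E1|rewrite -E2|rewrite E1|rewrite E2].
Qed.

Lemma is_derive_line0 f x v (df : R) :
  is_derive (0 : R) 1 (fun s : R => f (s *: v + x)) df <-> is_derive x v f df.
Proof. by rewrite is_derive_line scale0r add0r. Qed.

End derive_pointwise.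

Section smooth1.
Context {R : realType}.
Implicit Types (f g : R -> R).

Fixpoint nderivable (k : nat) f : Prop :=
  if k is k'.+1 then (forall x, derivable f x 1) /\ nderivable k' (derive1 f) else True.

Definition smooth f := forall k, nderivable k f.

Lemma nderivableS k f : nderivable k.+1 f -> nderivable k f.
Proof. by elim: k f => // k IH f [h1 h2]; split => //; exact: IH. Qed.

Lemma is_derive_derive1 f f' : (forall x, is_derive x (1 : R) f (f' x)) -> (derive1 f) = f'.
Proof. by move=> H; apply/funext => x; rewrite derive1E derive_val. Qed.

Lemma nderivable_is_derive k f f' :
  (forall x, is_derive x (1 : R) f (f' x)) -> nderivable k f' -> nderivable k.+1 f.
Proof.
move=> H nf'; split; last by rewrite (is_derive_derive1 H).
by move=> x; have [] := H x.
Qed.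

Lemma smooth_is_derive f x : smooth f -> is_derive x (1 : R) f ((derive1 f) x).
Proof. by move=> /(_ 1%N)[H _]; rewrite derive1E; exact/derivableP/H. Qed.

Lemma smooth_derive1 f : smooth f -> smooth (derive1 f).
Proof. by move=> H k; have [] := H k.+1. Qed.

Lemma smooth_primitive f f' :
  (forall x, is_derive x (1 : R) f (f' x)) -> smooth f' -> smooth f.
Proof. by move=> H sf [|k] //; apply: nderivable_is_derive H (sf k). Qed.

Lemma smooth_continuous f : smooth f -> continuous f.
Proof. by move=> sf x; apply/differentiable_continuous/derivable1_diffP; have [] := smooth_is_derive x sf. Qed.

(** A class of functions stable under differentiation contains only smooth functions: smoothness is
    shown by exhibiting such a class. *)
Lemma smooth_class (C : set (R -> R)) :
  (forall f, C f -> exists2 f', C f' & forall x, is_derive x (1 : R) f (f' x)) ->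
  forall f, C f -> smooth f.
Proof.
move=> H f Cf k; elim: k f Cf => // k IH f /H[f' Cf' ff'].
by apply: nderivable_is_derive ff' _; exact: IH.
Qed.

Lemma nderivableD k f g : nderivable k f -> nderivable k g ->
  nderivable k (fun x => f x + g x).
Proof.
elim: k f g => // k IH f g [df nf] [dg ng].
apply: (@nderivable_is_derive _ _ (fun x => (derive1 f) x + (derive1 g) x)); last exact: IH.
by move=> x; apply: is_deriveD_fun; rewrite derive1E; exact/derivableP.
Qed.

Lemma nderivableM k f g : nderivable k f -> nderivable k g ->
  nderivable k (fun x => f x * g x).
Proof.
elim: k f g => // k IH f g Hf Hg; have [df nf] := Hf; have [dg ng] := Hg.
apply: (@nderivable_is_derive _ _ (fun x => f x * (derive1 g) x + g x * (derive1 f) x)).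
  by move=> x; apply: is_deriveM_fun; rewrite derive1E; exact/derivableP.
by apply: nderivableD; apply: IH => //; exact: nderivableS.
Qed.

Lemma smoothD f g : smooth f -> smooth g -> smooth (fun x => f x + g x).
Proof. by move=> sf sg k; exact: nderivableD. Qed.

Lemma smoothM f g : smooth f -> smooth g -> smooth (fun x => f x * g x).
Proof. by move=> sf sg k; exact: nderivableM. Qed.

Lemma smooth_cst (c : R) : smooth (fun=> c).
Proof.
apply: (@smooth_class (fun f => exists c, f = fun=> c)); last by exists c.
move=> _ [d ->]; exists (fun=> 0); first by exists 0.
by move=> x; exact: is_derive_cst.
Qed.

Lemma smoothN f : smooth f -> smooth (fun x => - f x).
Proof.
by move=> sf; rewrite (_ : (fun _ => _) = (fun x => -1 * f x));
  [exact: smoothM (smooth_cst _) sf|apply/funext => x; rewrite mulN1r].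
Qed.

Lemma smoothB f g : smooth f -> smooth g -> smooth (fun x => f x - g x).
Proof. by move=> sf sg; exact/smoothD/smoothN. Qed.

Lemma is_derive_affine (c d x : R) : is_derive x (1 : R) (fun t => c * t + d) c.
Proof.
have h := is_deriveD_fun (is_deriveM_fun (is_derive_cst c x 1) (is_derive_id x 1)) (is_derive_cst d x 1).
by apply: is_derive_eq h _; rewrite /= mulr1 mulr0 !addr0.
Qed.

Lemma is_derive_comp_affine f (df c d x : R) : is_derive (c * x + d) (1 : R) f df ->
  is_derive x (1 : R) (fun t => f (c * t + d)) (c * df).
Proof.
move=> hf; have h := @is_derive1_comp _ f (fun t => c * t + d) x df c hf (is_derive_affine c d x).
by apply: is_derive_eq h _; rewrite mulrC.
Qed.

Lemma smooth_comp_affine f (c d : R) : smooth f -> smooth (fun t => f (c * t + d)).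
Proof.
move=> sf k; elim: k f sf => // k IH f sf.
apply: (@nderivable_is_derive _ _ (fun x => c * (derive1 f) (c * x + d))).
  by move=> x; apply: is_derive_comp_affine; exact: smooth_is_derive.
by apply: nderivableM; [exact: smooth_cst|apply: IH; exact: smooth_derive1].
Qed.

End smooth1.

(** * A smooth step function *)

Section bump.
Context {R : realType}.
Implicit Types (f g : R -> R) (P : {poly R}) (t x : R).

(* All derivatives of exp (- 1 / t) are of this form. *)
Definition poly_exp P t : R := if 0 < t then P.[t^-1] * expR (- t^-1) else 0.

(** With y = 1 / t, the bound y^(i+2) <= (i+2)! e^y turns each monomial y^i e^(-y) into at most
    (i+2)! t^2. A quadratic bound is what yields a zero derivative at the origin. *)
Lemma poly_exp_le P : exists2 C, 0 <= C & forall t, `|poly_exp P t| <= C * t ^+ 2.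
Proof.
exists (\sum_(i < size P) `|P`_i| * (i.+2)`!%:R).
  by apply: sumr_ge0 => i _; rewrite mulr_ge0.
move=> t; rewrite /poly_exp; case: ifPn => t0; last first.
  rewrite normr0 mulr_ge0 ?sqr_ge0//; apply: sumr_ge0 => i _; exact: mulr_ge0.
rewrite normrM (ger0_norm (expR_ge0 _)) horner_coef.
apply: (@le_trans _ _ (\sum_(i < size P) `|P`_i * t^-1 ^+ i| * expR (- t^-1))).
  by rewrite -mulr_suml ler_wpM2r ?expR_ge0// ler_norm_sum.
rewrite mulr_suml; apply: ler_sum => i _; rewrite normrM -!mulrA ler_wpM2l//.
have y0 : 0 < t^-1 by rewrite invr_gt0.
rewrite ger0_norm ?exprn_ge0 ?(ltW y0)//.
have H : t^-1 ^+ i.+2 / i.+2`!%:R <= expR t^-1.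
  by apply: le_trans (expR_ge1Dxn i.+1 (ltW y0)); rewrite lerDr.
have {}H : t^-1 ^+ i.+2 <= expR t^-1 * i.+2`!%:R.
  by move: H; rewrite ler_pdivrMr ?ltr0n ?fact_gt0.
have tn : t != 0 by rewrite gt_eqF.
have -> : t^-1 ^+ i = t^-1 ^+ i.+2 * t ^+ 2 by rewrite -addn2 exprD -mulrA -exprMn mulVf// expr1n mulr1.
rewrite expRN mulrAC. apply: ler_wpM2r; first exact: sqr_ge0.
by rewrite ler_pdivrMr ?expR_gt0// mulrC.
Qed.

Lemma is_derive_0_sqr_bound f (C : R) : (forall t, `|f t| <= C * t ^+ 2) ->
  is_derive (0 : R) (1 : R) f 0.
Proof.
move=> H; have f0 : f 0 = 0 by apply/eqP; rewrite -normr_le0 (le_trans (H 0))// expr0n mulr0.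
have L : h^-1 *: ((f \o shift 0) (h *: (1 : R)) - f 0) @[h --> (0:R)^'] --> (0 : R).
  apply/cvgrPdist_le => /= e e0; near=> h.
  have h0 : h != 0 by near: h; exact: nbhs_dnbhs_neq.
  rewrite sub0r normrN f0 subr0 addr0 [h *: 1]mulr1 [_ *: _]mulrC normrM normfV.
  rewrite ler_pdivrMr ?normr_gt0//; apply: le_trans (H h) _.
  have -> : h ^+ 2 = `|h| * `|h| by rewrite -normrM -expr2 ger0_norm ?sqr_ge0.
  rewrite mulrA ler_wpM2r//.
  have Ch : `|C| + 1 > 0 by rewrite ltr_wpDl.
  have : `|h| <= e / (`|C| + 1).
    near: h; apply: dnbhs0_le; exact: divr_gt0.
  rewrite ler_pdivlMr// => hh; apply: le_trans hh; rewrite mulrC ler_wpM2l//.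
  by rewrite (le_trans (ler_norm _))// lerDl.
apply: DeriveDef; first by apply/cvg_ex; exists 0.
exact/cvg_lim.
Unshelve. all: by end_near. Qed.

(** For t > 0 the derivative of P(1/t) e^(-1/t) is t^(-2) (P - P')(1/t) e^(-1/t), which explains the
    new polynomial; at 0 the quadratic bound applies. *)
Lemma is_derive_poly_exp P t :
  is_derive t (1 : R) (poly_exp P) (poly_exp ('X^2 * (P - P^`())) t).
Proof.
have [t0|t0|->] := ltgtP t 0.
- rewrite [X in is_derive _ _ _ X]/poly_exp ltNge ltW //=.
  apply: (@near_eq_is_derive _ _ _ (fun=> 0)).
  near=> s; rewrite /poly_exp ltNge ltW//=.
  by near: s; exact: lt_nbhsl.
- rewrite [X in is_derive _ _ _ X]/poly_exp t0.
  apply: (@near_eq_is_derive _ _ _ (fun t => P.[t^-1] * expR (- t^-1))).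
    near=> s; rewrite /poly_exp; rewrite (_ : 0 < s)//.
    by near: s; exact: lt_nbhsr.
  have tn : t != 0 by rewrite gt_eqF.
  have dV : is_derive t (1 : R) (fun s : R => s^-1) (- (t ^- 2)).
    have h := @is_deriveV _ id t 1 1 tn (is_derive_id t 1).
    by apply: is_derive_eq h _; rewrite [_ *: _]mulr1.
  have dP : is_derive t^-1 (1 : R) (horner P) (P^`()).[t^-1].
    by rewrite derivE; rewrite derive1E; apply/derivableP/derivable_horner.
  have d1 := is_derive1_comp dP dV.
  have dN : is_derive t (1 : R) (fun s : R => - s^-1) (t ^- 2).
    by have h := is_deriveN dV; apply: is_derive_eq h _; rewrite opprK.
  have d2 := @is_derive1_comp _ expR (fun s => - s^-1) t _ _ (is_derive_expR (- t^-1)) dN.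
  have h := is_deriveM_fun d1 d2.
  apply: is_derive_eq h _ => /=; rewrite !hornerE /= exprVn; ring.
- rewrite [X in is_derive _ _ _ X]/poly_exp ltxx.
  have [C C0 H] := poly_exp_le P; exact: is_derive_0_sqr_bound H.
Unshelve. all: by end_near. Qed.

Lemma smooth_poly_exp P : smooth (poly_exp P).
Proof.
apply: (@smooth_class _ (fun f => exists P, f = poly_exp P)); last by exists P.
move=> _ [Q ->]; exists (poly_exp ('X^2 * (Q - Q^`()))); first by eexists.
by move=> x; exact: is_derive_poly_exp.
Qed.

Lemma primitive_exists f (a : R) : continuous f -> (forall t, t <= a -> f t = 0) ->
  (* The integral starts at a - 1, so that every t > a - 1 lies strictly inside the interval of
     integration, while the primitive still vanishes up to a. *)
  exists2 F : R -> R, (forall t, is_derive t (1 : R) F (f t)) & forall t, t <= a -> F t = 0.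
Proof.
move=> cf f0; pose F x := (\int[lebesgue_measure]_(t in `[a - 1, x]) f t)%R.
have F0 t : t <= a -> F t = 0.
  move=> ta; rewrite /F (@eq_Rintegral _ _ _ lebesgue_measure _ (fun=> 0)).
    by rewrite /Rintegral integral0.
  by move=> x; rewrite inE /= in_itv /= => /andP[_ xt]; apply: f0; exact: le_trans ta.
exists F => // t; have [ta|ta] := ltP (a - 1) t; last first.
  rewrite f0; last lra.
  apply: (@near_eq_is_derive _ _ _ (fun=> 0)).
  near=> s; rewrite F0//; apply/ltW; near: s; apply: lt_nbhsl; lra.
have [|d dE] := @continuous_FTC1_closed _ f (a - 1) t (t + 1) ltac:(lra) _ ta (cf t).
  apply: continuous_compact_integrable; first exact: segment_compact.
  exact: continuous_subspaceT.
by apply: DeriveDef; [exact: d|rewrite -derive1E; exact: dE].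
Unshelve. all: by end_near. Qed.

(** The step is the primitive of e(t) e(1 - t), with e(t) = exp(-1/t) for t > 0, divided by its
    value at 1. *)
Lemma smooth_step_exists : exists s : R -> R,
  [/\ smooth s, (forall t, t <= 0 -> s t = 0), (forall t, 1 <= t -> s t = 1) &
     forall t, 0 <= (derive1 s) t].
Proof.
pose e := poly_exp 1.
have e_ge0 t : 0 <= e t by rewrite /e /poly_exp; case: ifP; rewrite // hornerE mul1r expR_ge0.
have e_gt0 t : 0 < t -> 0 < e t by rewrite /e /poly_exp => ->; rewrite hornerE mul1r expR_gt0.
have e0 t : t <= 0 -> e t = 0 by rewrite /e /poly_exp ltNge => ->.
pose b t := e t * e (-1 * t + 1).
have sb : smooth b.
  by apply: smoothM; [|apply: smooth_comp_affine]; exact: smooth_poly_exp.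
have b0 t : t <= 0 -> b t = 0 by move=> /e0; rewrite /b => ->; rewrite mul0r.
have b1 t : 1 <= t -> b t = 0 by move=> t1; rewrite /b [X in _ * X]e0 ?mulr0//; lra.
have b_ge0 t : 0 <= b t by rewrite mulr_ge0.
have [B dB B0] := primitive_exists (smooth_continuous sb) b0.
have cB : continuous B.
  by move=> t; apply/differentiable_continuous/derivable1_diffP; have [] := dB t.
have B1 t : 1 <= t -> B t = B 1.
  move=> t1; have [] := MVT_segment t1 (fun x _ => dB x); first exact: continuous_subspaceT.
  move=> c; rewrite in_itv /= => /andP[c1 _]; rewrite b1// mul0r => /eqP.
  by rewrite subr_eq0 => /eqP.
have B1_gt0 : 0 < B 1.
  have [] := MVT (@ltr01 R) (fun x _ => dB x); first exact: continuous_subspaceT.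
  move=> c; rewrite in_itv /= => /andP[c0 c1]; rewrite (B0 0)// !subr0 mulr1 => ->.
  by rewrite /b mulr_gt0// e_gt0//; lra.
have sB : smooth B by exact: smooth_primitive dB sb.
have ds x : is_derive x (1 : R) (fun t => (B 1)^-1 * B t) ((B 1)^-1 * b x).
  have h := is_deriveM_fun (is_derive_cst (B 1)^-1 x 1) (dB x).
  apply: is_derive_eq h _; rewrite -[RHS]addr0; congr (_ + _); exact: mulr0.
exists (fun t => (B 1)^-1 * B t); split.
- by apply: smoothM => //; exact: smooth_cst.
- by move=> t t0; rewrite (B0 t)// mulr0.
- by move=> t t1; rewrite (B1 t)// mulVf// gt_eqF.
- by move=> t; rewrite (is_derive_derive1 ds) mulr_ge0// invr_ge0 ltW.
Qed.

End bump.

(** * Tensor products and partitions of unity *)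

Section tensor.
Context {R : realType} {n : nat}.
Implicit Types (a : 'I_n -> R -> R) (x : 'rV[R]_n) (l r : 'I_n -> R).

Definition tensor a x : R := \prod_(i < n) a i (x ord0 i).

Definition cbox l r : set 'rV[R]_n := [set x | forall i, l i <= x ord0 i <= r i].

Lemma closed_cbox l r : closed (cbox l r).
Proof.
rewrite (_ : cbox l r = \bigcap_(i in [set: 'I_n]) ((fun x : 'rV[R]_n => x ord0 i) @^-1` [set t | l i <= t <= r i])).
  apply: closed_bigI => i _; apply: preimage_closed => [x _|]; first exact: coord_continuous_rV.
  rewrite (_ : [set t | _] = `[l i, r i]%classic); first exact: itv_closed.
  by apply/seteqP; split=> t; rewrite /= in_itv.
by apply/seteqP; split=> x H i; [move=> _|have := H i Logic.I]; rewrite /= ; [exact: H|].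
Qed.

Lemma compact_cbox l r : compact (cbox l r).
Proof.
apply: bounded_closed_compact; last exact: closed_cbox.
exists (\sum_i (`|l i| + `|r i|)); split; first exact: num_real.
move=> M HM x Hx /=; have M0 : 0 <= M by rewrite (le_trans _ (ltW HM))// sumr_ge0// => i _; rewrite addr_ge0.
apply: rV_norm_le => // i; apply: le_trans (ltW HM).
rewrite (bigD1 i)//=; apply: le_trans (_ : `|l i| + `|r i| <= _); last first.
  by rewrite lerDl sumr_ge0// => j _; rewrite addr_ge0.
have /andP[h1 h2] := Hx i; have := ler_norm (r i); have := ler_norm (- l i).
by rewrite normrN ler_norml => ? ?; apply/andP; split; have := normr_ge0 (l i); have := normr_ge0 (r i); lra.
Qed.

Lemma continuous_tensor a : (forall i, continuous (a i)) -> continuous (tensor a).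
Proof.
move=> ca; rewrite /tensor => x.
rewrite (_ : (fun _ => _) = \prod_(i < n) (fun x : 'rV[R]_n => a i (x ord0 i))); last first.
  by apply/funext => y; rewrite fct_prodE.
elim/big_ind: _ => [|f g cf cg|i _]; first exact: cst_continuous.
  exact: continuousM.
by apply: continuous_comp; [exact: coord_continuous_rV|exact: ca].
Qed.

Lemma is_derive_tensor a x (i : 'I_n) (df : R) : is_derive (x ord0 i) (1 : R) (a i) df ->
  is_derive x (delta_mx ord0 i) (tensor a) (df * \prod_(j < n | j != i) a j (x ord0 j)).
Proof.
move=> H; apply/is_derive_line0.
rewrite (_ : (fun _ => _) = (fun s => (\prod_(j < n | j != i) a j (x ord0 j)) * a i (1 * s + x ord0 i))); last first.
  apply/funext => s; rewrite /tensor (bigD1 i)//= !mxE !eqxx mulr1 mul1r mulrC; congr (_ * _).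
  by apply: eq_bigr => j ji; rewrite !mxE eqxx (negbTE ji) mulr0 add0r.
have h0 : is_derive (1 * 0 + x ord0 i) (1 : R) (a i) df by rewrite mul1r add0r.
have h := is_deriveM_fun (is_derive_cst (\prod_(j < n | j != i) a j (x ord0 j)) (0:R) 1) (is_derive_comp_affine h0).
by apply: is_derive_eq h _ => /=; rewrite !mul1r mulr0 addr0 mulrC.
Qed.

Definition tensor_derive a (i : 'I_n) : 'I_n -> R -> R :=
  fun j => if j == i then derive1 (a j) else a j.

Lemma is_derive_smooth_tensor a x (i : 'I_n) : (forall j, smooth (a j)) ->
  is_derive x (delta_mx ord0 i) (tensor a) (tensor (tensor_derive a i) x).
Proof.
move=> sa; have h := is_derive_tensor (smooth_is_derive (x ord0 i) (sa i)).
apply: is_derive_eq h _; rewrite /tensor [RHS](bigD1 i)//= /tensor_derive eqxx; congr (_ * _).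
by apply: eq_bigr => j /negbTE ->.
Qed.

Lemma partial_tensor a (i : 'I_n) : (forall j, smooth (a j)) ->
  partial i (tensor a) = tensor (tensor_derive a i).
Proof.
by move=> sa; apply/funext => x; have [_ <-] := is_derive_smooth_tensor x i sa.
Qed.

(** Products with smooth factors are stable under every partial derivative, which settles the
    conditions of [Ck] at all orders at once. *)
Lemma partials_tensor a (s : seq 'I_n) : (forall j, smooth (a j)) ->
  exists2 b, (forall j, smooth (b j)) & partials s (tensor a) = tensor b.
Proof.
move=> sa; elim: s => [|i s [b sb IH]]; first by exists a.
rewrite /= IH partial_tensor//; exists (tensor_derive b i) => // j.
by rewrite /tensor_derive; case: ifP => // _; exact: smooth_derive1.
Qed.

Lemma Ck_tensor a k : (forall j, smooth (a j)) -> Ck k setT (tensor a).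
Proof.
move=> sa s x _; have [b sb ->] := partials_tensor s sa; split=> _.
  by apply: continuous_tensor => i; exact: smooth_continuous.
by move=> i; have [] := is_derive_smooth_tensor x i sb.
Qed.

Lemma tensor_eq0 a l r x : (forall i t, ~~ (l i <= t <= r i) -> a i t = 0) ->
  ~ cbox l r x -> tensor a x = 0.
Proof.
move=> a0 /existsNP[i /negP xi]; rewrite /tensor (bigD1 i)//= a0 ?mul0r//.
Qed.

Lemma Cc_infty_tensor (Omega : set 'rV[R]_n) a l r :
  (forall i, smooth (a i)) -> (forall i t, ~~ (l i <= t <= r i) -> a i t = 0) ->
  cbox l r `<=` Omega -> Cc_infty Omega (tensor a).
Proof.
move=> sa a0 sub; split; first by move=> k; exact: Ck_tensor.
exists (cbox l r); first exact: compact_cbox.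
by split=> // x; exact: tensor_eq0.
Qed.

End tensor.

(** * Partitions of unity and uniform approximation by tensor products *)

Section step.
Context {R : realType}.
Implicit Types t : R.

Definition step : R -> R := sval (cid (@smooth_step_exists R)).

Lemma smooth_step : smooth step.
Proof. by rewrite /step; case: cid => s []. Qed.

Lemma step_le0 t : t <= 0 -> step t = 0.
Proof. by rewrite /step; case: cid => s [] /= ? H _ _; exact: H. Qed.

Lemma step_ge1 t : 1 <= t -> step t = 1.
Proof. by rewrite /step; case: cid => s [] /= ? _ H _; exact: H. Qed.

Lemma derive1_step_ge0 t : 0 <= (derive1 step) t.
Proof. by rewrite /step; case: cid => s [] /= ? _ _ H; exact: H. Qed.

Lemma step_ndecr (x y : R) : x <= y -> step x <= step y.
Proof.
move=> xy; have [] := MVT_segment xy (fun z _ => smooth_is_derive z smooth_step).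
  exact/continuous_subspaceT/smooth_continuous/smooth_step.
by move=> c _; rewrite -subr_ge0 => ->; rewrite mulr_ge0 ?subr_ge0// derive1_step_ge0.
Qed.

Lemma step_ge0 t : 0 <= step t.
Proof.
have [t0|t0] := leP t 0; first by rewrite step_le0.
by rewrite -(step_le0 (lexx 0)); apply: step_ndecr; exact: ltW.
Qed.

Lemma step_le1 t : step t <= 1.
Proof.
have [t0|t0] := leP 1 t; first by rewrite step_ge1.
by rewrite -(step_ge1 (lexx 1)); apply: step_ndecr; exact: ltW.
Qed.

(** A difference of consecutive translates of [step], so that sums over integer translates telescope
    and form a partition of unity. *)
Definition hat t := step (t + 1) - step t.

Lemma hat_ge0 t : 0 <= hat t.
Proof. by rewrite subr_ge0 step_ndecr// lerDl. Qed.

Lemma hat_eq0 t : 1 < `|t| -> hat t = 0.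
Proof.
rewrite /hat ltr_normr orbC => /orP[t1|t1].
  by rewrite !step_le0 ?subrr//; lra.
by rewrite !step_ge1 ?subrr//; lra.
Qed.

Lemma smooth_hat c d : smooth (fun t => hat (c * t + d)).
Proof.
apply: smooth_comp_affine; apply: smoothB; last exact: smooth_step.
rewrite (_ : (fun _ => _) = (fun t => step (1 * t + 1))); last by apply/funext => t; rewrite mul1r.
exact/smooth_comp_affine/smooth_step.
Qed.

Lemma sum_hat t N : \sum_(k < N) hat (t - k%:R) = step (t + 1) - step (t + 1 - N%:R).
Proof.
elim: N => [|N IH]; first by rewrite big_ord0 subr0 subrr.
rewrite big_ord_recr /= IH /hat (_ : t - N%:R + 1 = t + 1 - N%:R); last by ring.
rewrite (_ : t + 1 - N.+1%:R = t - N%:R); first by ring.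
by rewrite -natr1; ring.
Qed.

Lemma smooth_grid (M e : R) : 0 < e -> exists (N : nat) (a : 'I_N -> R -> R) (p : 'I_N -> R),
  [/\ (forall k, smooth (a k)), (forall k t, 0 <= a k t),
      (forall k t, e < `|t - p k| -> a k t = 0) &
      (forall t, `|t| <= M -> \sum_k a k t = 1)].
Proof.
(* N - 1 exceeds 2|M| / e, so that the subtracted translate left by telescoping still vanishes on
   [-M, M]. *)
move=> e0; pose N := (Num.bound ((`|M| + `|M|) / e)).+1.
exists N, (fun k t => hat (e^-1 * t + (M / e - k%:R))), (fun k => e * k%:R - M); split.
- by move=> k; exact: smooth_hat.
- by move=> k t; exact: hat_ge0.
- move=> k t H; apply: hat_eq0.
  rewrite (_ : e^-1 * t + _ = e^-1 * (t - (e * k%:R - M))); last by field; rewrite gt_eqF.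
  by rewrite normrM gtr0_norm ?invr_gt0// mulrC ltr_pdivlMr// mul1r.
- move=> t; rewrite ler_norml => /andP[t1 t2].
  under eq_bigr do rewrite addrA; rewrite sum_hat.
  have h : e^-1 * t + M / e = (t + M) / e by rewrite mulrDl mulrC.
  have h0 : 0 <= (t + M) / e by rewrite divr_ge0 ?(ltW e0)//; lra.
  rewrite h step_ge1; last by rewrite lerDr.
  rewrite step_le0 ?subr0// /N -natr1.
  have : (t + M) / e <= (`|M| + `|M|) / e.
    by rewrite ler_wpM2r ?invr_ge0 ?(ltW e0)//; have := ler_norm M; lra.
  have : (`|M| + `|M|) / e <= (Num.bound ((`|M| + `|M|) / e))%:R.
    by apply/ltW/archi_boundP; rewrite divr_ge0 ?addr_ge0// (ltW e0).
  lra.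
Qed.

(** The product over the coordinates of one-variable partitions of unity, expanded by
    distributivity; hence an index set of functions from ['I_n] to ['I_N]. *)
Lemma tensor_grid n (M e : R) : 0 < e ->
  exists (I : finType) (a : I -> 'I_n -> R -> R) (p : I -> 'rV[R]_n),
  [/\ (forall k i, smooth (a k i)), (forall k (x : 'rV[R]_n), 0 <= tensor (a k) x),
      (forall k i t, e < `|t - p k ord0 i| -> a k i t = 0) &
      (forall x : 'rV[R]_n, `|x| <= M -> \sum_k tensor (a k) x = 1)].
Proof.
move=> e0; have [N [a [p [sa a0 ae aM]]]] := smooth_grid M e0.
exists {ffun 'I_n -> 'I_N}, (fun (f : {ffun 'I_n -> 'I_N}) i => a (f i)), (fun f : {ffun 'I_n -> 'I_N} => \row_i p (f i)); split.
- by move=> k i.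
- by move=> k x; apply: prodr_ge0 => i _.
- by move=> k i t; rewrite mxE; exact: ae.
- move=> x xM; rewrite /tensor -(bigA_distr_bigA (fun i j => a j (x ord0 i))) big1// => i _.
  by apply: aM; apply: le_trans (coord_le_norm x i) xM.
Qed.

Lemma tensor_dist n (a : 'I_n -> R -> R) (p x : 'rV[R]_n) e : 0 <= e ->
  (forall i t, e < `|t - p ord0 i| -> a i t = 0) -> tensor a x != 0 -> `|x - p| <= e.
Proof.
move=> e0 H ax; apply: rV_norm_le => // i; rewrite !mxE leNgt; apply/negP => xe.
by move/eqP : ax; apply; rewrite /tensor (bigD1 i)//= H ?mul0r.
Qed.

Lemma compact_supp_unif_continuous n (th : 'rV[R]_n -> R) (x0 : 'rV[R]_n) (r : R) :
  continuous th -> (forall x, r < `|x - x0| -> th x = 0) ->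
  forall e, 0 < e -> exists2 d, 0 < d & forall x y, `|x - y| <= d -> `|th x - th y| <= e.
Proof.
(* The ball is enlarged by 1: if one of two points at distance at most 1 lies outside [K], then [th]
   vanishes at both. *)
move=> cth th0 e e0; pose K := [set x | `|x - x0| <= r + 1].
have cK : compact K.
  apply: bounded_closed_compact.
    exists (`|x0| + (r + 1)); split; first exact: num_real.
    move=> M HM x Kx /=; apply: le_trans (ltW HM).
    by rewrite -[X in `|X| <= _](subrK x0) addrC (le_trans (ler_normD _ _))// lerD2l.
  rewrite /K (_ : [set x | _] = (fun x => `|x - x0|) @^-1` [set t | t <= r + 1]); last by [].
  apply: preimage_closed; last exact: closed_le.
  by move=> x _; apply: continuous_comp; [apply: continuousB; [exact: cvg_id|exact: cst_continuous]|exact: norm_continuous].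
have /compact_near_coveringP/(_ R (0%R^'+) (fun d x => forall y, `|x - y| <= d -> `|th x - th y| <= e)) := cK.
case=> [x Kx|d /= d0 H].
  have [rho rho0 Hr] : exists2 rho, 0 < rho & forall y, `|x - y| < rho -> `|th x - th y| < e / 2.
    have : nbhs x [set y | `|th x - th y| < e / 2].
      by have /cvgrPdist_lt := cth x; apply; rewrite divr_gt0.
    by move=> /rV_nbhsP.
  exists ([set x' | `|x - x'| < rho / 2], [set d | d < rho / 2]).
    split; last by apply: nbhs_right_lt; rewrite divr_gt0.
    by apply/rV_nbhsP; exists (rho / 2); rewrite ?divr_gt0.
  move=> [x' d] /= [xx' dr] y x'y.
  have h1 : `|th x - th x'| < e / 2 by apply: Hr; apply: lt_trans xx' _; lra.
  have h2 : `|th x - th y| < e / 2.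
    apply: Hr; rewrite -(subrK x' x) -addrA (le_lt_trans (ler_normD _ _))//; lra.
  rewrite (_ : th x' - th y = - (th x - th x') + (th x - th y)); last by ring.
  by rewrite (le_trans (ler_normD _ _))// normrN; lra.
exists (Num.min (d / 2) 1); first by rewrite lt_min; apply/andP; split; lra.
move=> x y; rewrite le_min => /andP[xyd xy1].
have [xK|xK] := leP `|x - x0| (r + 1).
  apply: (H (d / 2)) => //=; last lra.
  by rewrite sub0r normrN gtr0_norm; lra.
rewrite !th0 ?subrr ?normr0 ?(ltW e0)//; last by lra.
have := ler_normD (x - y) (y - x0); rewrite addrA subrK; lra.
Qed.

(** Each piece of a fine partition of unity is weighted by the value of [th] at its centre, and
    uniform continuity bounds the error. Pieces of zero weight may lie anywhere, so supports are
    controlled only where [c k != 0]. *)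
Lemma tensor_approx n (th : 'rV[R]_n -> R) (x0 : 'rV[R]_n) (r d e : R) :
  continuous th -> (forall x, r < `|x - x0| -> th x = 0) -> 0 < d -> 0 < e ->
  exists (I : finType) (a : I -> 'I_n -> R -> R) (c : I -> R),
  [/\ (forall k i, smooth (a k i)),
      (forall k i t, c k != 0 -> r + d < `|t - x0 ord0 i| -> a k i t = 0) &
      (forall x : 'rV[R]_n, `|\sum_k c k * tensor (a k) x - th x| <= e)].
Proof.
move=> cth th0 d0 e0.
have [d' d'0 Hd'] := compact_supp_unif_continuous cth th0 e0.
pose h := Num.min d d'; have h0 : 0 < h by rewrite lt_min d0.
have [I [a [p [sa a0 ah aM]]]] := tensor_grid n (`|x0| + `|r| + d) h0.
exists I, a, (fun k => th (p k)); split => //.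
  move=> k i t thk rt; apply: ah.
  have pk : `|p k - x0| <= r by rewrite leNgt; apply: contraNN thk => /th0 ->.
  have := coord_le_norm (p k - x0) i; rewrite !mxE => pki.
  have := ler_normD (t - p k ord0 i) (p k ord0 i - x0 ord0 i); rewrite addrA subrK.
  have : h <= d by rewrite ge_min lexx.
  lra.
move=> x; have [xM|xM] := leP `|x| (`|x0| + `|r| + d).
  rewrite -[th x]mulr1 -(aM x xM) mulr_sumr -sumrB.
  apply: le_trans (ler_norm_sum _ _ _) _.
  rewrite -[e]mulr1 -(aM x xM) mulr_sumr; apply: ler_sum => k _.
  rewrite -mulrBl normrM [`|tensor _ _|]ger0_norm//.
  have [->|ax] := eqVneq (tensor (a k) x) 0; first by rewrite !mulr0.
  rewrite ler_wpM2r// distrC; apply: Hd'.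
  apply: le_trans (tensor_dist (ltW h0) (ah k) ax) _.
  by rewrite ge_min lexx orbT.
have xx0 : `|r| + d < `|x - x0| by have := ler_normD (x - x0) x0; rewrite subrK; lra.
rewrite (th0 x); last by have := ler_norm r; lra.
rewrite big1 ?subrr ?normr0 ?(ltW e0)// => k _.
have [->|ax] := eqVneq (tensor (a k) x) 0; first by rewrite !mulr0.
rewrite th0 ?mul0r//; have := tensor_dist (ltW h0) (ah k) ax.
have := ler_normD (x - p k) (p k - x0); rewrite addrA subrK.
have : h <= d by rewrite ge_min lexx.
have := ler_norm r; lra.
Qed.

End step.

(** * Real-valued integrals *)

Section real_integrals.
Context d (T : measurableType d) (R : realType) (mu : {measure set T -> \bar R}).
Implicit Types (f g : T -> R) (D : set T).

Definition intg f := mu.-integrable setT (EFin \o f).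

Lemma intg_measurable f : intg f -> measurable_fun setT f.
Proof. by move=> /measurable_int/measurable_EFinP. Qed.

Lemma intg_le g f : intg g -> measurable_fun setT f -> (forall x, `|f x| <= g x) -> intg f.
Proof.
move=> ig mf fg; apply: le_integrable ig => //; first exact/measurable_EFinP.
by move=> x _ /=; rewrite lee_fin (le_trans (fg x))// ler_norm.
Qed.

Lemma intgD f g : intg f -> intg g -> intg (fun x => f x + g x).
Proof. by move=> hf hg; exact: (integrableD _ hf hg). Qed.

Lemma intgZ (c : R) f : intg f -> intg (fun x => c * f x).
Proof. by move=> hf; exact: (integrableZl _ c hf). Qed.

Lemma intgB f g : intg f -> intg g -> intg (fun x => f x - g x).
Proof. by move=> hf hg; exact: (integrableB _ hf hg). Qed.

Lemma intgN f : intg f -> intg (fun x => - f x).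
Proof. by move=> hf; exact: (integrableN hf). Qed.

Lemma intg0 : intg (fun=> 0).
Proof. exact: integrable0. Qed.

Lemma intg_norm f : intg f -> intg (fun x => `|f x|).
Proof. by move=> /integrable_abse. Qed.

Lemma intgM (M : R) f g : intg f -> measurable_fun setT g -> (forall x, `|g x| <= M) ->
  intg (fun x => f x * g x).
Proof.
move=> hf mg gM; apply: (intg_le (intgZ M (intg_norm hf))).
  by apply: measurable_funM => //; exact: intg_measurable.
by move=> x; rewrite normrM mulrC ler_wpM2r.
Qed.

Lemma intg_sum (I : finType) (f : I -> T -> R) : (forall k, intg (f k)) ->
  intg (fun x => \sum_k f k x).
Proof.
move=> hf; rewrite (_ : (fun _ => _) = \sum_k f k); last by apply/funext => x; rewrite fct_sumE.
by elim/big_ind: _ => [|g h hg hh|k _]; [exact: intg0|exact: intgD|exact: hf].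
Qed.

Lemma intD f g : intg f -> intg g -> \int[mu]_x (f x + g x) = \int[mu]_x f x + \int[mu]_x g x.
Proof. by move=> *; exact: RintegralD. Qed.

Lemma intB f g : intg f -> intg g -> \int[mu]_x (f x - g x) = \int[mu]_x f x - \int[mu]_x g x.
Proof. by move=> *; exact: RintegralB. Qed.

Lemma intZ (c : R) f : intg f -> \int[mu]_x (c * f x) = c * \int[mu]_x f x.
Proof. by move=> *; exact: RintegralZl. Qed.

Lemma int0 : \int[mu]_x (0 : R) = 0.
Proof. by rewrite /Rintegral integral0. Qed.

Lemma intN f : intg f -> \int[mu]_x (- f x) = - \int[mu]_x f x.
Proof.
move=> hf; rewrite -sub0r -int0 -intB//; last exact: intg0.
by apply: eq_Rintegral => x _; rewrite sub0r.
Qed.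

Lemma int_sum (I : finType) (f : I -> T -> R) : (forall k, intg (f k)) ->
  \int[mu]_x (\sum_k f k x) = \sum_k \int[mu]_x f k x.
Proof.
move=> hf; rewrite (_ : (fun _ => _) = \sum_k f k); last by apply/funext => x; rewrite fct_sumE.
suff : intg (\sum_k f k) /\ \int[mu]_x (\sum_k f k) x = \sum_k \int[mu]_x f k x by case.
elim/big_ind2: _ => [|g a h b [hg ga] [hh hb]|k _]; last by split; [exact: hf|].
  by split; [exact: intg0|exact: int0].
by split; [exact: intgD|rewrite intD// ga hb].
Qed.

Lemma int_le f g : intg f -> intg g -> (forall x, f x <= g x) -> \int[mu]_x f x <= \int[mu]_x g x.
Proof. by move=> hf hg fg; apply: le_Rintegral. Qed.

Lemma int_ge0 f : (forall x, 0 <= f x) -> 0 <= \int[mu]_x f x.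
Proof. by move=> f0; exact: Rintegral_ge0. Qed.

Lemma int_norm_le f g : intg f -> intg g -> (forall x, `|f x| <= g x) ->
  `|\int[mu]_x f x| <= \int[mu]_x g x.
Proof.
move=> hf hg fg; apply: le_trans (le_normr_Rintegral measurableT hf) _.
by apply: int_le => //; exact: intg_norm.
Qed.

Lemma intg_EFin f : intg f -> (\int[mu]_x (f x)%:E)%E = (\int[mu]_x f x)%:E.
Proof. by move=> hf; rewrite fineK//; exact: integrable_fin_num. Qed.

Lemma int_dominated (f_ : nat -> T -> R) f g : (forall k, measurable_fun setT (f_ k)) ->
  intg g -> (forall k x, `|f_ k x| <= g x) -> (forall x, f_ k x @[k --> \oo] --> f x) ->
  intg f /\ (\int[mu]_x f_ k x) @[k --> \oo] --> \int[mu]_x f x.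
Proof.
move=> mf_ ig fg cf.
have mf : measurable_fun setT f by apply: (measurable_fun_cvg mf_) => x _; exact: cf.
have if_ k : intg (f_ k) by exact: intg_le ig _ _.
have [||||intf _ cvgf] := @dominated_convergence _ _ _ mu setT measurableT (fun k => EFin \o f_ k)
  (EFin \o f) (EFin \o g) _ _ _ ig.
- by move=> k; exact/measurable_EFinP.
- exact/measurable_EFinP.
- by apply: aeW => x _; apply: cvg_EFin; [exact: nearW|exact: cf].
- by apply: aeW => x k _; rewrite lee_fin.
by split => //; apply: fine_cvg; move: cvgf; rewrite /= intg_EFin.
Qed.

Lemma integrable_restrictT D f : measurable D ->
  mu.-integrable D (EFin \o f) <-> intg (f \_ D).
Proof.
by move=> mD; rewrite (integrable_mkcond _ mD) restrict_EFin.
Qed.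

Lemma intg_indic D : measurable D -> (mu D < +oo)%E -> intg (\1_D : T -> R).
Proof.
move=> mD Doo; apply/integrableP; split; first exact/measurable_EFinP.
by under eq_integral do rewrite /= ger0_norm//; rewrite integral_indic// setIT.
Qed.

Lemma intg_ae f g : measurable_fun setT g -> {ae mu, forall x, f x = g x} -> intg f ->
  intg g /\ \int[mu]_x f x = \int[mu]_x g x.
Proof.
move=> mg fg hf; have mf := intg_measurable hf.
split.
  apply/integrableP; split; first exact/measurable_EFinP.
  have /integrableP[_] := hf; congr (_ < _)%E.
  apply: ae_eq_integral => //; [exact/measurableT_comp/measurable_EFinP|exact/measurableT_comp/measurable_EFinP|].
  by apply: filterS fg => x /= -> _.
congr fine; apply: ae_eq_integral => //; [exact/measurable_EFinP|exact/measurable_EFinP|].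
by apply: filterS fg => x /= -> _.
Qed.

Lemma int_le_ae f g : intg f -> intg g ->
  {ae mu, forall x, f x <= g x} -> \int[mu]_x f x <= \int[mu]_x g x.
Proof.
move=> If Ig fg; pose m x := Num.max (f x) (g x).
have mm : measurable_fun setT m by exact: measurable_maxr (intg_measurable If) (intg_measurable Ig).
have gm : {ae mu, forall x, g x = m x} by apply: filterS fg => x fgx; rewrite /m max_r.
have [Im ->] := intg_ae mm gm Ig.
by apply: (int_le If Im) => x; rewrite /m le_max lexx.
Qed.

End real_integrals.

Section rV_integrals.
Context {R : realType} {n : nat}.
Local Notation mu := (@lebesgue_rV R n).
Implicit Types (f g th w : 'rV[R]_n -> R) (x v : 'rV[R]_n).

Lemma intg_shift v f : intg mu f -> intg mu (fun x => f (x + v)).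
Proof. exact: integrable_shift. Qed.

Lemma int_shift v f : intg mu f -> \int[mu]_x f (x + v) = \int[mu]_x f x.
Proof.
move=> hf; congr fine; apply: (integral_shift (f := EFin \o f)).
  by apply/measurable_EFinP; exact: intg_measurable hf.
exact: intg_shift.
Qed.

Lemma continuous_measurable_rVT f : continuous f -> measurable_fun setT f.
Proof.
move=> cf; apply: continuous_measurable_rV => //; exact: continuous_subspaceT.
Qed.

(** In the sup norm this closed ball is a closed box (see [nballE]), hence a natural support for
    tensor products. *)
Definition nball x (r : R) : set 'rV[R]_n := [set y | `|y - x| <= r].

Lemma closed_nball x r : closed (nball x r).
Proof.
rewrite /nball (_ : [set y | _] = (fun y => `|y - x|) @^-1` [set t | t <= r])//.
apply: preimage_closed; last exact: closed_le.
by move=> y _; apply: continuous_comp; [apply: continuousB; [exact: cvg_id|exact: cst_continuous]|exact: norm_continuous].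
Qed.

Lemma bounded_nball x r : bounded_set (nball x r).
Proof.
exists (`|x| + r); split; first exact: num_real.
move=> M HM y Ky /=; apply: le_trans (ltW HM).
by rewrite -[X in `|X| <= _](subrK x) addrC (le_trans (ler_normD _ _))// lerD2l.
Qed.

Lemma compact_nball x r : compact (nball x r).
Proof. by apply: bounded_closed_compact; [exact: bounded_nball|exact: closed_nball]. Qed.

Lemma measurable_nball x r : measurable (nball x r).
Proof. by apply: closed_measurable_rV; exact: closed_nball. Qed.

Lemma compact_bounded_fun (A : set 'rV[R]_n) f : compact A -> {within A, continuous f} ->
  exists2 M : R, 0 <= M & forall x, A x -> `|f x| <= M.
Proof.
move=> cA cf; have := compact_bounded (continuous_compact cf cA).
move=> [M [Mr MA]]; exists (`|M| + 1); first by rewrite addr_ge0.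
move=> x Ax; apply: MA; last by exists x.
by rewrite (le_lt_trans (ler_norm _))// ltrDl.
Qed.

Lemma continuous_supp_bounded x0 (r : R) f : continuous f -> (forall x, r < `|x - x0| -> f x = 0) ->
  exists2 M : R, 0 <= M & forall x, `|f x| <= M.
Proof.
move=> cf f0; have [|M M0 H] := @compact_bounded_fun (nball x0 r) f (@compact_nball x0 r).
  exact: continuous_subspaceT.
exists M => // x; have [xr|xr] := leP `|x - x0| r; first exact: H.
by rewrite f0// normr0.
Qed.

Lemma intg_bounded_supp x0 (r M : R) f : measurable_fun setT f -> (forall x, `|f x| <= M) ->
  (forall x, r < `|x - x0| -> f x = 0) -> intg mu f.
Proof.
move=> mf fM f0; apply: (@intg_le _ _ _ _ (fun x => M * \1_(nball x0 r) x)) => //.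
  apply: intgZ; apply: intg_indic; first exact: measurable_nball.
  by apply: bounded_lebesgue_lty; [exact: measurable_nball|exact: bounded_nball].
move=> x; have [xr|xr] := leP `|x - x0| r.
  by rewrite indicE mem_set// mulr1.
by rewrite f0// normr0 mulr_ge0//; apply: le_trans (fM x).
Qed.

End rV_integrals.

(** * Replacing one factor of a tensor product *)

Section tensor_update.
Context {R : realType} {n : nat}.
Implicit Types (a : 'I_n -> R -> R) (F : R -> R) (i : 'I_n) (x : 'rV[R]_n).

Definition upd a i F : 'I_n -> R -> R := fun j => if j == i then F else a j.

Lemma tensor_upd a i F x :
  tensor (upd a i F) x = F (x ord0 i) * \prod_(j < n | j != i) a j (x ord0 j).
Proof.
rewrite /tensor (bigD1 i)//= /upd eqxx; congr (_ * _).
by apply: eq_bigr => j /negbTE ->.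
Qed.

Lemma upd_id a i : upd a i (a i) = a.
Proof. by apply/funext => j; rewrite /upd; case: eqP => [->|]. Qed.

Lemma tensor_upd_shift a i F x (h : R) :
  tensor (upd a i F) (x - h *: delta_mx ord0 i) = tensor (upd a i (fun t => F (t - h))) x.
Proof.
rewrite !tensor_upd !mxE !eqxx mulr1; congr (_ * _); apply: eq_bigr => j ji.
by rewrite !mxE eqxx (negbTE ji) mulr0 subr0.
Qed.

Lemma tensor_updB a i F1 F2 x :
  tensor (upd a i (fun t => F1 t - F2 t)) x = tensor (upd a i F1) x - tensor (upd a i F2) x.
Proof. by rewrite !tensor_upd mulrBl. Qed.

Lemma tensor_derive_upd a i F F' : (forall t, is_derive t (1 : R) F (F' t)) ->
  tensor (tensor_derive (upd a i F) i) = tensor (upd a i F').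
Proof.
move=> FF'; congr tensor; apply/funext => j; rewrite /tensor_derive /upd.
by case: (j == i) => //; rewrite (is_derive_derive1 FF').
Qed.

Lemma is_derive_tensor_upd a i F F' x : (forall t, is_derive t (1 : R) F (F' t)) ->
  is_derive x (delta_mx ord0 i) (tensor (upd a i F)) (tensor (upd a i F') x).
Proof.
move=> FF'; have h : is_derive (x ord0 i) (1 : R) (upd a i F i) (F' (x ord0 i)).
  by rewrite /upd eqxx.
apply: is_derive_eq (is_derive_tensor h) _; rewrite tensor_upd; congr (_ * _).
by apply: eq_bigr => j /negbTE ji; rewrite /upd ji.
Qed.

Lemma smooth_upd a i F : smooth F -> (forall j, smooth (a j)) -> forall j, smooth (upd a i F j).
Proof. by move=> sF sa j; rewrite /upd; case: ifP. Qed.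

Lemma tensor_supp0 a (x0 x : 'rV[R]_n) (r : R) : 0 <= r ->
  (forall j t, r < `|t - x0 ord0 j| -> a j t = 0) -> r < `|x - x0| -> tensor a x = 0.
Proof.
move=> r0 H xr; apply: contraTeq xr => /(tensor_dist r0 H); by rewrite -leNgt.
Qed.

End tensor_update.

Section line_mvt.
Context {R : realType} {V : normedModType R}.

Lemma MVT_dir (f df : V -> R) (x v : V) (h : R) : 0 < h ->
  (forall t, 0 <= t <= h -> is_derive (t *: v + x) v f (df (t *: v + x))) ->
  exists2 t, 0 <= t <= h & f (h *: v + x) - f x = h * df (t *: v + x).
Proof.
move=> h0 H; have [t|c|c] := @MVT R (fun t => f (t *: v + x)) (fun t => df (t *: v + x)) 0 h h0.
- rewrite in_itv /= => /andP[t0 th]; apply/is_derive_line; apply: H.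
  by rewrite !ltW.
- apply: continuous_in_subspaceT => t; rewrite inE /= in_itv /= => t0h.
  have [d _] := (is_derive_line f x v t _).2 (H _ t0h).
  exact/differentiable_continuous/derivable1_diffP.
- rewrite in_itv /= => /andP[t0 th]; rewrite scale0r add0r subr0 => ->.
  by exists c; rewrite ?ltW// mulrC.
Qed.

End line_mvt.

(** * Difference quotients and the chain rule *)

Section discrete_weak.
Context {R : realType} {n : nat}.
Local Notation mu := (@lebesgue_rV R n).
Implicit Types (f g th w G : 'rV[R]_n -> R) (x v : 'rV[R]_n) (i : 'I_n).
Local Notation e_ i := (delta_mx ord0 i : 'rV[R]_n).

(* Tensor products suffice as test functions: they are dense, and have explicit
   primitives in each direction. *)
Definition ball_weak (x0 : 'rV[R]_n) (rho : R) i w G :=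
  forall a, (forall j, smooth (a j)) ->
    (forall j t, rho < `|t - x0 ord0 j| -> a j t = 0) ->
    \int[mu]_x (w x * tensor (tensor_derive a i) x) = - \int[mu]_x (G x * tensor a x).

Lemma tensor_bounded (a : 'I_n -> R -> R) (x0 : 'rV[R]_n) (r : R) : 0 <= r -> (forall j, smooth (a j)) ->
  (forall j t, r < `|t - x0 ord0 j| -> a j t = 0) -> exists2 M : R, 0 <= M & forall x, `|tensor a x| <= M.
Proof.
move=> r0 sa a0; apply: (@continuous_supp_bounded _ _ x0 r).
  by apply: continuous_tensor => j; exact: smooth_continuous.
by move=> x; exact: tensor_supp0.
Qed.

Lemma smooth_tensor_measurable (a : 'I_n -> R -> R) : (forall j, smooth (a j)) ->
  measurable_fun setT (tensor a).
Proof.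
by move=> sa; apply: continuous_measurable_rVT; apply: continuous_tensor => j; exact: smooth_continuous.
Qed.

(** If F is a primitive of the i-th factor, F(t) - F(t - h) has compact support although F need not,
    and the product having it as i-th factor is a test function whose i-th derivative is exactly the
    increment of the original product. The weak identity thus becomes an identity for increments.
    The support condition is guarded by [c != 0] to match [tensor_approx]. *)
Lemma tensor_translate (x0 : 'rV[R]_n) (r h rho c : R) i w G (a : 'I_n -> R -> R) :
  0 <= r -> 0 < h -> r + h <= rho -> intg mu w -> intg mu G -> ball_weak x0 rho i w G ->
  (forall j, smooth (a j)) ->
  (forall j t, c != 0 -> r < `|t - x0 ord0 j| -> a j t = 0) ->
  exists Phi : 'rV[R]_n -> R, [/\ (forall x, is_derive x (e_ i) Phi (c * tensor a x)),
    measurable_fun setT Phi,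
    exists M : R, forall x, `|Phi x - Phi (x - h *: e_ i)| <= M,
    exists M : R, forall x, `|c * tensor a x| <= M &
    \int[mu]_x (w x * (c * tensor a (x - h *: e_ i) - c * tensor a x)) =
    \int[mu]_x (G x * (Phi x - Phi (x - h *: e_ i)))].
Proof.
move=> r0 h0 rh iw iG wG sa; have [->|c0 /(_ _ _ isT) a0] := eqVneq c 0.
  move=> _; exists (fun=> 0); split => //.
  - by move=> x; rewrite mul0r; exact: is_derive_cst.
  - by exists 0 => x; rewrite subrr normr0.
  - by exists 0 => x; rewrite mul0r normr0.
  - by congr fine; apply: eq_integral => x _; rewrite !mul0r subrr !mulr0.
have [|F dF F0] := @primitive_exists _ (a i) (x0 ord0 i - (r + h)) (smooth_continuous (sa i)).
  by move=> t tx; apply: a0; rewrite ltr_normr; apply/orP; right; lra.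
have sF : smooth F by exact: smooth_primitive dF (sa i).
have sFh : smooth (fun t => F (t - h)).
  rewrite (_ : (fun _ => _) = (fun t => F (1 * t + - h))); first exact: smooth_comp_affine.
  by apply/funext => t; rewrite mul1r.
pose b := upd a i (fun t => F t - F (t - h)).
have sb j : smooth (b j) by apply: smooth_upd => //; exact: smoothB.
have b0 j t : rho < `|t - x0 ord0 j| -> b j t = 0.
  rewrite /b /upd; case: eqP => [->|_]; last by move=> H; apply: a0; lra.
  rewrite ltr_normr => /orP[H|H]; last by rewrite !F0 ?subrr//; lra.
  have th : t - h <= t by lra.
  have [|s] := MVT_segment th (fun z _ => dF z).
    exact/continuous_subspaceT/smooth_continuous.
  rewrite in_itv /= => /andP[s1 s2] ->; rewrite a0 ?mul0r//.
  by rewrite ltr_normr; apply/orP; left; lra.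
have rho0 : 0 <= rho by lra.
have bE x : tensor b x = tensor (upd a i F) x - tensor (upd a i F) (x - h *: e_ i).
  by rewrite tensor_upd_shift -tensor_updB.
have bdE x : tensor (tensor_derive b i) x = tensor a x - tensor a (x - h *: e_ i).
  have db t : is_derive t (1 : R) (fun t => F t - F (t - h)) (a i t - a i (t - h)).
    have H := @is_derive_comp_affine _ F (a i (1 * t - h)) 1 (- h) t (dF _).
    have := is_deriveB (dF t) H; rewrite !mul1r (_ : (fun t => _) = (fun t => F (t - h)))//.
    by apply/funext => s; rewrite mul1r.
  by rewrite (tensor_derive_upd a i db) tensor_updB -tensor_upd_shift !upd_id.
have [M M0 HM] := tensor_bounded rho0 sb b0.
have [N N0 HN] := tensor_bounded r0 sa a0.
exists (fun x => c * tensor (upd a i F) x); split.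
- move=> x; have H := is_deriveM_fun (is_derive_cst c x (e_ i)) (is_derive_tensor_upd a i x dF).
  by apply: is_derive_eq H _; rewrite upd_id mulr0 addr0.
- apply: measurable_funM => //; apply: smooth_tensor_measurable => j; exact: smooth_upd.
- by exists (`|c| * M) => x; rewrite -mulrBr -bE normrM ler_wpM2l.
- by exists (`|c| * N) => x; rewrite normrM ler_wpM2l.
- transitivity (- c * \int[mu]_x (w x * tensor (tensor_derive b i) x)).
    rewrite -intZ.
      by apply: eq_Rintegral => x _; rewrite bdE; ring.
    apply: (@intgM _ _ _ _ (N + N)) => //.
      rewrite (_ : tensor _ = fun x => tensor a x - tensor a (x - h *: e_ i)); last exact/funext.
      apply: measurable_funB; first exact: smooth_tensor_measurable.
      apply: (measurableT_comp (smooth_tensor_measurable sa)).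
      exact: measurable_shift.
    by move=> x; rewrite bdE (le_trans (ler_normB _ _))// lerD.
  rewrite wG// mulrNN -intZ.
    by apply: eq_Rintegral => x _; rewrite bE; ring.
  by apply: (@intgM _ _ _ _ M) => //; exact: smooth_tensor_measurable.
Qed.

End discrete_weak.

Section discrete_weak_bound.
Context {R : realType} {n : nat}.
Local Notation mu := (@lebesgue_rV R n).
Implicit Types (f g th w G : 'rV[R]_n -> R) (x v : 'rV[R]_n) (i : 'I_n).
Local Notation e_ i := (delta_mx ord0 i : 'rV[R]_n).

Lemma measurable_fun_sub_shift f v : measurable_fun setT f ->
  measurable_fun setT (fun x => f (x - v)).
Proof. by move=> mf; apply: (measurableT_comp mf); exact: measurable_shift. Qed.

Lemma is_derive_fsum (I : finType) (F : I -> 'rV[R]_n -> R) (df : I -> R) x v :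
  (forall k, is_derive x v (F k) (df k)) ->
  is_derive x v (fun y => \sum_k F k y) (\sum_k df k).
Proof.
move=> H; rewrite (_ : (fun _ => _) = \sum_k F k); last by apply/funext => y; rewrite fct_sumE.
elim/big_ind2: _ => [|f1 d1 f2 d2 h1 h2|k _]; [exact: is_derive_cst|exact: is_deriveD|exact: H].
Qed.

(* If Phi is a primitive of th along e_i, then Phi - Phi (. - h e_i) is a test
   function whose derivative is the increment of th, and it is h om-close to h th. *)
Lemma discrete_weak_bound (x0 : 'rV[R]_n) (r h rho om : R) i w G th :
  0 <= r -> 0 < h -> r + h < rho -> intg mu w -> intg mu G -> ball_weak x0 rho i w G ->
  continuous th -> (forall x, r < `|x - x0| -> th x = 0) ->
  (forall x t, 0 <= t <= h -> `|th (x - t *: e_ i) - th x| <= om) ->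
  `|\int[mu]_x (w x * (th (x - h *: e_ i) - th x)) - h * \int[mu]_x (G x * th x)|
    <= h * om * \int[mu]_x `|G x|.
Proof.
move=> r0 h0 rh iw iG wG cth th0 thom.
(* [K] collects the cost of replacing [th] by a sum of tensor products within [eta] of it:
   increments change by at most 2 eta against [w], and primitives by h eta against [G]. *)
pose K := 2 * \int[mu]_x `|w x| + h * \int[mu]_x `|G x|.
have iG0 : 0 <= \int[mu]_x `|G x| by apply: int_ge0.
have iw0 : 0 <= \int[mu]_x `|w x| by apply: int_ge0.
have K0 : 0 <= K by rewrite addr_ge0 ?mulr_ge0 ?(ltW h0).
apply/ler_addgt0Pr => e e0; pose eta := e / (K + 1).
have eta0 : 0 < eta by rewrite divr_gt0// ltr_wpDl.
have Keta : eta * K <= e.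
  by rewrite /eta mulrAC ler_pdivrMr ?ltr_wpDl// ler_wpM2l ?(ltW e0)// lerDl.
apply: (@le_trans _ _ (h * om * (\int[mu]_x `|G x|) + eta * K)); last by rewrite lerD2l.
have d0 : 0 < rho - r - h by lra.
have [I [a [c [sa asupp aT]]]] := tensor_approx cth th0 d0 eta0.
have /choice[Phi HPhi] k := @tensor_translate _ _ x0 (r + (rho - r - h)) h rho (c k) i w G (a k)
  ltac:(lra) h0 ltac:(lra) iw iG wG (sa k) (asupp k).
pose P x := \sum_k Phi k x; pose T x := \sum_k c k * tensor (a k) x.
have dP x : is_derive x (e_ i) P (T x) by apply: is_derive_fsum => k; case: (HPhi k).
have mth := continuous_measurable_rVT cth.
have mT : measurable_fun setT T.
  rewrite /T; apply: measurable_sum => k; apply: measurable_funM => //.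
  exact: smooth_tensor_measurable.
have mP : measurable_fun setT P by apply: measurable_sum => k; case: (HPhi k).
(* By the mean value theorem the increment of the primitive is h times [T] at an intermediate point;
   [T] is [eta]-close to [th], which varies by at most [om]. *)
have Pth x : `|P x - P (x - h *: e_ i) - h * th x| <= h * (eta + om).
  have [t t0h] := @MVT_dir _ _ P T (x - h *: e_ i) (e_ i) h h0 (fun t _ => dP _).
  rewrite addrCA subrr addr0 => ->; rewrite -mulrBr normrM (gtr0_norm h0) ler_wpM2l ?(ltW h0)//.
  pose s := h - t.
  have -> : t *: e_ i + (x - h *: e_ i) = x - s *: e_ i.
    by rewrite /s scalerBl opprB addrCA addrA.
  have s0h : 0 <= s <= h by rewrite /s; lra.
  rewrite -(subrKA (th (x - s *: e_ i))) (le_trans (ler_normD _ _))// lerD//; [exact: aT|exact: thom].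
have [Mth Mth0 HMth] := continuous_supp_bounded cth th0.
have mths := measurable_fun_sub_shift (h *: e_ i) mth.
have mTs := measurable_fun_sub_shift (h *: e_ i) mT.
have mPs := measurable_fun_sub_shift (h *: e_ i) mP.
have TM x : `|T x| <= eta + Mth.
  have -> : T x = (T x - th x) + th x by rewrite subrK.
  by apply: le_trans (ler_normD _ _) _; apply: lerD; [exact: aT|exact: HMth].
have iwth : intg mu (fun x => w x * (th (x - h *: e_ i) - th x)).
  apply: (@intgM _ _ _ _ (Mth + Mth)) => //; first exact: measurable_funB.
  by move=> x; rewrite (le_trans (ler_normB _ _))// lerD.
have iwT : intg mu (fun x => w x * (T (x - h *: e_ i) - T x)).
  apply: (@intgM _ _ _ _ ((eta + Mth) + (eta + Mth))) => //; first exact: measurable_funB.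
  by move=> x; rewrite (le_trans (ler_normB _ _))// lerD.
have iGth : intg mu (fun x => G x * th x) by exact: (@intgM _ _ _ _ Mth).
have iGP : intg mu (fun x => G x * (P x - P (x - h *: e_ i))).
  apply: (@intgM _ _ _ _ (h * (eta + om) + h * Mth)) => //; first exact: measurable_funB.
  move=> x; rewrite -[P x - _](subrK (h * th x)); apply: le_trans (ler_normD _ _) _; apply: lerD => //.
  by rewrite normrM (gtr0_norm h0) ler_wpM2l ?(ltW h0).
have E : \int[mu]_x (w x * (T (x - h *: e_ i) - T x)) = \int[mu]_x (G x * (P x - P (x - h *: e_ i))).
  transitivity (\sum_k \int[mu]_x (w x * (c k * tensor (a k) (x - h *: e_ i) - c k * tensor (a k) x))).
    rewrite -int_sum => [|k].
      by apply: eq_Rintegral => x _; rewrite -mulr_sumr -sumrB.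
    have [_ _ _ [M HM] _] := HPhi k.
    apply: (@intgM _ _ _ _ (M + M)) => //; last by move=> x; rewrite (le_trans (ler_normB _ _))// lerD.
    have mk : measurable_fun setT (fun x => c k * tensor (a k) x).
      by apply: measurable_funM => //; exact: smooth_tensor_measurable.
    by apply: measurable_funB => //; exact: (measurable_fun_sub_shift (h *: e_ i) mk).
  transitivity (\sum_k \int[mu]_x (G x * (Phi k x - Phi k (x - h *: e_ i)))).
    by apply: eq_bigr => k _; have [_ _ _ _ ->] := HPhi k.
  rewrite -int_sum => [|k].
    by apply: eq_Rintegral => x _; rewrite -mulr_sumr -sumrB.
  have [_ mk [M HM] _ _] := HPhi k.
  apply: (@intgM _ _ _ _ M) => //.
  by apply: measurable_funB => //; exact: (measurable_fun_sub_shift (h *: e_ i) mk).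
have -> : \int[mu]_x (w x * (th (x - h *: e_ i) - th x)) - h * \int[mu]_x (G x * th x) =
  \int[mu]_x (w x * (th (x - h *: e_ i) - th x) - w x * (T (x - h *: e_ i) - T x)) +
  \int[mu]_x (G x * (P x - P (x - h *: e_ i)) - h * (G x * th x)).
  by rewrite !intB ?intZ//; [rewrite E; ring|exact: intgZ].
apply: le_trans (ler_normD _ _) _.
have H1 : `|\int[mu]_x (w x * (th (x - h *: e_ i) - th x) - w x * (T (x - h *: e_ i) - T x))| <=
    (2 * eta) * \int[mu]_x `|w x|.
  rewrite -intZ; last exact: intg_norm.
  apply: int_norm_le; [exact: intgB|by apply: intgZ; exact: intg_norm|move=> x].
  rewrite -mulrBr normrM mulrC ler_wpM2r//.
  rewrite (_ : _ - _ = (T x - th x) - (T (x - h *: e_ i) - th (x - h *: e_ i))); last by ring.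
  by rewrite (le_trans (ler_normB _ _))// (_ : 2 * eta = eta + eta) ?lerD//; [exact: aT|exact: aT|ring].
have H2 : `|\int[mu]_x (G x * (P x - P (x - h *: e_ i)) - h * (G x * th x))| <=
    (h * (eta + om)) * \int[mu]_x `|G x|.
  rewrite -intZ; last exact: intg_norm.
  apply: int_norm_le; [by apply: intgB => //; exact: intgZ|by apply: intgZ; exact: intg_norm|move=> x].
  rewrite (_ : _ - _ = G x * (P x - P (x - h *: e_ i) - h * th x)); last by ring.
  by rewrite normrM mulrC ler_wpM2r.
apply: le_trans (lerD H1 H2) _; rewrite /K le_eqVlt; apply/orP; left; apply/eqP; ring.
Qed.

End discrete_weak_bound.

(** * Convergence of difference quotients and cutoffs *)

Section growth.
Context {R : realType} {n : nat}.
Local Notation mu := (@lebesgue_rV R n).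
Implicit Types (f g df th w G eta : 'rV[R]_n -> R) (x v : 'rV[R]_n) (i : 'I_n).
Local Notation e_ i := (delta_mx ord0 i : 'rV[R]_n).

Lemma norm_e i : `|e_ i| <= 1 :> R.
Proof.
apply: rV_norm_le => // j; rewrite mxE; case: (_ && _); by rewrite ?normr1 ?normr0.
Qed.

Lemma normZ_e (t : R) i : `|t *: e_ i| <= `|t|.
Proof. by rewrite normrZ ler_piMr// norm_e. Qed.

Lemma is_derive_growth_cvg f x v (dfx : R) (h_ : nat -> R) : is_derive x v f dfx ->
  (forall k, 0 < h_ k) -> h_ @ \oo --> 0 ->
  (h_ k)^-1 * (f (x - h_ k *: v) - f x) @[k --> \oo] --> - dfx.
Proof.
move=> [d <-] h0 hc.
have /cvgr_dnbhsP/(_ (fun k => - h_ k)) H := d.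
have {}H : (- h_ k)^-1 *: ((f \o shift x) (- h_ k *: v) - f x) @[k --> \oo] --> 'D_v f x.
  by apply: H; split=> [k|]; [rewrite oppr_eq0 gt_eqF|rewrite -oppr0; exact: cvgN].
rewrite (_ : (fun k => _) = (fun k => - ((- h_ k)^-1 *: ((f \o shift x) (- h_ k *: v) - f x)))).
  exact: cvgN.
by apply/funext => k /=; rewrite invrN !scaleNr opprK [- (h_ k *: v) + x]addrC.
Qed.

Definition plateau (x0 : 'rV[R]_n) (r s : R) x : R :=
  Num.min 1 (Num.max 0 ((s - `|x - x0|) / (s - r))).

Lemma plateau_ge0 x0 r s x : 0 <= plateau x0 r s x.
Proof. by rewrite /plateau le_min ler01 le_max lexx. Qed.

Lemma plateau_le1 x0 r s x : plateau x0 r s x <= 1.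
Proof. by rewrite /plateau ge_min lexx. Qed.

Lemma norm_plateau x0 r s x : `|plateau x0 r s x| <= 1.
Proof. by rewrite ger0_norm ?plateau_ge0 ?plateau_le1. Qed.

Lemma plateau1 x0 r s x : r < s -> `|x - x0| <= r -> plateau x0 r s x = 1.
Proof.
move=> rs xr; rewrite /plateau; apply/min_idPl; rewrite le_max; apply/orP; right.
by rewrite ler_pdivlMr ?subr_gt0// mul1r lerD2l lerN2.
Qed.

Lemma plateau0 x0 r s x : r < s -> s <= `|x - x0| -> plateau x0 r s x = 0.
Proof.
move=> rs xr; rewrite /plateau (_ : Num.max _ _ = 0) ?min_r//.
by apply/max_idPl; rewrite ler_pdivrMr ?subr_gt0// mul0r subr_le0.
Qed.

Lemma continuous_dist x0 : continuous (fun x => `|x - x0|).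
Proof.
by move=> y; apply: continuous_comp; [apply: continuousB; [exact: cvg_id|exact: cst_continuous]|exact: norm_continuous].
Qed.

Lemma continuous_plateau x0 r s : continuous (plateau x0 r s).
Proof.
move=> x; apply: (@continuous_min _ _ (cst 1) (fun x => Num.max 0 ((s - `|x - x0|) / (s - r)))).
  exact: cst_continuous.
apply: (@continuous_max _ _ (cst 0) (fun x => (s - `|x - x0|) / (s - r))).
  exact: cst_continuous.
apply: continuousM; last exact: cst_continuous.
by apply: continuousB; [exact: cst_continuous|exact: continuous_dist].
Qed.

Lemma continuousM_plateau x0 (r s : R) f : r < s -> (forall x, `|x - x0| < s + (s - r) -> {for x, continuous f}) ->
  continuous (fun x => f x * plateau x0 r s x).
Proof.
move=> rs cf x; have [xs|xs] := ltP `|x - x0| (s + (s - r)).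
  by apply: continuousM; [exact: cf|exact: continuous_plateau].
have H : \forall y \near x, 0 = f y * plateau x0 r s y.
  have : nbhs x [set y | s < `|y - x0|].
    apply: (@continuous_dist x0 x [set t | s < t]); apply: lt_nbhsr; lra.
  by apply: filterS => y /= sy; rewrite plateau0 ?mulr0// ltW.
rewrite /continuous_at [X in _ --> X](_ : _ = 0); last by rewrite plateau0 ?mulr0//; lra.
by apply: (@cvg_near_cst _ _ _ _ (nbhs x)); apply: filterS H => y <-.
Qed.

(** Step sizes are taken along a sequence because dominated convergence is applied to sequences; the
    bound [eps] keeps the translates inside the region where derivatives are controlled. *)
Definition null_steps (eps : R) (h_ : nat -> R) := (forall k, 0 < h_ k <= eps) /\ h_ @ \oo --> 0.

Lemma null_steps_exists (eps : R) : 0 < eps -> exists h_, null_steps eps h_.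
Proof.
move=> e0; exists (fun k => eps * (k.+1%:R)^-1); split=> [k|].
  by rewrite mulr_gt0//= ?ler_piMr ?(ltW e0)// invf_le1// ler1n.
by rewrite -(mulr0 eps); apply: cvgM; [exact: cvg_cst|exact: cvg_harmonic].
Qed.

(** Dominated convergence: the mean value theorem bounds the quotients by M where [eta] is nonzero.
    The quotients are backward, whence the minus sign of the limit. *)
Lemma int_growth_cvg (eps M : R) (h_ : nat -> R) i eta f df : null_steps eps h_ ->
  intg mu eta -> measurable_fun setT f ->
  (forall x t, eta x != 0 -> 0 <= t <= eps ->
     is_derive (x - t *: e_ i) (e_ i) f (df (x - t *: e_ i)) /\ `|df (x - t *: e_ i)| <= M) ->
  intg mu (fun x => eta x * df x) /\
  (h_ k)^-1 * \int[mu]_x (eta x * (f (x - h_ k *: e_ i) - f x)) @[k --> \oo]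
    --> - \int[mu]_x (eta x * df x).
Proof.
move=> [h0e hc] ieta mf H.
have meta := intg_measurable ieta.
have h0 k : 0 < h_ k by have /andP[] := h0e k.
pose F k x := (h_ k)^-1 * (eta x * (f (x - h_ k *: e_ i) - f x)).
have FM k x : `|F k x| <= `|M| * `|eta x|.
  rewrite /F; have [->|ex] := eqVneq (eta x) 0; first by rewrite mul0r mulr0 !normr0 mulr0.
  rewrite mulrCA normrM mulrC ler_wpM2r//.
  have [|t /andP[t0 th]] := @MVT_dir _ _ f df (x - h_ k *: e_ i) (e_ i) (h_ k) (h0 k).
    move=> t /andP[t0 th]; have -> : t *: e_ i + (x - h_ k *: e_ i) = x - (h_ k - t) *: e_ i.
      by rewrite scalerBl opprB addrCA addrA.
    by apply: (H _ _ ex _).1; have /andP[_ ?] := h0e k; lra.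
  have -> : t *: e_ i + (x - h_ k *: e_ i) = x - (h_ k - t) *: e_ i.
    by rewrite scalerBl opprB addrCA addrA.
  rewrite addrCA subrr addr0 => fE.
  rewrite -opprB fE mulrN normrN mulrA mulVf ?mul1r ?gt_eqF//.
  apply: le_trans (ler_norm M); apply: (H _ _ ex _).2.
  by have /andP[_ ?] := h0e k; lra.
have mF k : measurable_fun setT (F k).
  apply: measurable_funM => //; apply: measurable_funM => //.
  by apply: measurable_funB => //; exact: (measurable_fun_sub_shift (h_ k *: e_ i) mf).
have cF x : F k x @[k --> \oo] --> - (eta x * df x).
  rewrite /F; have [->|ex] := eqVneq (eta x) 0.
    by under eq_fun do rewrite mul0r mulr0; rewrite mul0r oppr0; exact: cvg_cst.
  under eq_fun do rewrite mulrCA; rewrite -mulrN.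
  apply: cvgM; first exact: cvg_cst.
  apply: is_derive_growth_cvg => //.
  have [|+ _] := H x 0 ex _; first by rewrite lexx /=; have /andP[? ?] := h0e 0; lra.
  by rewrite scale0r subr0.
have [iN cN] := int_dominated mF (intgZ `|M| (intg_norm ieta)) FM cF.
have ied : intg mu (fun x => eta x * df x).
  by have := intgN iN; under eq_fun do rewrite opprK.
split => //; rewrite -intN//; apply: cvg_trans cN; apply: near_eq_cvg; apply: nearW => k /=.
rewrite -intZ//.
have -> : (fun x => eta x * (f (x - h_ k *: e_ i) - f x)) = (fun x => h_ k * F k x).
  by apply/funext => x; rewrite /F mulrA mulfV ?mul1r ?gt_eqF.
apply: intgZ; apply: intg_le (mF k) (FM k); apply: intgZ; exact: intg_norm.
Qed.

End growth.

(** * The weak derivative of half the squared positive part *)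

Section chain.
Context {R : realType} {n : nat}.
Local Notation mu := (@lebesgue_rV R n).
Implicit Types (f df g th w G eta : 'rV[R]_n -> R) (x v : 'rV[R]_n) (i : 'I_n).
Local Notation e_ i := (delta_mx ord0 i : 'rV[R]_n).

(* The plateau only makes the function globally continuous: it will be used for w
   nonpositive at distances between 2 eps and 8 eps from x0. *)
Definition trunc_pos (x0 : 'rV[R]_n) (eps : R) w x : R :=
  Num.max 0 (w x * plateau x0 (6 * eps) (7 * eps) x).

Lemma trunc_pos_ge0 x0 eps w x : 0 <= trunc_pos x0 eps w x.
Proof. by rewrite /trunc_pos le_max lexx. Qed.

Lemma trunc_posE x0 (eps : R) w x : 0 < eps -> `|x - x0| <= 6 * eps ->
  trunc_pos x0 eps w x = Num.max 0 (w x).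
Proof. by move=> e0 xr; rewrite /trunc_pos plateau1 ?mulr1//; lra. Qed.

Lemma trunc_pos_eq0 x0 (eps : R) w x : 0 < eps ->
  (forall y, 2 * eps < `|y - x0| < 8 * eps -> w y <= 0) ->
  2 * eps < `|x - x0| -> trunc_pos x0 eps w x = 0.
Proof.
move=> e0 wn xr; rewrite /trunc_pos; have [x7|x7] := leP (7 * eps) `|x - x0|.
  by rewrite plateau0 ?mulr0 ?maxxx//; lra.
by rewrite max_l// mulr_le0_ge0 ?plateau_ge0// wn// xr/=; lra.
Qed.

Lemma continuous_trunc_pos x0 (eps : R) w : 0 < eps ->
  (forall x, `|x - x0| < 8 * eps -> {for x, continuous w}) -> continuous (trunc_pos x0 eps w).
Proof.
move=> e0 cw x; apply: (@continuous_max _ _ (cst 0) (fun x => w x * plateau x0 (6 * eps) (7 * eps) x)).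
  exact: cst_continuous.
apply: continuousM_plateau; first lra.
by move=> y yr; apply: cw; lra.
Qed.

(** The derivative s^+ of (s^+)^2 / 2 is 1-Lipschitz, so the first-order Taylor remainder is
    quadratic in spite of the corner of s^+. *)
Lemma half_sqr_pos_taylor (a b : R) :
  `|Num.max 0 b ^+ 2 / 2 - Num.max 0 a ^+ 2 / 2 - Num.max 0 a * (b - a)| <= (b - a) ^+ 2.
Proof.
have sa : 0 <= a * a by rewrite -expr2 sqr_ge0.
have sb : 0 <= b * b by rewrite -expr2 sqr_ge0.
have sab : 0 <= (b - a) * (b - a) by rewrite -expr2 sqr_ge0.
rewrite ler_norml !expr2.
have [a0|a0] := leP 0 a; have [b0|b0] := leP 0 b; apply/andP.
- by split; lra.
- by have := mulr_ge0_le0 a0 (ltW b0); split; lra.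
- by have := mulr_ge0_le0 b0 (ltW a0); split; lra.
- by rewrite !mul0r; split; lra.
Qed.

(* W ^+ 2 / 2 is a C^1 function of w, so that a second-order expansion of its
   difference quotients gives its weak derivative W * G. *)
Lemma chain_by_parts (x0 : 'rV[R]_n) (eps M : R) i w G f df : 0 < eps ->
  intg mu w -> intg mu G -> ball_weak x0 (8 * eps) i w G ->
  (forall x, `|x - x0| < 8 * eps -> {for x, continuous w}) ->
  (forall x, 2 * eps < `|x - x0| < 8 * eps -> w x <= 0) ->
  (forall x, `|x - x0| < 8 * eps -> [/\ {for x, continuous f}, is_derive x (e_ i) f (df x) & `|df x| <= M]) ->
  let W := trunc_pos x0 eps w in
  [/\ intg mu (fun x => W x ^+ 2 / 2 * df x), intg mu (fun x => G x * (W x * f x)) &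
  \int[mu]_x (W x ^+ 2 / 2 * df x) = - \int[mu]_x (G x * (W x * f x))].
Proof.
move=> e0 iw iG wG cw wn Hf W.
(* Nested radii, in units of eps: [W] lives within 2, [f] is cut off between 4 and 5, [w] between 6
   and 7, and the weak identity is available up to 8. The unit margins absorb translations by h <=
   eps. *)
pose c1 := plateau x0 (4 * eps) (5 * eps); pose c2 := plateau x0 (6 * eps) (7 * eps).
pose w' x := w x * c2 x; pose f' x := f x * c1 x; pose eta x := W x ^+ 2 / 2.
have W0 x : 2 * eps < `|x - x0| -> W x = 0 by exact: trunc_pos_eq0.
have cW : continuous W by exact: continuous_trunc_pos.
have cw' : continuous w'.
  by apply: continuousM_plateau; [lra|move=> x xr; apply: cw; lra].
have w'0 x : 7 * eps < `|x - x0| -> w' x = 0.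
  by move=> xr; rewrite /w' /c2 plateau0 ?mulr0//; lra.
have cf' : continuous f'.
  by apply: continuousM_plateau; [lra|move=> x xr; have [] := Hf x ltac:(lra)].
have f'0 x : 5 * eps < `|x - x0| -> f' x = 0.
  by move=> xr; rewrite /f' /c1 plateau0 ?mulr0//; lra.
have ceta : continuous eta.
  move=> x; rewrite /eta; apply: (@continuousM _ _ (fun x => W x ^+ 2)); last exact: cst_continuous.
  by apply: (@continuousM _ _ W W); exact: cW.
have eta0 x : 2 * eps < `|x - x0| -> eta x = 0 by move=> /W0; rewrite /eta => ->; rewrite expr0n mul0r.
have [Me Me0 HMe] := continuous_supp_bounded ceta eta0.
have [Mf Mf0 HMf] := continuous_supp_bounded cf' f'0.
have [MW MW0 HMW] := continuous_supp_bounded cW W0.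
have [Mw' Mw'0 HMw'] := continuous_supp_bounded cw' w'0.
have ieta : intg mu eta by exact: intg_bounded_supp (continuous_measurable_rVT ceta) HMe eta0.
have mf' := continuous_measurable_rVT cf'.
have mw' := continuous_measurable_rVT cw'.
have mW := continuous_measurable_rVT cW.
have [h_ hn] := null_steps_exists e0.
have step_dist x (t : R) : 0 <= t <= eps -> `|x - x0| <= eps + `|x - t *: e_ i - x0| /\
    `|x - t *: e_ i - x0| <= `|x - x0| + eps.
  move=> /andP[t0 te]; have := normZ_e t i; rewrite ger0_norm// => et; split.
    rewrite (_ : x - x0 = t *: e_ i + (x - t *: e_ i - x0)); last by rewrite addrA addrCA subrr addr0.
    by rewrite (le_trans (ler_normD _ _))// lerD2r; lra.
  rewrite (_ : x - t *: e_ i - x0 = (x - x0) - t *: e_ i); last by rewrite addrAC.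
  by rewrite (le_trans (ler_normB _ _))// lerD2l; lra.
have df'E x : `|x - x0| < 4 * eps -> is_derive x (e_ i) f' (df x).
  move=> x4; apply: (@near_eq_is_derive _ _ _ f).
    have : nbhs x [set y | `|y - x0| < 4 * eps].
      by apply: (@continuous_dist _ _ x0 x [set t | t < 4 * eps]); exact: lt_nbhsl.
    by apply: filterS => y /= yr; rewrite /f' /c1 plateau1 ?mulr1//; lra.
  by have [] := Hf x ltac:(lra).
have [ied cvg1] : intg mu (fun x => eta x * df x) /\
    (h_ k)^-1 * \int[mu]_x (eta x * (f' (x - h_ k *: e_ i) - f' x)) @[k --> \oo]
    --> - \int[mu]_x (eta x * df x).
  apply: (@int_growth_cvg _ _ eps M) => // x t ex t0e.
  have x2 : `|x - x0| <= 2 * eps by rewrite leNgt; apply: contraNN ex => /eta0 ->.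
  have [_ ?] := step_dist x t t0e; split; first by apply: df'E; lra.
  by have [] := Hf (x - t *: e_ i) ltac:(lra).
pose th1 x := W x * f' x.
have th1E x : th1 x = W x * f x.
  rewrite /th1 /f'; have [x2|x2] := ltP (2 * eps) `|x - x0|; first by rewrite W0// !mul0r.
  by rewrite /c1 plateau1 ?mulr1//; lra.
have cth1 : continuous th1 by move=> x; apply: continuousM; [exact: cW|exact: cf'].
have th10 x : 2 * eps < `|x - x0| -> th1 x = 0 by move=> /W0; rewrite /th1 => ->; rewrite mul0r.
have mth1 := continuous_measurable_rVT cth1.
have Mth1 x : `|th1 x| <= MW * Mf by rewrite normrM ler_pM.
(* Here sg bounds the oscillation of [th1] and [w'] over one step. The difference quotient is within
   O(sg) of the integral of [G] against [th1]: one error comes from the discrete weak identity, the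
   other from the Taylor remainder. *)
have key k sg : (forall x y, `|x - y| <= h_ k -> `|th1 x - th1 y| <= sg) ->
   (forall x y, `|x - y| <= h_ k -> `|w' x - w' y| <= sg) -> 0 <= sg ->
   `|(h_ k)^-1 * \int[mu]_x (eta x * (f' (x - h_ k *: e_ i) - f' x)) - \int[mu]_x (G x * th1 x)|
     <= sg * ((1 + 3 * Mf) * \int[mu]_x `|G x|).
  move: (h_ k) (hn.1 k) => h /andP[h0 he] osc1 osc2 sg0.
  have hd x t : 0 <= t <= h -> `|x - t *: e_ i - x| <= h.
    move=> /andP[t0 th]; rewrite addrAC subrr sub0r normrN (le_trans (normZ_e _ _))//.
    by rewrite ger0_norm.
  have iG0 : 0 <= \int[mu]_x `|G x| by apply: int_ge0.
  pose D x := w (x + h *: e_ i) - w x.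
  have iD : intg mu D by apply: intgB => //; exact: intg_shift.
  (* [D * th2] is the squared increment of [w], cut off. Taking the increment itself as a test
     function, of size at most sg, bounds the integral of its square by O(h sg), which requires [G]
     to be integrable only, not square integrable. *)
  pose th2 x := (w' (x + h *: e_ i) - w' x) * c1 x.
  have cth2 : continuous th2.
    move=> x; apply: (@continuousM _ _ (fun x => w' (x + h *: e_ i) - w' x)); last exact: continuous_plateau.
    apply: (@continuousB _ _ _ (fun x => w' (x + h *: e_ i)) w'); last exact: cw'.
    apply: (@continuous_comp _ _ _ (fun x => x + h *: e_ i) w'); last exact: cw'.
    by apply: continuousD; [exact: cvg_id|exact: cst_continuous].
  have th20 x : 5 * eps < `|x - x0| -> th2 x = 0.
    by move=> xr; rewrite /th2 /c1 plateau0 ?mulr0 ?(ltW xr)//; clear -e0; lra.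
  have th2sg x : `|th2 x| <= sg.
    rewrite /th2 normrM -[sg]mulr1 ler_pM ?norm_plateau//; apply: osc2.
    by rewrite addrAC subrr add0r (le_trans (normZ_e _ _))// ger0_norm ?(ltW h0).
  have mth2 := continuous_measurable_rVT cth2.
  (* Discrete integration by parts: translation invariance moves the increment from [w] to the test
     function. *)
  have swap th (B : R) : continuous th -> (forall x, `|th x| <= B) ->
      \int[mu]_x (D x * th x) = \int[mu]_x (w x * (th (x - h *: e_ i) - th x)).
    move=> cth HB; have mth := continuous_measurable_rVT cth.
    have i1 : intg mu (fun x => w x * th (x - h *: e_ i)).
      by apply: (@intgM _ _ _ _ B) => //; exact: (measurable_fun_sub_shift (h *: e_ i) mth).
    have i2 : intg mu (fun x => w x * th x) by exact: (@intgM _ _ _ _ B).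
    transitivity (\int[mu]_x (w (x + h *: e_ i) * th (x + h *: e_ i - h *: e_ i) - w x * th x)).
      by apply: eq_Rintegral => x _; rewrite addrK /D mulrBl.
    rewrite (intB (intg_shift (h *: e_ i) i1) i2) (int_shift (h *: e_ i) i1) -(intB i1 i2).
    by apply: eq_Rintegral => x _; rewrite mulrBr.
  have B1 : `|\int[mu]_x (D x * th1 x) - h * \int[mu]_x (G x * th1 x)| <= h * sg * \int[mu]_x `|G x|.
    rewrite (swap th1 _ cth1 Mth1).
    have e2 : 0 <= 2 * eps by clear -e0; lra.
    have e28 : 2 * eps + h < 8 * eps by clear -e0 he; lra.
    apply: (discrete_weak_bound e2 h0 e28 iw iG wG cth1 th10).
    by move=> x t t0h; apply: osc1; exact: hd.
  have B2 : `|\int[mu]_x (D x * th2 x)| <= 3 * (h * sg * \int[mu]_x `|G x|).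
    rewrite (swap th2 _ cth2 th2sg).
    have sg2 : sg + sg <= 2 * sg by rewrite mulr_natl mulr2n.
    have e5 : 0 <= 5 * eps by clear -e0; lra.
    have e58 : 5 * eps + h < 8 * eps by clear -e0 he; lra.
    have H := @discrete_weak_bound _ _ x0 (5 * eps) h (8 * eps) (2 * sg) i w G th2
      e5 h0 e58 iw iG wG cth2 th20 _.
    have {}H := H (fun x t _ => le_trans (ler_normB _ _) (le_trans (lerD (th2sg _) (th2sg _)) sg2)).
    have HG : `|\int[mu]_x (G x * th2 x)| <= sg * \int[mu]_x `|G x|.
      rewrite -intZ; last exact: intg_norm.
      apply: int_norm_le; [exact: (@intgM _ _ _ _ sg)|by apply: intgZ; exact: intg_norm|].
      by move=> x; rewrite normrM mulrC ler_wpM2r.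
    set A := (X in `|X|); set B := \int[mu]_x (G x * th2 x) in H HG *.
    have -> : A = (A - h * B) + h * B by ring.
    rewrite (le_trans (ler_normD _ _))// normrM (gtr0_norm h0).
    have hB : h * `|B| <= h * (sg * \int[mu]_x `|G x|) by rewrite ler_wpM2l ?(ltW h0).
    by rewrite -/A in H; clear -H hB; lra.
  have Dth2 x : 0 <= D x * th2 x.
    rewrite /th2 /D; have [x5|x5] := leP (5 * eps) `|x - x0|.
      by rewrite /c1 plateau0 ?mulr0//; clear -e0; lra.
    have x6 : `|x + h *: e_ i - x0| <= 6 * eps.
      rewrite addrAC (le_trans (ler_normD _ _))//.
      by have := normZ_e h i; rewrite (gtr0_norm h0); clear -x5 he; lra.
    have xx : `|x - x0| <= 6 * eps by clear -x5 e0; lra.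
    have e67 : 6 * eps < 7 * eps by clear -e0; lra.
    rewrite /w' /c2 (plateau1 e67 x6) (plateau1 e67 xx) !mulr1.
    by rewrite mulrA -expr2 mulr_ge0 ?sqr_ge0// plateau_ge0.
  have iDth1 : intg mu (fun x => D x * th1 x) by exact: (@intgM _ _ _ _ (MW * Mf)).
  have iDth2 : intg mu (fun x => D x * th2 x) by exact: (@intgM _ _ _ _ sg).
  have ieta1 : intg mu (fun x => eta (x + h *: e_ i) * f' x).
    by apply: (@intgM _ _ _ _ Mf) => //; exact: intg_shift.
  have ieta2 : intg mu (fun x => eta x * f' x) by exact: (@intgM _ _ _ _ Mf).
  have ieta3 : intg mu (fun x => eta x * f' (x - h *: e_ i)).
    by apply: (@intgM _ _ _ _ Mf) => //; exact: (measurable_fun_sub_shift (h *: e_ i) mf').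
  have E1 : \int[mu]_x (eta x * (f' (x - h *: e_ i) - f' x)) =
      \int[mu]_x (eta (x + h *: e_ i) * f' x - eta x * f' x).
    transitivity (\int[mu]_x (eta x * f' (x - h *: e_ i) - eta x * f' x)).
      by apply: eq_Rintegral => x _; rewrite mulrBr.
    have Es : \int[mu]_x (eta x * f' (x - h *: e_ i)) = \int[mu]_x (eta (x + h *: e_ i) * f' x).
      by rewrite -(int_shift (h *: e_ i) ieta3); apply: eq_Rintegral => x _; rewrite addrK.
    by rewrite (intB ieta3 ieta2) (intB ieta1 ieta2) Es.
  (* The Taylor remainder of [eta] along one step is at most the squared increment of [w]; beyond
     radius 4 eps, both sides are settled by supports alone. *)
  have E2 x : `|(eta (x + h *: e_ i) * f' x - eta x * f' x) - D x * th1 x| <= Mf * (D x * th2 x).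
    have [x4|x4] := ltP (4 * eps) `|x - x0|.
      have x2 : 2 * eps < `|x - x0| by clear -x4 e0; lra.
      have x2' : 2 * eps < `|x + h *: e_ i - x0|.
        have := ler_normB (x + h *: e_ i - x0) (h *: e_ i).
        rewrite (_ : x + h *: e_ i - x0 - h *: e_ i = x - x0); last by rewrite addrAC addrK.
        by have := normZ_e h i; rewrite (gtr0_norm h0); clear -x4 he e0; lra.
      rewrite (eta0 _ x2) (eta0 _ x2') (th10 _ x2).
      by rewrite !mul0r mulr0 !subr0 normr0 (mulr_ge0 Mf0 (Dth2 x)).
    have x5 : `|x + h *: e_ i - x0| <= 5 * eps.
      rewrite addrAC (le_trans (ler_normD _ _))//.
      by have := normZ_e h i; rewrite (gtr0_norm h0); clear -x4 he; lra.
    have x6 : `|x - x0| <= 6 * eps by clear -x4 e0; lra.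
    have x6' : `|x + h *: e_ i - x0| <= 6 * eps by clear -x5 e0; lra.
    have -> : th2 x = D x.
      have e67 : 6 * eps < 7 * eps by clear -e0; lra.
      have e45 : 4 * eps < 5 * eps by clear -e0; lra.
      by rewrite /th2 /D /w' /c1 /c2 (plateau1 e45 x4) (plateau1 e67 x6) (plateau1 e67 x6') !mulr1.
    rewrite /eta /th1 /W (trunc_posE _ e0 x6) (trunc_posE _ e0 x6').
    rewrite (_ : _ - _ = (Num.max 0 (w (x + h *: e_ i)) ^+ 2 / 2 - Num.max 0 (w x) ^+ 2 / 2
       - Num.max 0 (w x) * D x) * f' x); last by ring.
    rewrite normrM mulrC; apply: ler_pM; [exact: normr_ge0|exact: normr_ge0|exact: HMf|].
    rewrite -expr2; exact: half_sqr_pos_taylor.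
  rewrite E1.
  have -> : \int[mu]_x (eta (x + h *: e_ i) * f' x - eta x * f' x) =
     \int[mu]_x ((eta (x + h *: e_ i) * f' x - eta x * f' x) - D x * th1 x) + \int[mu]_x (D x * th1 x).
    rewrite -(intD (intgB (intgB ieta1 ieta2) iDth1) iDth1).
    by apply: eq_Rintegral => x _; rewrite subrK.
  set E := \int[mu]_x ((eta _ * _ - _) - _).
  have HE : `|E| <= Mf * (3 * (h * sg * \int[mu]_x `|G x|)).
    apply: (@le_trans _ _ (Mf * \int[mu]_x (D x * th2 x))).
      rewrite -(intZ _ iDth2); apply: int_norm_le E2; last exact: (intgZ _ iDth2).
      exact: (intgB (intgB ieta1 ieta2) iDth1).
    by rewrite (ler_wpM2l Mf0)// (le_trans (ler_norm _)).
  set A := \int[mu]_x (D x * th1 x) in B1 *; set B := \int[mu]_x (G x * th1 x) in B1 *.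
  have -> : h^-1 * (E + A) - B = h^-1 * (E + (A - h * B)).
    by field; rewrite gt_eqF.
  rewrite normrM gtr0_norm ?invr_gt0// mulrC ler_pdivrMr//.
  apply: le_trans (ler_normD _ _) _; move: HE B1; clear; lra.
rewrite (_ : (fun x => G x * (W x * f x)) = (fun x => G x * th1 x)); last first.
  by apply/funext => x; rewrite th1E.
split; [exact: ied|exact: (intgM iG mth1 Mth1)|].
apply/eqP; rewrite eq_sym -subr_eq0 -normr_le0; apply/ler_addgt0Pr => e e0'; rewrite add0r.
pose C := (1 + 3 * Mf) * \int[mu]_x `|G x|.
have C0 : 0 <= C by rewrite mulr_ge0 ?int_ge0//; lra.
pose sg := e / 2 / (C + 1).
have sg0 : 0 < sg by rewrite !divr_gt0// ltr_wpDl.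
have sgC : sg * C <= e / 2.
  by rewrite /sg mulrAC ler_pdivrMr ?ltr_wpDl// ler_wpM2l ?divr_ge0 ?(ltW e0')// lerDl.
have [d1 d10 Hd1] := compact_supp_unif_continuous cth1 th10 sg0.
have [d2 d20 Hd2] := compact_supp_unif_continuous cw' w'0 sg0.
have N1 : \forall k \near \oo, h_ k < d1 by have /cvgr_lt := hn.2; apply.
have N2 : \forall k \near \oo, h_ k < d2 by have /cvgr_lt := hn.2; apply.
have e20 : 0 < e / 2 by rewrite divr_gt0.
have N3 : \forall k \near \oo, `|- (\int[mu]_x (eta x * df x)) -
    (h_ k)^-1 * \int[mu]_x (eta x * (f' (x - h_ k *: e_ i) - f' x))| <= e / 2.
  by have /cvgrPdist_le := cvg1; apply.
have [k [[hd1 hd2] H2]] := filter_ex (filterI (filterI N1 N2) N3).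
have H1 := key k sg (fun x y xy => Hd1 x y (le_trans xy (ltW hd1)))
  (fun x y xy => Hd2 x y (le_trans xy (ltW hd2))) (ltW sg0).
rewrite -/C in H1.
set A := _ * _ in H1 H2; set B := \int[mu]_x (G x * th1 x) in H1 *.
have -> : - B - \int[mu]_x (W x ^+ 2 / 2 * df x) = (- (\int[mu]_x (eta x * df x)) - A) + (A - B).
  by rewrite /eta; ring.
by rewrite (le_trans (ler_normD _ _))//; clear -H1 H2 sgC; lra.
Qed.

End chain.

(** * Uniqueness of weak gradients *)

Section fundamental_lemma.
Context {R : realType} {n : nat}.
Local Notation mu := (@lebesgue_rV R n).
Implicit Types (f g : 'rV[R]_n -> R) (U A : set 'rV[R]_n) (l r c d : 'I_n -> R).

(** The sets over which [g] integrates to 0 form a Dynkin system, stable under complement because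
    the full integral vanishes, and containing the pi-system of boxes. *)
Lemma ae_eq0_box_integrals g : intg mu g ->
  (\int[mu]_x (g x)%:E = 0)%E ->
  (forall l r, \int[mu]_(x in box l r) (g x)%:E = 0)%E -> {ae mu, forall x, g x = 0}.
Proof.
move=> ig gT gB; pose D := [set A | measurable A /\ (\int[mu]_(x in A) (g x)%:E = 0)%E].
have igA A : measurable A -> mu.-integrable A (EFin \o g).
  by move=> mA; exact: integrableS ig.
have dD : dynkin D.
  split.
  - by split.
  - move=> A [mA A0]; split; first exact: measurableC.
    have := @integral_setU_EFin _ _ _ mu A (~` A) g mA (measurableC mA).
    rewrite setUCr gT A0 add0e => ->//; first exact: intg_measurable ig.
    by rewrite disj_set2E setICr.
  - move=> F tF DF; split; first by apply: bigcupT_measurable => k; case: (DF k).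
    have mF k : measurable (F k) by case: (DF k).
    rewrite (integral_bigcup tF mF); last by apply: igA; exact: bigcupT_measurable.
    by apply: eseries0 => k _ _; case: (DF k).
have mD A : measurable A -> D A.
  rewrite measurable_rVE -setI_closed_g_dynkin_g_sigma_algebra; last first.
    by move=> _ _ [a [b ->]] [a' [b' ->]]; rewrite boxI; do 2 eexists.
  by apply: smallest_sub => // _ [a [b ->]]; split; [exact: measurable_box|exact: gB].
have : ae_eq mu setT (EFin \o g) (cst 0%E).
  apply: integral_ae_eq => // A _ mA; rewrite integral0; have [] := mD _ mA; by [].
by apply: filterS => x /(_ Logic.I) /= [].
Qed.

(** Smooth functions between 0 and 1 that vanish off the open box and tend pointwise to its
    indicator: each factor climbs over a width 1/(k+1) at either end. *)
Definition box_tensor l r (k : nat) : 'I_n -> R -> R := fun i t =>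
  step (k.+1%:R * t + - (k.+1%:R * l i)) * step (- k.+1%:R * t + k.+1%:R * r i).

Lemma smooth_box_tensor l r k i : smooth (box_tensor l r k i).
Proof. by apply: smoothM; apply: smooth_comp_affine; exact: smooth_step. Qed.

Lemma box_tensor_ge0 l r k i t : 0 <= box_tensor l r k i t.
Proof. by rewrite mulr_ge0// step_ge0. Qed.

Lemma box_tensor_le1 l r k i t : box_tensor l r k i t <= 1.
Proof. by rewrite /box_tensor -[leRHS]mulr1 ler_pM ?step_ge0 ?step_le1. Qed.

Lemma box_tensor_eq0 l r k i t : ~~ (l i < t < r i) -> box_tensor l r k i t = 0.
Proof.
rewrite negb_and -!leNgt => /orP[tl|rt].
  by rewrite /box_tensor step_le0 ?mul0r// -mulrBr pmulr_rle0// subr_le0.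
by rewrite /box_tensor [X in _ * X]step_le0 ?mulr0// mulNr addrC -mulrBr pmulr_rle0// subr_le0.
Qed.

Lemma cvg_box_tensor l r (x : 'rV[R]_n) :
  tensor (box_tensor l r k) x @[k --> \oo] --> (\1_(box l r) x : R).
Proof.
have [xb|xb] := pselect (box l r x).
  rewrite indicE mem_set//; apply: cvg_near_cst.
  have H : \forall k \near \oo, forall i, box_tensor l r k i (x ord0 i) = 1.
    apply: filter_forall => i; have /andP[lx xr] := xb i.
    have N1 : \forall k \near \oo, (x ord0 i - l i)^-1 < k%:R by exact: nbhs_infty_gtr.
    have N2 : \forall k \near \oo, (r i - x ord0 i)^-1 < k%:R by exact: nbhs_infty_gtr.
    apply: filterS2 N1 N2 => k k1 k2.
    have h1 : 1 <= k.+1%:R * (x ord0 i - l i).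
      rewrite -ler_pdivrMr ?subr_gt0// div1r (le_trans (ltW k1))// ler_nat//.
    have h2 : 1 <= k.+1%:R * (r i - x ord0 i).
      rewrite -ler_pdivrMr ?subr_gt0// div1r (le_trans (ltW k2))// ler_nat//.
    by rewrite /box_tensor !step_ge1 ?mulr1//; lra.
  by apply: filterS H => k Hk; rewrite /tensor big1.
rewrite indicE memNset//=; apply: cvg_near_cst; apply: nearW => k.
by move/existsNP : xb => [i /negP xi]; rewrite /tensor (bigD1 i)//= box_tensor_eq0 ?mul0r.
Qed.

Lemma tensor_box_tensor_norm l r k (x : 'rV[R]_n) : `|tensor (box_tensor l r k) x| <= 1.
Proof.
rewrite /tensor normr_prod; apply: prodr_ile1 => i _.
by rewrite normr_ge0 ger0_norm ?box_tensor_ge0 ?box_tensor_le1.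
Qed.

(** On a closed box inside U, [box_tensor] approximates indicators of open boxes, so [g] integrates
    to 0 over all of them and vanishes almost everywhere there; countably many such boxes cover
    U. *)
Lemma fundamental_lemma U g : open U -> measurable_fun U g ->
  (forall K, compact K -> K `<=` U -> mu.-integrable K (EFin \o g)) ->
  (forall a l r, (forall i, smooth (a i)) -> (forall i t, ~~ (l i <= t <= r i) -> a i t = 0) ->
     cbox l r `<=` U -> \int[mu]_(x in U) (g x * tensor a x) = 0) ->
  {ae mu, forall x, U x -> g x = 0}.
Proof.
move=> oU mg gK gt.
have local c d : cbox c d `<=` U -> {ae mu, forall x, box c d x -> g x = 0}.
  move=> cdU; pose g1 := g \_ (cbox c d).
  have ig1 : intg mu g1.
    have mcd : measurable (cbox c d) by apply: closed_measurable_rV; exact: closed_cbox.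
    by apply: (integrable_restrictT mu g mcd).1; apply: gK => //; exact: compact_cbox.
  have B l r : (forall i, c i <= l i) -> (forall i, r i <= d i) -> \int[mu]_x (g1 x * \1_(box l r) x) = 0.
    move=> cl rd.
    have [||||_ C] := @int_dominated _ _ _ mu (fun k x => g1 x * tensor (box_tensor l r k) x)
      (fun x => g1 x * \1_(box l r) x) (fun x => `|g1 x|).
    - move=> k; apply: measurable_funM; first exact: intg_measurable ig1.
      by apply: smooth_tensor_measurable => i; exact: smooth_box_tensor.
    - exact: intg_norm.
    - by move=> k x; rewrite normrM ler_piMr// tensor_box_tensor_norm.
    - by move=> x; apply: cvgM; [exact: cvg_cst|exact: cvg_box_tensor].
    have Z k : \int[mu]_x (g1 x * tensor (box_tensor l r k) x) = 0.
      rewrite -(gt (box_tensor l r k) l r); last 3 first.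
      - by move=> i; exact: smooth_box_tensor.
      - move=> i t H; apply: box_tensor_eq0; apply: contraNN H => /andP[? ?].
        by rewrite !ltW.
      - move=> x H; apply: cdU => i; have /andP[? ?] := H i.
        by rewrite (le_trans (cl i))//= (le_trans _ (rd i)).
      rewrite [RHS]Rintegral_mkcond; apply: eq_Rintegral => x _; rewrite patchE /g1 patchE.
      have [xcd|xcd] := boolP (x \in cbox c d).
        by rewrite mem_set//; apply: cdU; move: xcd; rewrite inE.
      have -> : tensor (box_tensor l r k) x = 0.
        apply: (@tensor_eq0 _ _ _ c d); last by move: xcd; rewrite notin_setE.
        move=> i t H; apply: box_tensor_eq0; apply: contraNN H => /andP[? ?].
        by rewrite (le_trans (cl i)) ?(le_trans _ (rd i)) ?ltW.
      by rewrite !mulr0; case: ifP.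
    move: C; under eq_fun do rewrite Z.
    by move=> C; have <- := cvg_lim (@Rhausdorff R) C; exact: (cvg_lim (@Rhausdorff R) (cvg_cst _)).
  pose g2 := g \_ (box c d).
  have g2E x : g2 x = g1 x * \1_(box c d) x.
    rewrite /g2 /g1 !patchE indicE; case: ifPn => xb; last by rewrite mulr0.
    rewrite mem_set ?mulr1//; move: xb; rewrite inE => xb i; have /andP[? ?] := xb i.
    by rewrite !ltW.
  have ig2 : intg mu g2.
    rewrite (_ : g2 = fun x => g1 x * \1_(box c d) x); last exact/funext.
    apply: (@intgM _ _ _ _ 1) => //; first by apply: measurable_indic; exact: measurable_box.
    by move=> x; rewrite indicE; case: (_ \in _); rewrite ?normr1 ?normr0.
  have : {ae mu, forall x, g2 x = 0}.
    apply: ae_eq0_box_integrals => //.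
      rewrite (intg_EFin ig2); congr (_%:E); apply: etrans (B c d _ _) => //.
      by apply: eq_Rintegral => x _; rewrite g2E.
    move=> l r; rewrite integral_mkcond restrict_EFin.
    rewrite (intg_EFin (f := g2 \_ (box l r))).
      congr (_%:E); apply: etrans (B (fun i => Num.max (l i) (c i)) (fun i => Num.min (r i) (d i)) _ _).
      - apply: eq_Rintegral => x _; rewrite patchE g2E -boxI !indicE in_setI.
        by case: (x \in box l r); rewrite ?mulr0.
      - by move=> i; rewrite le_max lexx orbT.
      - by move=> i; rewrite ge_min lexx orbT.
    apply: (integrable_restrictT mu g2 (measurable_box l r)).1.
    by apply: integrableS ig2 => //; exact: measurable_box.
  by apply: filterS => x H xb; rewrite -H /g2 patchE mem_set.
(* The exceptional set is covered by the null sets attached to rational boxes whose closure lies in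
   U. *)
pose F (p : 'rV[rat]_n * 'rV[rat]_n) : set 'rV[R]_n :=
  if `[< cbox (fun i => ratr (p.1 ord0 i)) (fun i => ratr (p.2 ord0 i)) `<=` U >]
  then ~` [set x | box (fun i => ratr (p.1 ord0 i)) (fun i => ratr (p.2 ord0 i)) x -> g x = 0] else set0.
have nF p : mu.-negligible (F p).
  by rewrite /F; case: asboolP => [/local//|_]; exact: negligible_set0.
have : mu.-negligible (\bigcup_k (if unpickle k is Some p then F p else set0)).
  by apply: negligible_bigcup => k; case: unpickle => [p|]; [exact: nF|exact: negligible_set0].
apply: negligibleS => x /= /not_implyP[Ux gx].
have /rV_nbhsP[e e0 H] := open_nbhs_nbhs (conj oU Ux).
have /choice[c Hc] : forall i, exists c : rat, x ord0 i - e < ratr c < x ord0 i.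
  move=> i; have [c] := @rat_in_itvoo _ (x ord0 i - e) (x ord0 i) ltac:(lra).
  by rewrite in_itv/=; exists c.
have /choice[d Hd] : forall i, exists d : rat, x ord0 i < ratr d < x ord0 i + e.
  move=> i; have [d] := @rat_in_itvoo _ (x ord0 i) (x ord0 i + e) ltac:(lra).
  by rewrite in_itv/=; exists d.
exists (pickle ((\row_i c i, \row_i d i) : 'rV[rat]_n * 'rV[rat]_n)) => //.
rewrite pickleK /F; case: asboolP => [_|].
  apply/not_implyP; split=> // i /=; rewrite !mxE.
  by move: (Hc i) (Hd i) => /andP[_ ->] /andP[->].
case=> y By; apply: H; apply: rV_norm_lt => // i; rewrite !mxE.
move: (By i); rewrite /= !mxE; move: (Hc i) (Hd i) => /andP[? ?] /andP[? ?] /andP[? ?].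
by rewrite ltr_norml; apply/andP; split; lra.
Qed.

End fundamental_lemma.

Section weak_gradient.
Context {R : realType} {n : nat}.
Local Notation mu := (@lebesgue_rV R n).
Implicit Types (f g u w : 'rV[R]_n -> R) (G H : 'rV[R]_n -> 'rV[R]_n) (Omega U : set 'rV[R]_n) (i : 'I_n).

Lemma weak_gradient_tensor Omega f G a l r i : is_weak_gradient Omega f G ->
  (forall j, smooth (a j)) -> (forall j t, ~~ (l j <= t <= r j) -> a j t = 0) ->
  cbox l r `<=` Omega ->
  \int[mu]_(x in Omega) (f x * tensor (tensor_derive a i) x) =
  - \int[mu]_(x in Omega) (G x ord0 i * tensor a x).
Proof.
move=> [_ _ H] sa a0 sub; have := H (tensor a) i (Cc_infty_tensor sa a0 sub).
by rewrite partial_tensor// /Rintegral => ->; rewrite fineN.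
Qed.

Lemma loc_integrableS Omega U f : measurable Omega -> measurable U -> U `<=` Omega ->
  loc_integrable Omega f -> loc_integrable U f.
Proof.
move=> mO mU UO [mf If]; split; first exact: measurable_funS mf.
by move=> K cK KU; apply: If => //; exact: subset_trans UO.
Qed.

Lemma loc_integrableB Omega f g : loc_integrable Omega f -> loc_integrable Omega g ->
  loc_integrable Omega (f \- g).
Proof.
move=> [mf If] [mg Ig]; split; first exact: measurable_funB.
move=> K cK KO; apply: (integrableB _ (If _ cK KO) (Ig _ cK KO)); exact: compact_measurable_rV.
Qed.

Lemma loc_integrableN Omega f : loc_integrable Omega f -> loc_integrable Omega (\- f).
Proof.
move=> [mf If]; split; first exact: measurable_funN.
by move=> K cK KO; exact: (integrableN (If _ cK KO)).
Qed.

(* Weak identities only see the values of f on the box carrying the test function. *)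
Lemma Rintegral_cbox Omega f (p : 'rV[R]_n -> R) l r : cbox l r `<=` Omega ->
  (forall x, ~ cbox l r x -> p x = 0) ->
  \int[mu]_(x in Omega) (f x * p x) = \int[mu]_x ((f \_ (cbox l r)) x * p x).
Proof.
move=> sub p0; rewrite Rintegral_mkcond; apply: eq_Rintegral => x _; rewrite !patchE.
have [xc|xc] := boolP (x \in cbox l r).
  by rewrite mem_set//; apply: sub; rewrite inE in xc.
by rewrite p0 ?mulr0 ?if_same//; move: xc; rewrite notin_setE.
Qed.

Lemma loc_integrable_cbox Omega f l r : cbox l r `<=` Omega -> loc_integrable Omega f ->
  intg mu (f \_ (cbox l r)).
Proof.
move=> sub [_ If]; have mc : measurable (cbox l r) by apply: closed_measurable_rV; exact: closed_cbox.
by apply: (integrable_restrictT mu f mc).1; apply: If => //; exact: compact_cbox.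
Qed.

Lemma tensor_derive_supp (a : 'I_n -> R -> R) l r i : (forall j t, ~~ (l j <= t <= r j) -> a j t = 0) ->
  forall j t, ~~ (l j <= t <= r j) -> tensor_derive a i j t = 0.
Proof.
move=> a0 j t tlr; rewrite /tensor_derive; case: ifP => _; last exact: a0.
suff [_ <-] : is_derive t (1 : R) (a j) 0 by rewrite derive1E.
apply: (@near_eq_is_derive _ _ _ (fun=> 0)).
move: tlr; rewrite negb_and -!ltNge => /orP[tl|rt].
  near=> s; rewrite a0//; rewrite negb_and -ltNge.
  by apply/orP; left; near: s; exact: lt_nbhsl.
near=> s; rewrite a0//; rewrite negb_and -!ltNge.
by apply/orP; right; near: s; exact: lt_nbhsr.
Unshelve. all: by end_near. Qed.

Lemma cbox_tensor_bounded (a : 'I_n -> R -> R) l r : (forall j, smooth (a j)) ->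
  (forall j t, ~~ (l j <= t <= r j) -> a j t = 0) -> exists2 M : R, 0 <= M & forall x, `|tensor a x| <= M.
Proof.
move=> sa a0; have ca : continuous (tensor a).
  by apply: continuous_tensor => j; exact: smooth_continuous.
have [|M M0 H] := @compact_bounded_fun _ _ (cbox l r) (tensor a) (@compact_cbox _ _ l r).
  exact: continuous_subspaceT.
exists M => // x; have [xc|xc] := pselect (cbox l r x); first exact: H.
by rewrite (tensor_eq0 a0)// normr0.
Qed.

Lemma smooth_tensor_derive (a : 'I_n -> R -> R) i : (forall j, smooth (a j)) ->
  forall j, smooth (tensor_derive a i j).
Proof. by move=> sa j; rewrite /tensor_derive; case: ifP => // _; exact: smooth_derive1. Qed.

Lemma intg_tensor f (a : 'I_n -> R -> R) l r : intg mu f -> (forall j, smooth (a j)) ->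
  (forall j t, ~~ (l j <= t <= r j) -> a j t = 0) -> intg mu (fun x => f x * tensor a x).
Proof.
move=> hf sa a0; have [M M0 HM] := cbox_tensor_bounded sa a0.
by apply: (intgM hf _ HM); exact: smooth_tensor_measurable.
Qed.

(** Both gradients have the same integrals against tensor products supported in [Omega], so the
    fundamental lemma applies to their difference. It allows the arbitrary selection [wgrad] to be
    replaced by an explicit weak gradient. *)
Lemma weak_gradient_unique Omega f g G H : open Omega ->
  {ae mu, forall x, Omega x -> f x = g x} ->
  is_weak_gradient Omega f G -> is_weak_gradient Omega g H ->
  {ae mu, forall x, Omega x -> G x = H x}.
Proof.
move=> oO fg wG wH; have mO := open_measurable_rV oO.
suff HH i : {ae mu, forall x, Omega x -> G x ord0 i - H x ord0 i = 0}.
  have HA : {ae mu, forall x i, Omega x -> G x ord0 i - H x ord0 i = 0}.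
    exact: (@filter_forall _ _ (fun i x => Omega x -> G x ord0 i - H x ord0 i = 0) (almost_everywhere mu) _ HH).
  apply: filterS HA => x Hx Ox; apply/rowP => i; apply/eqP; rewrite -subr_eq0; exact/eqP/Hx.
have [lf lG _] := wG; have [lg lH _] := wH.
have [mGH iGH] := loc_integrableB (lG i) (lH i).
apply: (fundamental_lemma oO mGH iGH) => a l r sa a0 sub.
have t0 x := @tensor_eq0 _ _ a l r x a0.
have dt0 x := @tensor_eq0 _ _ (tensor_derive a i) l r x (tensor_derive_supp i a0).
have ig1 : intg mu (fun x => ((fun x => G x ord0 i) \_ (cbox l r)) x * tensor a x).
  by apply: intg_tensor a0 => //; exact: loc_integrable_cbox (lG i).
have ig2 : intg mu (fun x => ((fun x => H x ord0 i) \_ (cbox l r)) x * tensor a x).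
  by apply: intg_tensor a0 => //; exact: loc_integrable_cbox (lH i).
rewrite (Rintegral_cbox _ sub t0).
transitivity (\int[mu]_x (((fun x => G x ord0 i) \_ (cbox l r)) x * tensor a x -
    ((fun x => H x ord0 i) \_ (cbox l r)) x * tensor a x)).
  apply: eq_Rintegral => x _; rewrite !patchE -mulrBl; congr (_ * _).
  by case: ifP => _ //; exact: (esym (subrr _)).
rewrite (intB ig1 ig2) -!(Rintegral_cbox _ sub t0).
rewrite -[X in X - _]opprK -(weak_gradient_tensor i wG sa a0 sub).
rewrite -[X in _ - X]opprK -(weak_gradient_tensor i wH sa a0 sub).
rewrite !(Rintegral_cbox _ sub dt0).
have if' : intg mu (fun x => (f \_ (cbox l r)) x * tensor (tensor_derive a i) x).
  apply: (intg_tensor (loc_integrable_cbox sub lf) (smooth_tensor_derive i sa)).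
  exact: tensor_derive_supp a0.
have ig' : intg mu (fun x => (g \_ (cbox l r)) x * tensor (tensor_derive a i) x).
  apply: (intg_tensor (loc_integrable_cbox sub lg) (smooth_tensor_derive i sa)).
  exact: tensor_derive_supp a0.
have fg' : {ae mu, forall x, (f \_ (cbox l r)) x * tensor (tensor_derive a i) x =
    (g \_ (cbox l r)) x * tensor (tensor_derive a i) x}.
  apply: filterS fg => x Hx; rewrite !patchE; case: ifPn => // xc; rewrite Hx//.
  by apply: sub; rewrite inE in xc.
have [_ ->] := intg_ae (intg_measurable ig') fg' if'.
by rewrite opprK addrC subrr.
Qed.

Lemma wgradP Omega f : (exists G, is_weak_gradient Omega f G) ->
  is_weak_gradient Omega f (wgrad Omega f).
Proof. by move=> H; exact: (xgetPex (fun=> 0) H). Qed.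

End weak_gradient.

(** * Integration by parts against differentiable functions *)

Section by_parts.
Context {R : realType} {n : nat}.
Local Notation mu := (@lebesgue_rV R n).
Implicit Types (f df g u w phi F dF : 'rV[R]_n -> R) (G H : 'rV[R]_n -> 'rV[R]_n)
  (Omega U : set 'rV[R]_n) (i : 'I_n) (x : 'rV[R]_n).
Local Notation e_ i := (delta_mx ord0 i : 'rV[R]_n).

Lemma nballE (x0 : 'rV[R]_n) (r : R) : 0 <= r ->
  nball x0 r = cbox (fun j => x0 ord0 j - r) (fun j => x0 ord0 j + r).
Proof.
move=> r0; apply/seteqP; split=> x /=.
  move=> xr j; have := le_trans (coord_le_norm (x - x0) j) xr; rewrite !mxE ler_norml => /andP[? ?].
  by apply/andP; split; lra.
move=> H; apply: rV_norm_le => // j; rewrite !mxE ler_norml; have /andP[? ?] := H j.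
by apply/andP; split; lra.
Qed.

Lemma nball_suppE (a : 'I_n -> R -> R) (x0 : 'rV[R]_n) (r : R) :
  (forall j t, r < `|t - x0 ord0 j| -> a j t = 0) ->
  forall j t, ~~ (x0 ord0 j - r <= t <= x0 ord0 j + r) -> a j t = 0.
Proof.
move=> H j t tr; apply: H; rewrite ltNge; apply: contraNN tr; rewrite ler_norml => /andP[? ?].
by apply/andP; split; lra.
Qed.

(** By translation invariance the difference quotients of [F] integrate to 0, and their integrals
    tend to minus the integral of [dF]. *)
Lemma int_derive_eq0 (x0 : 'rV[R]_n) (r M N : R) i F dF : 0 <= r ->
  (forall x, is_derive x (e_ i) F (dF x)) -> measurable_fun setT F ->
  (forall x, `|F x| <= N) -> (forall x, `|dF x| <= M) ->
  (forall x, r < `|x - x0| -> F x = 0) -> (forall x, r < `|x - x0| -> dF x = 0) ->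
  intg mu dF /\ \int[mu]_x dF x = 0.
Proof.
move=> r0 HF mF FN dFM F0 dF0.
(* The radius exceeds that of the support by 1 so that translates by h <= 1 remain covered:
   multiplying by [eta] then changes neither the quotients nor the derivative. *)
pose eta : 'rV[R]_n -> R := \1_(nball x0 (r + 1)).
have ieta : intg mu eta.
  apply: intg_indic; first exact: measurable_nball.
  by apply: bounded_lebesgue_lty; [exact: measurable_nball|exact: bounded_nball].
have [h_ hn] := null_steps_exists (@ltr01 R).
have [|ied C] := @int_growth_cvg _ _ 1 M h_ i eta F dF hn ieta mF.
  by move=> x t _ _; split.
have E : (fun x => eta x * dF x) = dF.
  apply/funext => x; rewrite /eta indicE; have [xr|xr] := boolP (x \in _); first by rewrite mul1r.
  rewrite mul0r dF0//; move: xr; rewrite notin_setE /nball /= => /negP; rewrite -ltNge; lra.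
rewrite E in ied C; split => //.
have iF : intg mu F by exact: intg_bounded_supp mF FN F0.
have Z k : (h_ k)^-1 * \int[mu]_x (eta x * (F (x - h_ k *: e_ i) - F x)) = 0.
  have /andP[h0 h1] := hn.1 k.
  rewrite (_ : \int[mu]_x _ = 0) ?mulr0//.
  transitivity (\int[mu]_x (F (x - h_ k *: e_ i) - F x)).
    apply: eq_Rintegral => x _; rewrite /eta indicE; have [xr|xr] := boolP (x \in _); first by rewrite mul1r.
    move: xr; rewrite notin_setE /nball /= => /negP; rewrite -ltNge => xr.
    rewrite mul0r !F0 ?subrr//; first lra.
    have := ler_normB (x - x0) (h_ k *: e_ i); have := normZ_e (h_ k) i.
    rewrite (gtr0_norm h0) => ? _.
    have := ler_normD (x - h_ k *: e_ i - x0) (h_ k *: e_ i).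
    rewrite (_ : x - h_ k *: e_ i - x0 + h_ k *: e_ i = x - x0); last by rewrite addrAC subrK.
    lra.
  rewrite (intB (intg_shift (- (h_ k *: e_ i)) iF) iF) (int_shift (- (h_ k *: e_ i)) iF) subrr//.
move: C; under eq_fun do rewrite Z.
move=> C; have E0 : - (\int[mu]_x dF x) = 0.
  have <- := cvg_lim (@Rhausdorff R) C; exact: (cvg_lim (@Rhausdorff R) (cvg_cst _)).
by apply/eqP; rewrite -oppr_eq0 E0.
Qed.

(** The product of [phi] with the test function, which vanishes off the ball, has a derivative of
    zero integral. Differentiability of [phi] is needed on the ball only. *)
Lemma classical_by_parts (x0 : 'rV[R]_n) (rho : R) i phi dphi a : 0 <= rho ->
  (forall x, `|x - x0| <= rho -> is_derive x (e_ i) phi (dphi x)) ->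
  {within nball x0 rho, continuous phi} -> {within nball x0 rho, continuous dphi} ->
  (forall j, smooth (a j)) -> (forall j t, rho < `|t - x0 ord0 j| -> a j t = 0) ->
  \int[mu]_x ((phi \_ (nball x0 rho)) x * tensor (tensor_derive a i) x) =
  - \int[mu]_x ((dphi \_ (nball x0 rho)) x * tensor a x).
Proof.
move=> r0 Hphi cphi cdphi sa a0.
have mB := @measurable_nball _ _ x0 rho.
have [Mp Mp0 HMp] := compact_bounded_fun (@compact_nball _ _ x0 rho) cphi.
have [Md Md0 HMd] := compact_bounded_fun (@compact_nball _ _ x0 rho) cdphi.
have da0 := tensor_derive_supp i (nball_suppE a0).
have sda := smooth_tensor_derive i sa.
have [Ma Ma0 HMa] := cbox_tensor_bounded sa (nball_suppE a0).
have [Mda Mda0 HMda] := cbox_tensor_bounded sda da0.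
have ta0 x : rho < `|x - x0| -> tensor a x = 0 by exact: tensor_supp0.
have tda0 x : rho < `|x - x0| -> tensor (tensor_derive a i) x = 0.
  move=> xr; apply: (tensor_eq0 da0); rewrite -nballE// /nball /= => /(lt_le_trans xr); by rewrite ltxx.
pose p := phi \_ (nball x0 rho); pose dp := dphi \_ (nball x0 rho).
have mp : measurable_fun setT p.
  by apply: (measurable_restrictT phi mB).1; exact: continuous_measurable_rV mB cphi.
have mdp : measurable_fun setT dp.
  by apply: (measurable_restrictT dphi mB).1; exact: continuous_measurable_rV mB cdphi.
have pE x : `|x - x0| <= rho -> p x = phi x by move=> xr; rewrite /p patchE mem_set.
have dpE x : `|x - x0| <= rho -> dp x = dphi x by move=> xr; rewrite /dp patchE mem_set.
have p0 x : rho < `|x - x0| -> p x = 0.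
  by move=> xr; rewrite /p patchE memNset//= => /(lt_le_trans xr); rewrite ltxx.
have dp0 x : rho < `|x - x0| -> dp x = 0.
  by move=> xr; rewrite /dp patchE memNset//= => /(lt_le_trans xr); rewrite ltxx.
have pM x : `|p x| <= Mp.
  by have [xr|xr] := leP `|x - x0| rho; [rewrite pE//; exact: HMp|rewrite p0// normr0].
have dpM x : `|dp x| <= Md.
  by have [xr|xr] := leP `|x - x0| rho; [rewrite dpE//; exact: HMd|rewrite dp0// normr0].
have ip : intg mu p by exact: intg_bounded_supp mp pM p0.
have idp : intg mu dp by exact: intg_bounded_supp mdp dpM dp0.
have ma := smooth_tensor_measurable sa; have mda := smooth_tensor_measurable sda.
have i1 : intg mu (fun x => p x * tensor (tensor_derive a i) x) by exact: intgM ip mda HMda.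
have i2 : intg mu (fun x => dp x * tensor a x) by exact: intgM idp ma HMa.
have [||||||_] := @int_derive_eq0 x0 rho (Mp * Mda + Md * Ma) (Mp * Ma) i
  (fun x => phi x * tensor a x) (fun x => p x * tensor (tensor_derive a i) x + dp x * tensor a x) r0.
- move=> x; have [xr|xr] := leP `|x - x0| rho.
    apply: is_derive_eq (is_deriveM_fun (Hphi x xr) (is_derive_smooth_tensor x i sa)) _.
    by rewrite pE// dpE// [tensor a x * _]mulrC.
  rewrite p0// dp0// !mul0r addr0; apply: (@near_eq_is_derive _ _ _ (fun=> 0)).
  have : nbhs x [set y | rho < `|y - x0|].
    by apply: (@continuous_dist _ _ x0 x [set t | rho < t]); exact: lt_nbhsr.
  by apply: filterS => y yr; rewrite ta0// mulr0.
- rewrite (_ : (fun x => _) = (fun x => p x * tensor a x)); first exact: measurable_funM.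
  apply/funext => x; have [xr|xr] := leP `|x - x0| rho; first by rewrite pE.
  by rewrite ta0// !mulr0.
- move=> x; have [xr|xr] := leP `|x - x0| rho; first by rewrite -pE// normrM ler_pM.
  by rewrite ta0// mulr0 normr0 mulr_ge0.
- by move=> x; rewrite (le_trans (ler_normD _ _))// !normrM lerD// ler_pM.
- by move=> x xr; rewrite ta0// mulr0.
- by move=> x xr; rewrite p0// dp0// !mul0r addr0.
by rewrite (intD i1 i2) => /eqP; rewrite addr_eq0 => /eqP.
Qed.

(** Supplies the local weak identity for the difference of a smooth function and the continuous
    representative. Truncation to the ball is harmless, since the test functions vanish outside
    it. *)
Lemma ball_weak_sub (x0 : 'rV[R]_n) (rho : R) i Omega u ubar G phi dphi : 0 <= rho ->
  is_weak_gradient Omega u G -> nball x0 rho `<=` Omega ->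
  measurable_fun (nball x0 rho) ubar ->
  {ae mu, forall x, Omega x -> ubar x = u x} ->
  (forall x, `|x - x0| <= rho -> is_derive x (e_ i) phi (dphi x)) ->
  {within nball x0 rho, continuous phi} -> {within nball x0 rho, continuous dphi} ->
  [/\ intg mu ((fun x => phi x - ubar x) \_ (nball x0 rho)),
      intg mu ((fun x => dphi x - G x ord0 i) \_ (nball x0 rho)) &
      ball_weak x0 rho i ((fun x => phi x - ubar x) \_ (nball x0 rho))
        ((fun x => dphi x - G x ord0 i) \_ (nball x0 rho))].
Proof.
move=> r0 wG BO mub uu Hphi cphi cdphi.
have mB := @measurable_nball _ _ x0 rho; have [lu lG _] := wG.
pose r_ (f : 'rV[R]_n -> R) := f \_ (nball x0 rho).
have cint f : {within nball x0 rho, continuous f} -> intg mu (r_ f).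
  move=> cf; have [M M0 HM] := compact_bounded_fun (@compact_nball _ _ x0 rho) cf.
  have f0 x : rho < `|x - x0| -> r_ f x = 0.
    by move=> xr; rewrite /r_ patchE memNset//= => /(lt_le_trans xr); rewrite ltxx.
  apply: (intg_bounded_supp (x0 := x0) (r := rho) (M := M)) f0.
    by apply: (measurable_restrictT f mB).1; exact: continuous_measurable_rV mB cf.
  move=> x; rewrite /r_ patchE; case: ifPn => [|_]; last by rewrite normr0.
  by rewrite inE => xr; exact: HM.
have rB f g : r_ (fun x => f x - g x) = (fun x => r_ f x - r_ g x).
  apply/funext => x; rewrite /r_ !patchE; case: ifP => _ //; exact: (esym (subrr _)).
have ip := cint _ cphi; have idp := cint _ cdphi.
have lint f : loc_integrable Omega f -> intg mu (r_ f).
  by move=> lf; rewrite /r_ nballE// ; apply: loc_integrable_cbox lf; rewrite -nballE.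
have iu := lint _ lu; have iG := lint _ (lG i).
have uub : {ae mu, forall x, r_ u x = r_ ubar x}.
  apply: filterS uu => x Hx; rewrite /r_ !patchE; case: ifPn => //; rewrite inE => xr.
  by rewrite Hx//; exact: BO.
have mrub : measurable_fun setT (r_ ubar) by apply: (measurable_restrictT ubar mB).1.
have [iub _] := intg_ae mrub uub iu.
rewrite -/(r_ (fun x => phi x - ubar x)) -/(r_ (fun x => dphi x - G x ord0 i)) !rB.
split; [exact: intgB|exact: intgB|].
move=> a sa a0.
have sda := smooth_tensor_derive i sa; have da0 := tensor_derive_supp i (nball_suppE a0).
have it f : intg mu f -> intg mu (fun x => f x * tensor a x).
  by move=> hf; exact: intg_tensor hf sa (nball_suppE a0).
have idt f : intg mu f -> intg mu (fun x => f x * tensor (tensor_derive a i) x).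
  by move=> hf; exact: intg_tensor hf sda da0.
transitivity (\int[mu]_x (r_ phi x * tensor (tensor_derive a i) x - r_ ubar x * tensor (tensor_derive a i) x)).
  by apply: eq_Rintegral => x _; rewrite mulrBl.
rewrite (intB (idt _ ip) (idt _ iub)).
transitivity (- (\int[mu]_x (r_ dphi x * tensor a x - r_ (fun x => G x ord0 i) x * tensor a x))); last first.
  by congr (- _); apply: eq_Rintegral => x _; rewrite mulrBl.
rewrite (intB (it _ idp) (it _ iG)) (classical_by_parts r0 Hphi cphi cdphi sa a0) opprB addrC.
congr (_ + _).
have sub : cbox (fun j => x0 ord0 j - rho) (fun j => x0 ord0 j + rho) `<=` Omega by rewrite -nballE.
have := weak_gradient_tensor i wG sa (nball_suppE a0) sub.
rewrite !(Rintegral_cbox _ sub); last 2 first.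
- by move=> x; apply: tensor_eq0; exact: nball_suppE.
- by move=> x; exact: tensor_eq0.
rewrite -!nballE// -/(r_ u) -/(r_ (fun x => G x ord0 i)) => H.
have [_ <-] := @intg_ae _ _ _ mu _ _ (intg_measurable (idt _ iub)) (filterS (fun x Hx => congr1 (fun t => t * tensor (tensor_derive a i) x) Hx) uub) (idt _ iu).
by rewrite H opprK.
Qed.

End by_parts.

(** * The flux of a smooth function *)

Section flux_field.
Context {R : realType} {n : nat}.
Variables (Omega : set 'rV[R]_n) (q phi : 'rV[R]_n -> R).
Hypotheses (q_C1 : Ck 1 Omega q) (phi_C2 : Ck 2 Omega phi).
Implicit Types (x : 'rV[R]_n) (i j : 'I_n).
Local Notation e_ i := (delta_mx ord0 i : 'rV[R]_n).

Lemma is_derive_comp1 (g : R -> R) (f : 'rV[R]_n -> R) x v (dg df : R) :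
  is_derive (f x) (1 : R) g dg -> is_derive x v f df ->
  is_derive x v (fun y => g (f y)) (dg * df).
Proof.
move=> Hg Hf; apply/is_derive_line0.
apply: (@is_derive1_comp _ g (fun s => f (s *: v + x))).
  by rewrite scale0r add0r.
exact/is_derive_line0.
Qed.

Let DDphi x i j : Omega x -> is_derive x (e_ i) (partial j phi) (partial i (partial j phi) x).
Proof. by move=> Ox; apply/derivableP; exact: (phi_C2 [:: j] Ox).2. Qed.

Let Dq x i : Omega x -> is_derive x (e_ i) q (partial i q x).
Proof. by move=> Ox; apply/derivableP; exact: (q_C1 [::] Ox).2. Qed.

Let cDphi x i : Omega x -> {for x, continuous (partial i phi)}.
Proof. by move=> Ox; exact: (phi_C2 [:: i] Ox).1. Qed.

Let cDDphi x i j : Omega x -> {for x, continuous (partial i (partial j phi))}.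
Proof. by move=> Ox; exact: (phi_C2 [:: i; j] Ox).1. Qed.

Let cq x : Omega x -> {for x, continuous q}.
Proof. by move=> Ox; exact: (q_C1 [::] Ox).1. Qed.

Let cDq x i : Omega x -> {for x, continuous (partial i q)}.
Proof. by move=> Ox; exact: (q_C1 [:: i] Ox).1. Qed.

Definition grad_sqr x : R := dotv (grad phi x) (grad phi x).

(** This is |grad phi|^(q-2), written as an exponential of ln |grad phi|^2 so that, where the
    gradient is nonzero, its dependence on both [q] and [phi] is differentiated by the usual
    rules. *)
Definition grad_pow x : R := expR ((q x - 2) / 2 * ln (grad_sqr x)).

Definition flux_field i x : R := grad_pow x * partial i phi x.

Definition flux_derive i x : R := grad_pow x * partial i (partial i phi) x +
  partial i phi x * (grad_pow x * (partial i q x / 2 * ln (grad_sqr x) +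
    (q x - 2) * (\sum_j partial j phi x * partial i (partial j phi) x) / grad_sqr x)).

Lemma grad_sqrE x : grad_sqr x = \sum_j partial j phi x * partial j phi x.
Proof. by apply: eq_bigr => j _; rewrite !mxE. Qed.

Lemma is_derive_grad_sqr i x : Omega x -> is_derive x (e_ i) grad_sqr
  (2 * \sum_j partial j phi x * partial i (partial j phi) x).
Proof.
move=> Ox; rewrite (_ : grad_sqr = fun x => \sum_j partial j phi x * partial j phi x); last exact/funext/grad_sqrE.
apply: is_derive_eq (is_derive_fsum (fun j => is_deriveM_fun (DDphi i j Ox) (DDphi i j Ox))) _.
rewrite mulr_sumr; apply: eq_bigr => j _; ring.
Qed.

Lemma is_derive_flux_field i x : Omega x -> 0 < grad_sqr x ->
  is_derive x (e_ i) (flux_field i) (flux_derive i x).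
Proof.
move=> Ox s0; have dln := is_derive_comp1 (is_derive1_ln s0) (is_derive_grad_sqr i Ox).
have dq2 : is_derive x (e_ i) (fun y => (q y - 2) / 2) (partial i q x / 2).
  have h := is_deriveM_fun (is_deriveB (Dq i Ox) (is_derive_cst (2 : R) x (e_ i))) (is_derive_cst (2^-1 : R) x (e_ i)).
  by apply: is_derive_eq h _; rewrite mulr0 add0r subr0 mulrC.
have dexp := is_derive_comp1 (is_derive_expR _) (is_deriveM_fun dq2 dln).
apply: is_derive_eq (is_deriveM_fun dexp (DDphi i i Ox)) _.
rewrite /flux_derive -/(grad_pow x); field; by rewrite gt_eqF.
Qed.

Lemma continuous_fsum (I : finType) (F : I -> 'rV[R]_n -> R) x :
  (forall k, {for x, continuous (F k)}) -> {for x, continuous (fun y => \sum_k F k y)}.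
Proof.
move=> cF; rewrite (_ : (fun _ => _) = \sum_k F k); last by apply/funext => y; rewrite fct_sumE.
elim/big_ind: _ => [|f g cf cg|k _]; [exact: cst_continuous|exact: continuousD|exact: cF].
Qed.

Lemma continuous_grad_sqr x : Omega x -> {for x, continuous grad_sqr}.
Proof.
move=> Ox; rewrite (_ : grad_sqr = fun x => \sum_j partial j phi x * partial j phi x); last exact/funext/grad_sqrE.
by apply: continuous_fsum => j; apply: continuousM; exact: cDphi.
Qed.

Let cln x : Omega x -> 0 < grad_sqr x -> {for x, continuous (fun y => ln (grad_sqr y))}.
Proof.
move=> Ox s0; apply: continuous_comp; first exact: continuous_grad_sqr.
exact: continuous_ln.
Qed.

Lemma continuous_grad_pow x : Omega x -> 0 < grad_sqr x -> {for x, continuous grad_pow}.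
Proof.
move=> Ox s0; apply: continuous_comp; last exact: continuous_expR.
apply: (@continuousM _ _ (fun y => (q y - 2) / 2)); last exact: cln.
apply: (@continuousM _ _ (fun y => q y - 2)); last exact: cst_continuous.
by apply: (@continuousB _ _ _ q (cst 2)); [exact: cq|exact: cst_continuous].
Qed.

Lemma continuous_flux_field i x : Omega x -> 0 < grad_sqr x -> {for x, continuous (flux_field i)}.
Proof. by move=> Ox s0; apply: continuousM; [exact: continuous_grad_pow|exact: cDphi]. Qed.

Lemma continuous_flux_derive i x : Omega x -> 0 < grad_sqr x -> {for x, continuous (flux_derive i)}.
Proof.
move=> Ox s0; have cE := continuous_grad_pow Ox s0.
apply: (@continuousD _ _ _ (fun y => grad_pow y * partial i (partial i phi) y)).
  by apply: continuousM => //; exact: cDDphi.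
apply: (@continuousM _ _ (partial i phi)); first exact: cDphi.
apply: (@continuousM _ _ grad_pow); first exact: cE.
apply: (@continuousD _ _ _ (fun y => partial i q y / 2 * ln (grad_sqr y))).
  apply: (@continuousM _ _ (fun y => partial i q y / 2)); last exact: cln.
  by apply: (@continuousM _ _ (partial i q)); [exact: cDq|exact: cst_continuous].
apply: (@continuousM _ _ (fun y => (q y - 2) * (\sum_j partial j phi y * partial i (partial j phi) y))).
  apply: (@continuousM _ _ (fun y => q y - 2)).
    by apply: (@continuousB _ _ _ q (cst 2)); [exact: cq|exact: cst_continuous].
  by apply: continuous_fsum => j; apply: continuousM; [exact: cDphi|exact: cDDphi].
by apply: (@continuousV _ _ grad_sqr); [rewrite gt_eqF|exact: continuous_grad_sqr].
Qed.

Lemma enorm_gradE x : 0 < grad_sqr x -> forall t : R,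
  enorm (grad phi x) `^ t = expR (t / 2 * ln (grad_sqr x)).
Proof.
move=> s0 t; have e0 : 0 < enorm (grad phi x) by rewrite sqrtr_gt0.
rewrite /powR gt_eqF// -[in RHS](@sqr_sqrtr _ (grad_sqr x)) ?ltW// lnXn// /enorm -/(grad_sqr x).
by congr expR; rewrite -mulr_natl; field.
Qed.

Lemma flux_fieldE i x : 0 < grad_sqr x ->
  flux_field i x = enorm (grad phi x) `^ (q x - 2) * grad phi x ord0 i.
Proof. by move=> s0; rewrite enorm_gradE// mxE. Qed.

Lemma grad_sqr_gt0 x : (0 < grad_sqr x) = (grad phi x != 0).
Proof.
have ge0 : 0 <= grad_sqr x by apply: sumr_ge0 => i _; rewrite -expr2 sqr_ge0.
rewrite lt_neqAle ge0 andbT eq_sym; congr (~~ _); apply/eqP/eqP => [s0|g0].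
  apply/rowP => i; rewrite !mxE; apply/eqP; rewrite -sqrf_eq0 expr2.
  have := psumr_eq0P (P := predT) (F := fun i => grad phi x ord0 i * grad phi x ord0 i) _ s0.
  by move=> /(_ (fun i _ => ltac:(by rewrite -expr2 sqr_ge0)) i isT); rewrite mxE => ->.
by rewrite /grad_sqr g0 /dotv big1// => i _; rewrite mxE mul0r.
Qed.

(** In div V, differentiating [partial i phi] gives the trace of the Hessian, differentiating the
    exponent [q] gives the logarithmic term, and differentiating |grad phi|^2 gives the
    infinity-Laplacian. *)
Lemma sum_flux_derive x : 0 < grad_sqr x ->
  \sum_i flux_derive i x = - minus_qx_laplacian q x (grad phi x) (hessian phi x).
Proof.
move=> s0; rewrite /minus_qx_laplacian; have := s0; rewrite grad_sqr_gt0 => /negbTE ->.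
rewrite (enorm_gradE s0) (_ : enorm _ `^ (q x - 4) = grad_pow x / grad_sqr x); last first.
  rewrite (enorm_gradE s0) /grad_pow -{3}(lnK (s0 : grad_sqr x \in Num.pos)) -expRN -expRD.
  by congr expR; field.
have -> : ln (enorm (grad phi x)) = ln (grad_sqr x) / 2.
  rewrite -[in RHS](@sqr_sqrtr _ (grad_sqr x)) ?ltW// lnXn ?sqrtr_gt0// -mulr_natl.
  by rewrite /enorm -/(grad_sqr x); field.
rewrite -/(grad_pow x).
have H1 : \sum_i (grad_pow x * partial i (partial i phi) x) = grad_pow x * \tr (hessian phi x).
  by rewrite /mxtrace mulr_sumr; apply: eq_bigr => i _; rewrite mxE.
have H2 : \sum_i (partial i phi x * (grad_pow x * (partial i q x / 2 * ln (grad_sqr x) +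
    (q x - 2) * (\sum_j partial j phi x * partial i (partial j phi) x) / grad_sqr x))) =
  grad_pow x * (ln (grad_sqr x) / 2) * dotv (grad phi x) (grad q x) +
  (q x - 2) * (grad_pow x / grad_sqr x) * infty_laplacian (grad phi x) (hessian phi x).
  have -> : infty_laplacian (grad phi x) (hessian phi x) =
     \sum_i (partial i phi x * \sum_j partial j phi x * partial i (partial j phi) x).
    by apply: eq_bigr => i _; rewrite mulr_sumr; apply: eq_bigr => j _; rewrite !mxE mulrA.
  rewrite /dotv [X in _ = X + _]mulr_sumr [X in _ = _ + X]mulr_sumr -big_split; apply: eq_bigr => i _.
  rewrite /= !mxE.
  move: (\sum_(j < n) (partial j phi x * partial i (partial j phi) x)) (grad_pow x) (partial i phi x) (partial i q x) (q x) (grad_sqr x) (ln (grad_sqr x)) => A B C D E F G.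
  ring.
apply: etrans (big_split _ _ _ _ _) _; apply: etrans (congr2 +%R H1 H2) _.
move: (\tr _) (infty_laplacian _ _) (grad_pow x) (dotv _ _) (q x) (grad_sqr x) (ln (grad_sqr x)) => A B C D E F G.
ring.
Qed.

End flux_field.

(** * Euclidean inequalities and monotonicity of the flux *)

Section euclidean_facts.
Context {R : realType} {n : nat}.
Implicit Types (a b c : 'rV[R]_n).

Lemma dotvC a b : dotv a b = dotv b a.
Proof. by apply: eq_bigr => i _; rewrite mulrC. Qed.

Lemma dotvBr a b c : dotv a (b - c) = dotv a b - dotv a c.
Proof. by rewrite -sumrB; apply: eq_bigr => i _; rewrite !mxE mulrBr. Qed.

Lemma dotvBl a b c : dotv (a - b) c = dotv a c - dotv b c.
Proof. by rewrite dotvC dotvBr !(dotvC c). Qed.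

Lemma dotvZl (k : R) a b : dotv (k *: a) b = k * dotv a b.
Proof. by rewrite mulr_sumr; apply: eq_bigr => i _; rewrite !mxE mulrA. Qed.

Lemma dotvZr (k : R) a b : dotv a (k *: b) = k * dotv a b.
Proof. by rewrite dotvC dotvZl dotvC. Qed.

Lemma dotv_ge0 a : 0 <= dotv a a.
Proof. by apply: sumr_ge0 => i _; rewrite -expr2 sqr_ge0. Qed.

Lemma enorm_ge0 a : 0 <= enorm a.
Proof. exact: sqrtr_ge0. Qed.

Lemma sqr_enorm a : enorm a ^+ 2 = dotv a a.
Proof. by rewrite sqr_sqrtr// dotv_ge0. Qed.

Lemma coord_le_enorm a (i : 'I_n) : `|a ord0 i| <= enorm a.
Proof.
rewrite -(@ler_pXn2r _ 2)// ?nnegrE ?enorm_ge0// sqr_enorm real_normK ?num_real//.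
rewrite /dotv (bigD1 i)//= -expr2 lerDl; apply: sumr_ge0 => j _.
by rewrite -expr2 sqr_ge0.
Qed.

Lemma enorm_eq0 a : enorm a = 0 -> a = 0.
Proof.
move=> a0; apply/rowP => i; rewrite mxE; apply/eqP.
by rewrite -normr_le0 -a0 coord_le_enorm.
Qed.

Lemma enormN a : enorm (- a) = enorm a.
Proof. by congr Num.sqrt; apply: eq_bigr => i _; rewrite !mxE mulrNN. Qed.

Lemma cauchy_schwarz a b : dotv a b <= enorm a * enorm b.
Proof.
have [a0|an] := eqVneq (enorm a) 0.
  by rewrite a0 mul0r (enorm_eq0 a0) /dotv big1// => i _; rewrite mxE mul0r.
have [b0|bn] := eqVneq (enorm b) 0.
  by rewrite b0 mulr0 (enorm_eq0 b0) /dotv big1// => i _; rewrite mxE mulr0.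
have a0 : 0 < enorm a by rewrite lt_neqAle eq_sym an enorm_ge0.
have b0 : 0 < enorm b by rewrite lt_neqAle eq_sym bn enorm_ge0.
have := dotv_ge0 ((enorm b) *: a - (enorm a) *: b).
rewrite dotvBl !dotvBr !dotvZl !dotvZr -!sqr_enorm (dotvC b a).
move: (dotv a b) (enorm a) (enorm b) a0 b0 => d A B a0 b0 {an bn}.
have -> : B * (B * A ^+ 2) - B * (A * d) - (A * (B * d) - A * (A * B ^+ 2)) = 2 * (A * B) * (A * B - d) by ring.
by rewrite pmulr_rge0 ?mulr_gt0// subr_ge0.
Qed.

(** With A = |a| and B = |b|, the pairing equals (A^(r-1) - B^(r-1)) (A - B) + (A^(r-2) + B^(r-2))
    (A B - a.b). The first term is nonnegative as r > 1, the second by Cauchy-Schwarz. *)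
Lemma flux_monotone (r : R) a b : 1 < r ->
  0 <= dotv (enorm a `^ (r - 2) *: a - enorm b `^ (r - 2) *: b) (a - b).
Proof.
move=> r1; have A0 := enorm_ge0 a; have B0 := enorm_ge0 b.
have CS := cauchy_schwarz a b.
rewrite dotvBl !dotvBr !dotvZl -!sqr_enorm (dotvC b a).
have HA : enorm a * enorm a `^ (r - 2) = enorm a `^ (r - 1).
  by rewrite (_ : r - 2 = (r - 1) - 1) ?mulr_powRB1//; lra.
have HB : enorm b * enorm b `^ (r - 2) = enorm b `^ (r - 1).
  by rewrite (_ : r - 2 = (r - 1) - 1) ?mulr_powRB1//; lra.
have mono : 0 <= (enorm a `^ (r - 1) - enorm b `^ (r - 1)) * (enorm a - enorm b).
  have r10 : 0 <= r - 1 by rewrite subr_ge0 ltW.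
  have [ab|ba] := leP (enorm a) (enorm b).
    have := ge0_ler_powR r10 A0 B0 ab; rewrite -subr_le0 => h1.
    by apply: mulr_le0 => //; rewrite subr_le0.
  have := ge0_ler_powR r10 B0 A0 (ltW ba); rewrite -subr_ge0 => h1.
  by apply: mulr_ge0 => //; rewrite subr_ge0 ltW.
have P0 := powR_ge0 (enorm a) (r - 2); have Q0 := powR_ge0 (enorm b) (r - 2).
move: HA HB mono CS A0 B0 P0 Q0.
move: (dotv a b) (enorm a) (enorm b) (enorm a `^ (r - 1)) (enorm b `^ (r - 1)) (enorm a `^ (r - 2)) (enorm b `^ (r - 2)).
move=> d A B A1 B1 A2 B2 <- <- mono CS A0 B0 P0 Q0.
have h : 0 <= (A2 + B2) * (A * B - d).
  by apply: mulr_ge0; [exact: addr_ge0|rewrite subr_ge0].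
by rewrite -[leRHS]subr0 (_ : _ - 0 = (A * A2 - B * B2) * (A - B) + (A2 + B2) * (A * B - d)) ?addr_ge0//; ring.
Qed.

End euclidean_facts.

Section measurable_powers.
Context {R : realType} d (T : measurableType d).

Lemma measurable_powR2 (D : set T) (f q : T -> R) : measurable D ->
  measurable_fun D f -> measurable_fun D q -> measurable_fun D (fun x => f x `^ q x).
Proof.
move=> mD mf mq.
rewrite (_ : (fun x => _) = (fun x => if f x == 0 then (if q x == 0 then 1 else 0) else expR (q x * ln (f x)))); last first.
  by apply/funext => x; rewrite /powR; case: ifP => // _; case: ifP.
have mb (g : T -> R) : measurable_fun D g -> measurable_fun D (fun x => g x == 0).
  by move=> mg; apply: measurable_fun_eqr.
have m1 : measurable_fun D (fun x => if q x == 0 then 1 else 0 : R).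
  by apply: (measurable_fun_if mD (mb q mq)); exact: measurable_cst.
have m2 : measurable_fun D (fun x => expR (q x * ln (f x))).
  apply: measurableT_comp => //; apply: measurable_funM => //.
  by apply: measurableT_comp => //; exact: measurable_ln.
apply: (measurable_fun_if mD (mb f mf)).
- by apply: (measurable_funS mD _ m1); exact: subIsetl.
- by apply: (measurable_funS mD _ m2); exact: subIsetl.
Qed.

End measurable_powers.

(** * Viscosity inequalities *)

Section truncated_test.
Context {R : realType} {n : nat}.
Local Notation mu := (@lebesgue_rV R n).
Implicit Types (f g u w q : 'rV[R]_n -> R) (G H : 'rV[R]_n -> 'rV[R]_n)
  (Omega : set 'rV[R]_n) (i : 'I_n) (x : 'rV[R]_n).
Local Notation e_ i := (delta_mx ord0 i : 'rV[R]_n).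

Lemma integral_supp Omega f : (forall x, ~ Omega x -> f x = 0) ->
  (\int[mu]_(x in Omega) (f x)%:E = \int[mu]_x (f x)%:E)%E.
Proof.
move=> f0; rewrite integral_mkcond; apply: eq_integral => x _; rewrite patchE.
by case: ifPn => // xO; rewrite f0//; move: xO; rewrite notin_setE.
Qed.

(** [chain_by_parts] accepts an arbitrary C^1 multiplier, so it may be fed any test function [psi]
    directly. This passes from identities on tensor products to the full definition of a weak
    gradient. *)
Lemma trunc_weak_gradient Omega (x0 : 'rV[R]_n) (eps : R) w (Gi : 'I_n -> 'rV[R]_n -> R) :
  0 < eps -> nball x0 (8 * eps) `<=` Omega -> intg mu w -> (forall i, intg mu (Gi i)) ->
  (forall i, ball_weak x0 (8 * eps) i w (Gi i)) ->
  (forall x, `|x - x0| < 8 * eps -> {for x, continuous w}) ->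
  (forall x, 2 * eps < `|x - x0| < 8 * eps -> w x <= 0) ->
  is_weak_gradient Omega (fun x => trunc_pos x0 eps w x ^+ 2 / 2)
    (fun x => \row_i (trunc_pos x0 eps w x * Gi i x)).
Proof.
move=> e0 BO iw iG wG cw wn; set W := trunc_pos x0 eps w.
have W0 x : 2 * eps < `|x - x0| -> W x = 0 by exact: trunc_pos_eq0.
have cW : continuous W by exact: continuous_trunc_pos.
have mW := continuous_measurable_rVT cW.
have [MW MW0 HMW] := continuous_supp_bounded cW W0.
have WO x : ~ Omega x -> W x = 0.
  move=> Ox; apply: W0; rewrite ltNge; apply/negP => xr; apply: Ox; apply: BO.
  by rewrite /nball /=; lra.
have meta : measurable_fun setT (fun x => W x ^+ 2 / 2).
  by apply: measurable_funM => //; exact: measurable_funX.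
have ieta : intg mu (fun x => W x ^+ 2 / 2).
  apply: (intg_bounded_supp (x0 := x0) (r := 2 * eps) (M := MW ^+ 2)) => //; last first.
    by move=> x /W0 ->; rewrite expr0n mul0r.
  move=> x; rewrite normrM normrX [`|2^-1|]ger0_norm// -[leRHS]mulr1 ler_pM ?exprn_ge0//.
    by rewrite lerXn2r ?nnegrE.
  by rewrite invf_le1// ler1n.
have iWG i : intg mu (fun x => W x * Gi i x).
  by rewrite (_ : (fun x => _) = (fun x => Gi i x * W x)); [exact: (intgM (iG i) mW HMW)|apply/funext => x; rewrite mulrC].
have loc f : intg mu f -> loc_integrable Omega f.
  move=> hf; split; first by apply: measurable_funTS; exact: intg_measurable hf.
  by move=> K cK KO; apply: integrableS hf => //; exact: compact_measurable_rV.
split.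
- exact: loc.
- move=> i; rewrite (_ : (fun x => _) = (fun x => W x * Gi i x)); first exact: loc.
  by apply/funext => x; rewrite mxE.
move=> psi i [Cpsi _].
have cpsi : continuous psi by move=> x; exact: (Cpsi 1%N [::] x Logic.I).1.
have dpsi x : is_derive x (e_ i) psi (partial i psi x).
  by apply/derivableP; exact: (Cpsi 1%N [::] x Logic.I).2.
have cdpsi : continuous (partial i psi) by move=> x; exact: (Cpsi 1%N [:: i] x Logic.I).1.
have [|M M0 HM] := @compact_bounded_fun _ _ (nball x0 (8 * eps)) (partial i psi) (@compact_nball _ _ x0 (8 * eps)).
  exact: continuous_subspaceT.
have [|i1 i2 E] := chain_by_parts (M := M) e0 iw (iG i) (wG i) cw wn (f := psi) (df := partial i psi).
  move=> x xr; split; [exact: cpsi|exact: dpsi|apply: HM; rewrite /nball /=; exact: ltW].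
rewrite (@integral_supp Omega (fun x => W x ^+ 2 / 2 * partial i psi x)); last first.
  by move=> x Ox; rewrite (WO x Ox) expr0n !mul0r.
rewrite (@integral_supp Omega (fun x => (\row_j (W x * Gi j x)) ord0 i * psi x)); last first.
  by move=> x Ox; rewrite mxE (WO x Ox) !mul0r.
rewrite (intg_EFin i1) E -/W.
rewrite [X in _ = (- X)%E](_ : _ = (\int[mu]_x (Gi i x * (W x * psi x))%:E)%E); last first.
  by apply: eq_integral => x _; rewrite mxE; congr (_%:E); ring.
by rewrite (intg_EFin i2).
Qed.

Lemma measurable_fun_invr Omega q : measurable Omega -> measurable_fun Omega q ->
  (forall x, Omega x -> 1 < q x) -> measurable_fun Omega (fun x => (q x)^-1).
Proof.
move=> mO mq q1; apply: (@eq_measurable_fun _ _ _ _ _ (fun x => q x `^ (-1))).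
  by move=> x; rewrite inE => Ox; rewrite powR_inv1// (le_trans _ (ltW (q1 _ Ox))).
exact: (measurableT_comp (measurable_powR (-1)) mq).
Qed.

Lemma Lq_le Omega q f (lambda : R) (B : 'rV[R]_n -> R) : measurable Omega ->
  measurable_fun Omega q -> measurable_fun Omega f -> 0 < lambda -> measurable_fun Omega B ->
  (\int[mu]_(x in Omega) (B x)%:E < +oo)%E ->
  (forall x, Omega x -> `|lambda * f x| `^ q x <= B x) -> Lq Omega q f.
Proof.
move=> mO mq mf l0 mB Boo fB; split => //; exists lambda => //.
apply: le_lt_trans Boo; apply: ge0_le_integral => //.
- apply/measurable_EFinP; apply: measurable_powR2 => //.
  by apply: measurableT_comp => //; exact: measurable_funM.
- exact/measurable_EFinP.
Qed.

Lemma Lq_ae Omega q f g : measurable Omega -> measurable_fun Omega q -> measurable_fun Omega g ->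
  {ae mu, forall x, Omega x -> f x = g x} -> Lq Omega q f -> Lq Omega q g.
Proof.
move=> mO mq mg fg [mf [lam l0 foo]]; split; [exact: mg|exists lam; first exact: l0].
have mP h : measurable_fun Omega h -> measurable_fun Omega (fun x => (`|lam * h x| `^ q x)%:E).
  move=> mh; apply/measurable_EFinP; apply: measurable_powR2 => //.
  by apply: measurableT_comp => //; exact: measurable_funM.
have fgP : ae_eq mu Omega (fun x => (`|lam * f x| `^ q x)%:E) (fun x => (`|lam * g x| `^ q x)%:E).
  by apply: filterS fg => x H Ox; rewrite H.
by rewrite -(ae_eq_integral _ _ mO (mP f mf) (mP g mg) fgP).
Qed.

(** On the compact ball q <= Q, hence g^q <= Q g^q / q, and the finite modular of [g] controls the
    gradient of the truncated square. This makes it an admissible test function even if q is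
    unbounded on [Omega]. *)
Lemma trunc_W1q_comp Omega q g (x0 : 'rV[R]_n) (eps Q C : R) w (Gi : 'I_n -> 'rV[R]_n -> R) :
  open Omega -> (mu Omega < +oo)%E -> measurable_fun Omega q -> (forall x, Omega x -> 1 < q x) ->
  (forall x, nball x0 (8 * eps) x -> q x <= Q) ->
  measurable_fun Omega g -> (forall x, 0 <= g x) ->
  (\int[mu]_(x in Omega) (g x `^ q x / q x)%:E < +oo)%E ->
  0 <= C -> (forall i x, nball x0 (8 * eps) x -> `|Gi i x| <= C + g x) ->
  0 < eps -> nball x0 (8 * eps) `<=` Omega -> intg mu w -> (forall i, intg mu (Gi i)) ->
  (forall i, ball_weak x0 (8 * eps) i w (Gi i)) ->
  (forall x, `|x - x0| < 8 * eps -> {for x, continuous w}) ->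
  (forall x, 2 * eps < `|x - x0| < 8 * eps -> w x <= 0) ->
  W1q_comp Omega q (fun x => trunc_pos x0 eps w x ^+ 2 / 2) /\
  {ae mu, forall x, Omega x -> wgrad Omega (fun x => trunc_pos x0 eps w x ^+ 2 / 2) x =
     \row_i (trunc_pos x0 eps w x * Gi i x)}.
Proof.
move=> oO Ooo mq q1 qQ mg g0 goo C0 GC e0 BO iw iG wG cw wn.
have WG := trunc_weak_gradient e0 BO iw iG wG cw wn.
set W := trunc_pos x0 eps w in WG *.
set eta := (fun x => W x ^+ 2 / 2) in WG *.
have mO := open_measurable_rV oO.
have exG : exists G, is_weak_gradient Omega eta G by exists (fun x => \row_i (W x * Gi i x)).
have wW := wgradP exG.
have aeG := weak_gradient_unique oO (aeW mu (fun x (_ : Omega x) => erefl (eta x))) wW WG.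
split => //.
have W0 x : 2 * eps < `|x - x0| -> W x = 0 by exact: trunc_pos_eq0.
have cW : continuous W by exact: continuous_trunc_pos.
have mW := continuous_measurable_rVT cW.
have [MW MW0 HMW] := continuous_supp_bounded cW W0.
have meta : measurable_fun setT eta by apply: measurable_funM => //; exact: measurable_funX.
have etaM x : `|eta x| <= MW ^+ 2.
  rewrite /eta normrM normrX [`|2^-1|]ger0_norm// -[leRHS]mulr1 ler_pM ?exprn_ge0//.
    by rewrite lerXn2r ?nnegrE.
  by rewrite invf_le1// ler1n.
have BM : 0 < MW ^+ 2 + 1 by rewrite ltr_wpDl ?exprn_ge0.
split; last first.
  exists (nball x0 (2 * eps)); first exact: compact_nball.
  split; first by move=> x; rewrite /nball /= => xr; apply: BO; rewrite /nball /=; lra.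
  apply: aeW => x _ xr; rewrite /eta W0 ?expr0n ?mul0r//.
  by rewrite ltNge; apply/negP.
split => //.
  apply: (@Lq_le _ _ _ ((MW ^+ 2 + 1)^-1) (fun=> 1)) => //.
  - exact: measurable_funTS.
  - by rewrite invr_gt0.
  - by rewrite integral_cst// mul1e.
  - move=> x Ox; apply: (@le_trans _ _ (1 `^ q x)); last by rewrite powR1.
    apply: ge0_ler_powR => //; rewrite ?nnegrE//.
      by rewrite (le_trans _ (ltW (q1 _ Ox))).
    by rewrite normrM gtr0_norm ?invr_gt0// mulrC ler_pdivrMr// mul1r (le_trans (etaM x))// lerDl.
move=> i.
have mwi : measurable_fun Omega (fun x => wgrad Omega eta x ord0 i) by have [_ /(_ i)[]] := wW.
have aei : {ae mu, forall x, Omega x -> W x * Gi i x = wgrad Omega eta x ord0 i}.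
  by apply: filterS aeG => x H Ox; rewrite H// mxE.
apply: (Lq_ae mO mq mwi aei).
(* D >= 1 gives D^q <= D^Q. *)
pose D := Num.max 1 C.
have D1 : 1 <= D by rewrite /D le_max lexx.
have CD : C <= D by rewrite /D le_max lexx orbT.
(* This scaling absorbs the factor [W], at most [MW], and the factor 2 in C + g <= 2 max(D, g). *)
pose lam := (2 * (MW + 1))^-1.
have l0 : 0 < lam by rewrite invr_gt0 mulr_gt0// ltr_wpDl.
pose B x := D `^ Q + `|Q| * (g x `^ q x / q x).
have mgq : measurable_fun Omega (fun x => g x `^ q x / q x).
  apply: measurable_funM; first exact: measurable_powR2.
  exact: measurable_fun_invr.
have igq : mu.-integrable Omega (fun x => (g x `^ q x / q x)%:E).
  apply/integrableP; split; first exact/measurable_EFinP.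
  move: goo; congr (_ < _)%E; apply: eq_integral => x; rewrite inE => Ox.
  by rewrite /= ger0_norm// divr_ge0 ?powR_ge0// (le_trans _ (ltW (q1 _ Ox))).
have icst : mu.-integrable Omega (cst (D `^ Q)%:E).
  by apply/integrableP; split; [exact: measurable_cst|rewrite integral_cst// lte_mul_pinfty].
apply: (@Lq_le _ _ _ lam B) => //.
- by apply: measurable_funTS; apply: measurable_funM => //; exact: intg_measurable (iG i).
- by apply: measurable_funD => //; exact: measurable_funM.
- exact: (integrable_lty mO (integrableD mO icst (integrableZl mO `|Q| igq))).
- move=> x Ox; rewrite /B.
  have q0 : 0 < q x by have := q1 _ Ox; lra.
  have [x2|x2] := ltP (2 * eps) `|x - x0|.
    rewrite W0// mul0r mulr0 normr0 powR0 ?gt_eqF// addr_ge0 ?powR_ge0// mulr_ge0// divr_ge0 ?powR_ge0//.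
    exact: ltW.
  have xB : nball x0 (8 * eps) x by rewrite /nball /=; lra.
  have xQ := qQ _ xB.
  have t1 : `|lam * (W x * Gi i x)| <= Num.max D (g x).
    rewrite normrM (gtr0_norm l0) /lam mulrC ler_pdivrMr ?mulr_gt0 ?ltr_wpDl// normrM.
    apply: (@le_trans _ _ (MW * (Num.max D (g x) + Num.max D (g x)))).
      apply: ler_pM => //; apply: le_trans (GC i x xB) _; apply: lerD.
        by rewrite le_max CD.
      by rewrite le_max lexx orbT.
    have : 0 <= Num.max D (g x) by rewrite le_max g0 orbT.
    move: (Num.max D (g x)) => t t0.
    rewrite -subr_ge0 (_ : _ - _ = 2 * t); last by ring.
    by rewrite mulr_ge0.
  apply: (@le_trans _ _ (Num.max D (g x) `^ q x)).
    by apply: ge0_ler_powR => //; rewrite ?nnegrE ?(ltW q0)// le_max g0 orbT.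
  have gq : g x `^ q x <= `|Q| * (g x `^ q x / q x).
    rewrite mulrA ler_pdivlMr// mulrC ler_wpM2r ?powR_ge0//.
    exact: le_trans xQ (ler_norm _).
  have Dq : D `^ q x <= D `^ Q by exact: ler_powR.
  have [Dg|gD] := leP D (g x).
    by rewrite (le_trans gq)// lerDr powR_ge0.
  rewrite (le_trans Dq)// lerDl mulr_ge0// divr_ge0 ?powR_ge0//; exact: ltW.
Qed.

End truncated_test.

(** * The supersolution test *)

Section viscosity_test.
Context {R : realType} {n : nat}.
Local Notation mu := (@lebesgue_rV R n).
Implicit Types (f g u w q phi : 'rV[R]_n -> R) (G H : 'rV[R]_n -> 'rV[R]_n)
  (Omega : set 'rV[R]_n) (i : 'I_n) (x : 'rV[R]_n).
Local Notation e_ i := (delta_mx ord0 i : 'rV[R]_n).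

Lemma measurable_dotv Omega G H : (forall i, measurable_fun Omega (fun x => G x ord0 i)) ->
  (forall i, measurable_fun Omega (fun x => H x ord0 i)) ->
  measurable_fun Omega (fun x => dotv (G x) (H x)).
Proof.
by move=> mG mH; apply: measurable_sum => i; exact: measurable_funM.
Qed.

Lemma measurable_enorm Omega G : (forall i, measurable_fun Omega (fun x => G x ord0 i)) ->
  measurable_fun Omega (fun x => enorm (G x)).
Proof.
move=> mG; apply: (@measurableT_comp _ _ _ _ _ _ (@Num.sqrt R)); last exact: measurable_dotv.
by apply: continuous_measurable_fun; exact: sqrt_continuous.
Qed.

Lemma nball_lebesgue_gt0 (x0 : 'rV[R]_n) (r : R) : 0 < r -> (0 < mu (nball x0 r))%E.
Proof.
move=> r0; pose B := box (fun i => x0 ord0 i - r) (fun i => x0 ord0 i + r).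
apply: (@lt_le_trans _ _ (mu B)).
  apply: open_lebesgue_gt0; first exact: open_box.
  by exists x0 => i; apply/andP; split; lra.
apply: le_measure; rewrite ?inE; [exact: measurable_box|exact: measurable_nball|].
move=> x Bx; rewrite nballE ?(ltW r0)// => i; have /andP[? ?] := Bx i.
by apply/andP; split; exact: ltW.
Qed.

Lemma annulus_gap f (x0 : 'rV[R]_n) (r s : R) : {within nball x0 s, continuous f} ->
  (forall x, r <= `|x - x0| <= s -> f x0 < f x) ->
  exists2 m : R, 0 < m & forall x, r <= `|x - x0| <= s -> f x0 + m <= f x.
Proof.
move=> cf Hf; pose A := nball x0 s `&` [set y | r <= `|y - x0|].
have cA : compact A.
  apply: compact_closedI; first exact: compact_nball.
  rewrite (_ : [set y | _] = (fun y => `|y - x0|) @^-1` [set t | r <= t])//.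
  by apply: preimage_closed; [move=> y _; exact: continuous_dist|exact: closed_ge].
have [A0|A0] := pselect (A !=set0); last first.
  by exists 1 => // x /andP[rx xs]; case: A0; exists x; split.
have cfA : {within A, continuous f} by apply: continuous_subspaceW cf => x [].
have [c cA' Hc] := compact_EVT_min A0 cA cfA.
move: cA'; rewrite inE => -[cs rc].
have fc : f x0 < f c by apply: Hf; rewrite rc.
exists (f c - f x0); first by rewrite subr_gt0.
move=> x /andP[rx xs]; rewrite addrC subrK; apply: Hc.
by rewrite inE; split.
Qed.

(** From t^(r-1) <= 1 + t^r with t = |a|. It dominates the pairing of the flux with a gradient of
    size C + |a| by the modular of [a]. *)
Lemma flux_coord_le (r C : R) (a : 'rV[R]_n) i : 1 < r -> 0 <= C ->
  `|(enorm a `^ (r - 2) *: a) ord0 i| * (C + enorm a) <= C + (C + 1) * enorm a `^ r.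
Proof.
move=> r1 C0; rewrite mxE normrM ger0_norm ?powR_ge0//; set t := enorm a.
have t0 : 0 <= t by exact: enorm_ge0.
have h1 : t * t `^ (r - 2) = t `^ (r - 1) by rewrite (_ : r - 2 = (r - 1) - 1) ?mulr_powRB1//; lra.
have h2 : t * t `^ (r - 1) = t `^ r by rewrite mulr_powRB1//; lra.
have h3 : t `^ (r - 1) <= 1 + t `^ r.
  have [t1|t1] := leP t 1.
    have := @ge0_ler_powR R (r - 1) _ t 1; rewrite powR1 !nnegrE => h; rewrite ler_wpDr ?powR_ge0// h//; lra.
  by rewrite ler_wpDl// ler_powR ?(ltW t1)//; lra.
have h4 : t `^ (r - 2) * `|a ord0 i| <= t `^ (r - 1).
  by rewrite -h1 mulrC ler_wpM2r ?powR_ge0// coord_le_enorm.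
apply: le_trans (ler_wpM2r (addr_ge0 C0 t0) h4) _.
by rewrite mulrDr [_ * t]mulrC h2; clear -h3 C0; nra.
Qed.

Lemma viscosity_super_test Omega q u ubar G phi (x0 : 'rV[R]_n) :
  open Omega -> bounded_set Omega -> Ck 1 Omega q -> (forall x, Omega x -> 1 < q x) ->
  is_weak_gradient Omega u G -> (forall x, Omega x -> {for x, continuous ubar}) ->
  {ae mu, forall x, Omega x -> ubar x = u x} ->
  (\int[mu]_(x in Omega) (enorm (G x) `^ q x / q x)%:E < +oo)%E ->
  (forall psi, W1q_comp Omega q psi ->
    \int[mu]_(x in Omega) (dotv (enorm (G x) `^ (q x - 2) *: G x) (wgrad Omega psi x))%:E = 0)%E ->
  Ck 2 Omega phi -> strict_min Omega (ubar \- phi) x0 ->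
  0 <= minus_qx_laplacian q x0 (grad phi x0) (hessian phi x0).
Proof.
move=> oO bO q_C1 q1 wG cub ubu goo weak phi_C2 [Ox0 smin].
have [g0|gn] := eqVneq (grad phi x0) 0; first by rewrite /minus_qx_laplacian g0 eqxx.
rewrite leNgt; apply/negP => F0.
have mO := open_measurable_rV oO.
have Ooo : (mu Omega < +oo)%E by exact: bounded_lebesgue_lty.
have [lu lG _] := wG.
have mG i : measurable_fun Omega (fun x => G x ord0 i) by case: (lG i).
have s0 : 0 < grad_sqr phi x0 by rewrite grad_sqr_gt0.
pose Dv x := \sum_i flux_derive q phi i x.
have Dv0 : 0 < Dv x0 by rewrite /Dv sum_flux_derive// oppr_gt0.
have cDv : {for x0, continuous Dv}.
  by apply: continuous_fsum => i; exact: (continuous_flux_derive q_C1 phi_C2).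
have [rho rho0 Hrho] : exists2 rho, 0 < rho & forall y, `|x0 - y| < rho ->
    [/\ Omega y, 0 < grad_sqr phi y & Dv x0 / 2 < Dv y].
  apply/rV_nbhsP.
  have N1 : nbhs x0 Omega by exact: open_nbhs_nbhs.
  have N2 : nbhs x0 [set y | 0 < grad_sqr phi y].
    have h : grad_sqr phi y @[y --> x0] --> grad_sqr phi x0 by exact: (continuous_grad_sqr phi_C2 Ox0).
    by apply: (h [set t | 0 < t]); exact: lt_nbhsr.
  have N3 : nbhs x0 [set y | Dv x0 / 2 < Dv y].
    have h : Dv y @[y --> x0] --> Dv x0 by exact: cDv.
    by apply: (h [set t | Dv x0 / 2 < t]); apply: lt_nbhsr; rewrite ltr_pdivrMr// mulr_natr mulr2n ltrDl.
  by apply: filterS3 N1 N2 N3 => y ? ? ?; split.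
pose eps := rho / 9.
have e0 : 0 < eps by rewrite divr_gt0.
have BP x : `|x - x0| <= 8 * eps -> [/\ Omega x, 0 < grad_sqr phi x & Dv x0 / 2 < Dv x].
  by move=> xr; apply: Hrho; rewrite distrC; apply: le_lt_trans xr _; rewrite /eps; lra.
have BO : nball x0 (8 * eps) `<=` Omega by move=> x /BP[].
have win f : (forall x, Omega x -> {for x, continuous f}) -> {within nball x0 (8 * eps), continuous f}.
  by move=> cf; apply: continuous_in_subspaceT => x; rewrite inE => /BO; exact: cf.
have cphi x : Omega x -> {for x, continuous phi} by move=> Ox; exact: (phi_C2 [::] x Ox).1.
have cdphi i x : Omega x -> {for x, continuous (partial i phi)} by move=> Ox; exact: (phi_C2 [:: i] x Ox).1.
have dphi i x : Omega x -> is_derive x (e_ i) phi (partial i phi x).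
  by move=> Ox; apply/derivableP; exact: (phi_C2 [::] x Ox).2.
have cq x : Omega x -> {for x, continuous q} by move=> Ox; exact: (q_C1 [::] x Ox).1.
have mq : measurable_fun Omega q.
  apply: continuous_measurable_rV => //; apply: continuous_in_subspaceT => x; rewrite inE; exact: cq.
pose v x := ubar x - phi x.
have cv x : Omega x -> {for x, continuous v}.
  by move=> Ox; apply: continuousB; [exact: cub|exact: cphi].
(* The gap is taken over a whole annulus, not just a sphere: [w] is then nonpositive everywhere
   [trunc_pos] requires it. *)
have [m m0 Hm] : exists2 m : R, 0 < m & forall x, 2 * eps <= `|x - x0| <= 8 * eps -> v x0 + m <= v x.
  apply: annulus_gap; first exact: win.
  move=> x /andP[rx xs]; apply: smin; first exact: BO.
  by apply: contraTneq rx => ->; rewrite subrr normr0 -ltNge mulr_gt0.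
pose psi0 x := phi x + (v x0 + m).
pose w := (fun x => psi0 x - ubar x) \_ (nball x0 (8 * eps)).
pose Gi i := (fun x => partial i phi x - G x ord0 i) \_ (nball x0 (8 * eps)).
have e80 : 0 <= 8 * eps by rewrite mulr_ge0// ltW.
have mub : measurable_fun (nball x0 (8 * eps)) ubar.
  by apply: continuous_measurable_rV; [exact: measurable_nball|exact: win].
have HB i : [/\ intg mu w, intg mu (Gi i) & ball_weak x0 (8 * eps) i w (Gi i)].
  apply: (ball_weak_sub (Omega := Omega) (u := u)) => //.
  - move=> x xr; apply: is_derive_eq (is_deriveD_fun (dphi i x (BO _ xr)) (is_derive_cst (v x0 + m) x (e_ i))) _.
    by rewrite addr0.
  - apply: win => x Ox; apply: (@continuousD _ _ _ phi (cst _)); [exact: cphi|exact: cst_continuous].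
  - by apply: win; exact: cdphi.
have n0 : (0 < n)%N.
  rewrite lt0n; apply: contraNneq gn => n0; apply/eqP/rowP => i.
  by exfalso; move: (ltn_ord i); rewrite [X in (_ < X)%N]n0.
have iw : intg mu w by case: (HB (Ordinal n0)).
have iG i : intg mu (Gi i) by case: (HB i).
have bw i : ball_weak x0 (8 * eps) i w (Gi i) by case: (HB i).
have wE x : `|x - x0| <= 8 * eps -> w x = v x0 + m - v x.
  by move=> xr; rewrite /w patchE mem_set// /psi0 /v; ring.
have cw x : `|x - x0| < 8 * eps -> {for x, continuous w}.
  move=> xr; suff : w y @[y --> x] --> w x by [].
  have : (v x0 + m - v y) @[y --> x] --> v x0 + m - v x.
    apply: (@continuousB _ _ _ (cst (v x0 + m)) v); first exact: cst_continuous.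
    by apply: cv; apply: BO; exact: ltW.
  rewrite wE ?(ltW xr)//; move=> h; apply: cvg_trans h; apply: (@near_eq_cvg _ _ (nbhs x)).
  have hN : nbhs x [set y | `|y - x0| < 8 * eps].
    by apply: (@continuous_dist _ _ x0 x [set t | t < 8 * eps]); exact: lt_nbhsl.
  by apply: filterS hN => y /= yr; rewrite wE// ltW.
have wn x : 2 * eps < `|x - x0| < 8 * eps -> w x <= 0.
  move=> /andP[x2 x8]; rewrite wE ?(ltW x8)// subr_le0; apply: Hm.
  by rewrite (ltW x2) (ltW x8).
pose g x := enorm (G x).
have mg : measurable_fun Omega g by exact: measurable_enorm.
have g_ge0 x : 0 <= g x by exact: enorm_ge0.
have [Q Q0 HQ] := compact_bounded_fun (@compact_nball _ _ x0 (8 * eps)) (win q cq).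
have qQ x : nball x0 (8 * eps) x -> q x <= Q by move=> /HQ; exact: le_trans (ler_norm _).
have [S S0 HS] := compact_bounded_fun (@compact_nball _ _ x0 (8 * eps)) (win _ (continuous_grad_sqr phi_C2)).
have GiE i x : nball x0 (8 * eps) x -> Gi i x = partial i phi x - G x ord0 i.
  by move=> xB; rewrite /Gi patchE mem_set.
(* [S] bounds |grad phi|^2 on the ball, and t^2 <= S implies t <= 1 + S. *)
have GC i x : nball x0 (8 * eps) x -> `|Gi i x| <= (1 + S) + g x.
  move=> xB; rewrite GiE// (le_trans (ler_normB _ _))// lerD ?coord_le_enorm//.
  have := coord_le_enorm (grad phi x) i; rewrite mxE => h; apply: (le_trans h).
  have h1 : enorm (grad phi x) ^+ 2 <= S by rewrite sqr_enorm; apply: le_trans (ler_norm _) (HS x xB).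
  have := enorm_ge0 (grad phi x); move: (enorm _) h1 => t; nra.
have C0 : 0 <= 1 + S by rewrite addr_ge0.
have [memb aeG] := trunc_W1q_comp oO Ooo mq q1 qQ mg g_ge0 goo C0 GC e0 BO iw iG bw cw wn.
have {weak} := weak _ memb.
set W := trunc_pos x0 eps w in memb aeG *.
set eta := (fun x => W x ^+ 2 / 2) in memb aeG *.
move=> weak.
have W0 x : 2 * eps < `|x - x0| -> W x = 0 by exact: trunc_pos_eq0.
have WO x : ~ Omega x -> W x = 0.
  move=> Ox; apply: W0; rewrite ltNge; apply/negP => xr; apply: Ox; apply: BO.
  by rewrite /nball /=; lra.
have W_ge0 x : 0 <= W x by exact: trunc_pos_ge0.
have cW : continuous W by exact: continuous_trunc_pos.
have mW := continuous_measurable_rVT cW.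
have [MW MW0 HMW] := continuous_supp_bounded cW W0.
pose FL x := enorm (G x) `^ (q x - 2) *: G x.
have mFL i : measurable_fun Omega (fun x => FL x ord0 i).
  rewrite (_ : (fun x => _) = (fun x => g x `^ (q x - 2) * G x ord0 i)); last by apply/funext => x; rewrite mxE.
  apply: measurable_funM => //; apply: measurable_powR2 => //.
  exact: measurable_funB.
(* The flux of [u] paired with the weak gradient of [eta]: on the ball, [Gi] is a component of grad
   phi - grad u. The weak equation says that [K] integrates to 0. *)
pose K x := W x * \sum_i FL x ord0 i * Gi i x.
have KO x : ~ Omega x -> K x = 0 by move=> /WO; rewrite /K => ->; rewrite mul0r.
have mGi i : measurable_fun setT (Gi i) by exact: intg_measurable (iG i).
have mKO : measurable_fun Omega K.
  apply: measurable_funM; first exact: measurable_funTS.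
  by apply: measurable_sum => i; apply: measurable_funM => //; exact: measurable_funTS.
have KE : K = K \_ Omega.
  apply/funext => x; rewrite patchE; case: ifPn => //; rewrite notin_setE => Ox; exact: KO.
have mK : measurable_fun setT K by rewrite KE; exact: (measurable_restrictT K mO).1.
have intK0 : (\int[mu]_x (K x)%:E = 0)%E.
  rewrite -(integral_supp KO) -weak; apply/esym; apply: ae_eq_integral => //.
  - apply/measurable_EFinP; apply: measurable_dotv => //.
    move=> i; have [[_ wexists _] _] := memb.
    by have [_ lw _] := wgradP wexists; have [] := lw i.
  - exact/measurable_EFinP.
  apply: filterS aeG => x H Ox; rewrite H//; congr (_%:E); rewrite /K mulr_sumr.
  by apply: eq_bigr => i _; rewrite !mxE; ring.
have WB x : ~ nball x0 (8 * eps) x -> W x = 0.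
  move=> xB; apply: W0; rewrite ltNge; apply/negP => xr; apply: xB; rewrite /nball /=.
  by clear -xr e0; lra.
(* [flux_coord_le] dominates [K]; the bound q <= Q on the ball turns |G|^q into at most Q |G|^q / q,
   whose integral is finite. *)
have iK : intg mu K.
  pose c := MW * n%:R; pose Bd := (fun x => c * ((1 + S) + (2 + S) * Q * (g x `^ q x / q x))) \_ Omega.
  have mgq : measurable_fun Omega (fun x => g x `^ q x / q x).
    by apply: measurable_funM; [exact: measurable_powR2|exact: measurable_fun_invr].
  have igq : mu.-integrable Omega (EFin \o (fun x => g x `^ q x / q x)).
    apply/integrableP; split; first exact/measurable_EFinP.
    rewrite (eq_integral (fun x => (g x `^ q x / q x)%:E)) => [|x]; first exact: goo.
    rewrite inE => Ox; rewrite /= ger0_norm// divr_ge0 ?powR_ge0//.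
    by rewrite (le_trans _ (ltW (q1 _ Ox))).
  have iB : intg mu Bd.
    have i1 := proj1 (integrable_restrictT _ _ mO) igq.
    have i2 := intg_indic mO Ooo.
    have := intgZ c (intgD (intgZ (1 + S) i2) (intgZ ((2 + S) * Q) i1)).
    congr (intg mu _); apply/funext => x; rewrite /Bd !patchE indicE.
    by case: ifPn => xO; rewrite ?mulr1 ?mulr0 ?addr0 ?mulr0.
  apply: (intg_le iB mK) => x.
  have [xB|xB] := pselect (nball x0 (8 * eps) x); last first.
    rewrite /K WB// mul0r normr0 /Bd patchE; case: ifPn => //; rewrite inE => Ox.
    have q0 : 0 < q x by exact: lt_trans ltr01 (q1 _ Ox).
    have t0 := divr_ge0 (powR_ge0 (g x) (q x)) (ltW q0).
    have c0 : 0 <= c := mulr_ge0 MW0 (ler0n R n).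
    apply: (mulr_ge0 c0); apply: (addr_ge0 C0); apply: mulr_ge0 t0.
    by apply: mulr_ge0 Q0; exact: addr_ge0.
  have Ox := BO _ xB; have q0 : 0 < q x by exact: lt_trans ltr01 (q1 _ Ox).
  rewrite /Bd patchE mem_set// /K normrM /c -mulrA ler_pM//.
  apply: le_trans (ler_norm_sum _ _ _) _.
  rewrite mulr_natl -[n in _ *+ n]card_ord -sumr_const; apply: ler_sum => i _.
  rewrite normrM; apply: le_trans (ler_wpM2l (normr_ge0 _) (GC i x xB)) _.
  apply: le_trans (flux_coord_le (G x) i (q1 _ Ox) C0) _.
  rewrite lerD2l (_ : 1 + S + 1 = 2 + S); last by ring.
  rewrite -mulrA ler_wpM2l ?addr_ge0// -[X in X <= _](divfK (lt0r_neq0 q0)).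
  by rewrite mulrC ler_wpM2r ?qQ// divr_ge0 ?powR_ge0// ltW.
have intK : \int[mu]_x K x = 0 by rewrite /Rintegral intK0.
have chain i : [/\ intg mu (fun x => eta x * flux_derive q phi i x),
    intg mu (fun x => Gi i x * (W x * flux_field q phi i x)) &
    \int[mu]_x (eta x * flux_derive q phi i x) = - \int[mu]_x (Gi i x * (W x * flux_field q phi i x))].
  have cD x : nball x0 (8 * eps) x -> {for x, continuous (flux_derive q phi i)}.
    by move=> /BP[Ox sx _]; exact: (continuous_flux_derive q_C1 phi_C2).
  have wD : {within nball x0 (8 * eps), continuous (flux_derive q phi i)}.
    by apply: continuous_in_subspaceT => x; rewrite inE; exact: cD.
  have [M M0 HM] := compact_bounded_fun (@compact_nball _ _ x0 (8 * eps)) wD.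
  apply: (chain_by_parts (M := M) e0 iw (iG i) (bw i) cw wn) => x /ltW xr.
  have [Ox sx _] := BP x xr; split.
  - exact: (continuous_flux_field q_C1 phi_C2).
  - exact: (is_derive_flux_field q_C1 phi_C2).
  - exact: HM.
have ch1 i : intg mu (fun x => eta x * flux_derive q phi i x) by have [] := chain i.
have ch2 i : intg mu (fun x => Gi i x * (W x * flux_field q phi i x)) by have [] := chain i.
have i1 : intg mu (fun x => eta x * Dv x).
  have := intg_sum ch1.
  by congr (intg mu _); apply/funext => x; rewrite /Dv mulr_sumr.
have i2 : intg mu (fun x => \sum_i Gi i x * (W x * flux_field q phi i x)).
  exact: intg_sum ch2.
have E1 : \int[mu]_x (eta x * Dv x) = - \int[mu]_x (\sum_i Gi i x * (W x * flux_field q phi i x)).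
  rewrite (int_sum ch2).
  rewrite (_ : (fun x => eta x * Dv x) = (fun x => \sum_i eta x * flux_derive q phi i x)).
    rewrite (int_sum ch1) -sumrN.
    by apply: eq_bigr => i _; have [_ _ ->] := chain i.
  by apply/funext => x; rewrite /Dv mulr_sumr.
(* Subtracting [K], of zero integral, leaves W times the pairing of [flux_monotone]. *)
have E2 : 0 <= \int[mu]_x (\sum_i Gi i x * (W x * flux_field q phi i x)).
  rewrite -[X in X <= _]intK; apply: (int_le iK i2) => x.
  have [xB|xB] := pselect (nball x0 (8 * eps) x); last first.
    by rewrite /K WB// mul0r big1// => i _; rewrite mul0r mulr0.
  have [Ox sx _] := BP x xB.
  rewrite (_ : \sum_i _ = W x * \sum_i flux_field q phi i x * Gi i x); last first.
    by rewrite mulr_sumr; apply: eq_bigr => i _; rewrite mulrCA [_ * Gi i x]mulrC.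
  rewrite /K ler_wpM2l// -subr_ge0 -sumrB.
  have := flux_monotone (grad phi x) (G x) (q1 _ Ox); congr (0 <= _).
  by apply: eq_bigr => i _; rewrite GiE// flux_fieldE// !mxE; ring.
have eta0 x : 0 <= eta x by rewrite /eta divr_ge0// sqr_ge0.
have eD x : 0 <= eta x * Dv x.
  have [xB|xB] := pselect (nball x0 (8 * eps) x); last first.
    by rewrite /eta WB// expr0n/= !mul0r.
  have [_ _ h] := BP x xB; apply: mulr_ge0 (eta0 x) (ltW (lt_trans _ h)); exact: divr_gt0.
have Wx0 : W x0 = m.
  have x6 : `|x0 - x0| <= 6 * eps by rewrite subrr normr0 mulr_ge0// ltW.
  have x8 : `|x0 - x0| <= 8 * eps by rewrite subrr normr0.
  rewrite /W (trunc_posE w e0 x6) (wE _ x8).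
  by rewrite addrAC subrr add0r max_r// ltW.
have [d d0 Hd] : exists2 d, 0 < d & forall y, `|x0 - y| < d -> m / 2 < W y.
  apply/rV_nbhsP; apply: (cW x0 [set t | m / 2 < t]); apply: lt_nbhsr.
  by rewrite Wx0 ltr_pdivrMr// mulr_natr mulr2n ltrDl.
(* A lower bound of [eta * Dv] near x0, from W > m / 2 and Dv > Dv x0 / 2. Its integral over a small
   ball is positive, against the sign just obtained. *)
pose k := (m / 2) ^+ 2 / 2 * (Dv x0 / 2).
have k0 : 0 < k by rewrite /k !(mulr_gt0, exprn_gt0, divr_gt0).
pose r := Num.min (d / 2) eps.
have r0 : 0 < r by rewrite /r lt_min e0 divr_gt0.
have mB := @measurable_nball _ _ x0 r.
have Boo : (mu (nball x0 r) < +oo)%E by apply: bounded_lebesgue_lty => //; exact: bounded_nball.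
have E3 : k * fine (mu (nball x0 r)) <= \int[mu]_x (eta x * Dv x).
  have -> : fine (mu (nball x0 r)) = \int[mu]_x (\1_(nball x0 r) x : R).
    by rewrite /Rintegral integral_indic// setIT.
  rewrite -(intZ k (intg_indic mB Boo)); apply: (int_le (intgZ k (intg_indic mB Boo)) i1) => x.
  rewrite indicE; have [xB|] := boolP (x \in nball x0 r); last by rewrite mulr0 eD.
  rewrite mulr1; move: xB; rewrite inE /nball /= /r le_min => /andP[xd xe].
  have x8 : `|x - x0| <= 8 * eps by clear -xe e0; lra.
  have Wm : m / 2 < W x by apply: Hd; rewrite distrC; clear -xd d0; lra.
  have [_ _ Dx] := BP x x8.
  have m20 : 0 <= m / 2 by rewrite divr_ge0// ltW.
  have k1 : 0 <= (m / 2) ^+ 2 / 2 := divr_ge0 (sqr_ge0 _) (ler0n R 2).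
  have k2 : 0 <= Dv x0 / 2 := divr_ge0 (ltW Dv0) (ler0n R 2).
  have k3 : (m / 2) ^+ 2 / 2 <= eta x.
    by rewrite /eta ler_wpM2r// ler_pXn2r ?nnegrE ?W_ge0// ltW.
  exact: ler_pM k1 k2 k3 (ltW Dx).
have : 0 < k * fine (mu (nball x0 r)).
  by rewrite mulr_gt0// fine_gt0// Boo andbT; exact: nball_lebesgue_gt0.
move: E1 E2 E3; clear; lra.
Qed.

End viscosity_test.

(** * From the test to both viscosity inequalities *)

Section interior.
Context {R : realType} {n : nat}.
Local Notation mu := (@lebesgue_rV R n).
Implicit Types (f g u w q phi : 'rV[R]_n -> R) (G H : 'rV[R]_n -> 'rV[R]_n)
  (Omega : set 'rV[R]_n) (i : 'I_n) (x : 'rV[R]_n).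
Local Notation e_ i := (delta_mx ord0 i : 'rV[R]_n).

Lemma continuous_within_closure Omega f x : open Omega ->
  {within closure Omega, continuous f} -> Omega x -> {for x, continuous f}.
Proof.
move=> oO /(continuous_subspaceW (@subset_closure _ Omega)).
by rewrite continuous_open_subspace// => cf Ox; apply: cf; rewrite inE.
Qed.

Lemma lsc_within_continuous (A : set 'rV[R]_n) f : {within A, continuous f} -> lsc_on A f.
Proof.
move=> cf x a; rewrite lte_fin => ax; exists [set y : subspace A | a < f y].
  by apply: (cf x [set t | a < t]); exact: lt_nbhsr.
by move=> y /= ay; rewrite lte_fin.
Qed.

Lemma partialsN Omega f (k : nat) (s : seq 'I_n) x : open Omega -> Ck k Omega f ->
  (size s <= k)%N -> Omega x -> partials s (\- f) x = - partials s f x.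
Proof.
move=> oO Cf; elim: s x => //= i s IH x sk Ox.
have df : derivable (partials s f) x (e_ i) by exact: (Cf s x Ox).2.
rewrite /partial -deriveN//; apply: near_eq_derive => /=.
have : nbhs x Omega by exact: open_nbhs_nbhs.
by apply: filterS => y Oy; rewrite IH// ltnW.
Qed.

Lemma CkN Omega f (k : nat) : open Omega -> Ck k Omega f -> Ck k Omega (\- f).
Proof.
move=> oO Cf s x Ox; have nO : nbhs x Omega by exact: open_nbhs_nbhs.
split=> [sk|sk i].
  have h : (- partials s f y) @[y --> x] --> - partials s f x.
    by apply: continuousN; exact: (Cf s x Ox).1.
  suff : partials s (\- f) y @[y --> x] --> partials s (\- f) x by [].
  rewrite (partialsN oO Cf sk Ox); apply: cvg_trans h; apply: (@near_eq_cvg _ _ (nbhs x)).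
  by apply: filterS nO => y Oy; rewrite (partialsN oO Cf).
have df : derivable (partials s f) x (e_ i) by exact: (Cf s x Ox).2.
apply: near_eq_derivable (derivableN df).
by apply: filterS nO => y Oy; rewrite (partialsN oO Cf)// ltnW.
Qed.

Lemma minus_qx_laplacianN q x (p : 'rV[R]_n) (X : 'M[R]_n) :
  minus_qx_laplacian q x (- p) (- X) = - minus_qx_laplacian q x p X.
Proof.
rewrite /minus_qx_laplacian oppr_eq0; case: ifP => _; first by rewrite oppr0.
rewrite enormN raddfN /=.
have -> : infty_laplacian (- p) (- X) = - infty_laplacian p X.
  rewrite /infty_laplacian -sumrN; apply: eq_bigr => i _; rewrite -sumrN.
  by apply: eq_bigr => j _; rewrite !mxE; ring.
have -> : dotv (- p) (grad q x) = - dotv p (grad q x).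
  by rewrite /dotv -sumrN; apply: eq_bigr => i _; rewrite !mxE mulNr.
by ring.
Qed.

(* No integrability is needed: as +oo - +oo = -oo, a zero integral has finite
   positive and negative parts. *)
Lemma integral_eq0N (D : set 'rV[R]_n) (f : 'rV[R]_n -> \bar R) :
  (\int[mu]_(x in D) f x = 0 -> \int[mu]_(x in D) - f x = 0)%E.
Proof.
rewrite (integralE _ D f) (integralE _ D (\- f)%E) funeposN funenegN.
have : (0 <= \int[mu]_(x in D) f^\+ x)%E by apply: integral_ge0.
have : (0 <= \int[mu]_(x in D) f^\- x)%E by apply: integral_ge0.
move: (\int[mu]_(x in D) f^\+ x)%E (\int[mu]_(x in D) f^\- x)%E => [a| |] [b| |]//= _ _.
by rewrite -!EFinB => -[] /eqP; rewrite subr_eq0 => /eqP ->; rewrite subrr.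
Qed.

(** The sign is moved onto the test function, so no integral of an opposite has to be split. *)
Lemma weak_gradientN Omega f G : is_weak_gradient Omega f G -> is_weak_gradient Omega (\- f) (fun x => - G x).
Proof.
move=> [lf lG wG]; split; first exact: loc_integrableN.
  move=> i; rewrite (_ : (fun x => _) = \- (fun x => G x ord0 i)); first exact: loc_integrableN.
  by apply/funext => x; rewrite mxE.
move=> psi i Cpsi.
have [cpsi [K cK [KO psi0]]] := Cpsi.
have CN : Cc_infty Omega (\- psi).
  split; first by move=> k; apply: CkN; [exact: openT|exact: cpsi].
  by exists K => //; split=> // x /psi0 /= ->; rewrite oppr0.
have E := wG (\- psi) i CN.
rewrite (eq_integral (fun x => (f x * partial i (\- psi) x)%:E)) => [|x _]; last first.
  have -> : partial i (\- psi) x = - partial i psi x by exact: (partialsN (s := [:: i]) openT (cpsi 1%N)).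
  by rewrite /= mulrN mulNr.
rewrite E; congr (- _)%E; apply: eq_integral => x _.
by rewrite !mxE /= mulrN mulNr.
Qed.

(** The boundary equality is a separate input; both boundary inequalities are read off from it. *)
Lemma viscosity_solution_of_boundary Omega q u ubar g :
  open Omega -> bounded_set Omega -> Ck 1 Omega q -> (forall x, Omega x -> 1 < q x) ->
  W1q Omega q u -> {within closure Omega, continuous ubar} ->
  {ae mu, forall x, Omega x -> ubar x = u x} -> (rho_grad Omega q u < +oo)%E ->
  (forall psi, W1q_comp Omega q psi ->
    \int[mu]_(x in Omega) (dotv (flux Omega q u x) (wgrad Omega psi x))%:E = 0)%E ->
  (forall x, boundary Omega x -> ubar x = g x) ->
  viscosity_solution Omega (minus_qx_laplacian q) g ubar.
Proof.
move=> oO bO q_C1 q1 [_ wexists _] cu ubu goo weak bdry; have wG := wgradP wexists.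
have cub x (Ox : Omega x) := continuous_within_closure oO cu Ox.
have rhoE G : (forall x, 0 <= enorm (G x)) -> rho Omega q (fun x => enorm (G x)) =
    (\int[mu]_(x in Omega) (enorm (G x) `^ q x / q x)%:E)%E.
  by move=> G0; apply: eq_integral => x _; rewrite ger0_norm.
have goo' := goo; rewrite /rho_grad rhoE in goo'; last by move=> x; exact: enorm_ge0.
split; split.
- exact: lsc_within_continuous.
- by move=> x /bdry ->.
- move=> phi x0 phi_C2 smin; exact: viscosity_super_test oO bO q_C1 q1 wG cub ubu goo' weak phi_C2 smin.
- by apply: lsc_within_continuous => x; apply: continuousN; exact: cu.
- by move=> x /bdry ->.
move=> phi x0 phi_C2 [Ox0 smax].
have gN : grad (\- phi) x0 = - grad phi x0.
  by apply/rowP => i; rewrite !mxE; exact: (partialsN (s := [:: i]) oO phi_C2).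
have hN : hessian (\- phi) x0 = - hessian phi x0.
  by apply/matrixP => i j; rewrite !mxE; exact: (partialsN (s := [:: i; j]) oO phi_C2).
rewrite -oppr_ge0 -minus_qx_laplacianN -gN -hN.
apply: (viscosity_super_test (ubar := \- ubar) oO bO q_C1 q1 (weak_gradientN wG)).
- by move=> x Ox; apply: continuousN; exact: cub.
- by apply: filterS ubu => x H Ox /=; rewrite H.
- by under eq_integral do rewrite enormN; exact: goo'.
- move=> psi Cpsi; rewrite -[RHS](integral_eq0N (weak psi Cpsi)); apply: eq_integral => x _.
  by rewrite enormN /flux !dotvZl /dotv -EFinN -mulrN -sumrN; congr (_ * _)%:E; apply: eq_bigr => i _; rewrite mxE mulNr.
- exact: CkN.
split=> // x Ox xn; have := smax x Ox xn => /=; rewrite !opprK; lra.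
Qed.

End interior.

(** * Extension by zero *)

Section zero_extension.
Context {R : realType} {n : nat}.
Local Notation mu := (@lebesgue_rV R n).
Implicit Types (f g h u w q phi psi : 'rV[R]_n -> R) (G H : 'rV[R]_n -> 'rV[R]_n)
  (Omega : set 'rV[R]_n) (i : 'I_n) (x : 'rV[R]_n).
Local Notation e_ i := (delta_mx ord0 i : 'rV[R]_n).

Lemma loc_integrableM_supp Omega f psi : open Omega -> loc_integrable Omega f ->
  continuous psi -> supported_in Omega psi -> mu.-integrable Omega (EFin \o (fun x => f x * psi x)).
Proof.
move=> oO [mf If] cpsi [K cK [KO psi0]]; have mO := open_measurable_rV oO.
have mK := compact_measurable_rV cK.
have [M M0 HM] := compact_bounded_fun cK (continuous_subspaceT cpsi).
apply/(integrable_restrictT _ _ mO).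
have i1 := proj1 (integrable_restrictT _ f mK) (If K cK KO).
have i2 : intg mu (fun x => M * (f \_ K) x) by exact: intgZ.
have {}i2 := intg_norm i2.
have mfp : measurable_fun setT ((fun x => f x * psi x) \_ Omega).
  apply: (measurable_restrictT (fun x => f x * psi x) mO).1; apply: measurable_funM => //.
  by apply: measurable_funTS; exact: continuous_measurable_rVT.
apply: (intg_le i2 mfp) => x; rewrite !patchE; case: ifPn => [xO|_]; last by rewrite normr0.
case: ifPn => [|]; rewrite ?inE ?notin_setE => xK; last by rewrite psi0// mulr0 normr0.
by rewrite !normrM mulrC ler_wpM2r// (le_trans (HM x xK))// ler_norm.
Qed.

Lemma supported_in_partial Omega psi i : supported_in Omega psi -> supported_in Omega (partial i psi).
Proof.
move=> [K cK [KO psi0]]; exists K => //; split=> // x xK.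
have oK : open (~` K) by apply: closed_openC; exact: (compact_closed (@norm_hausdorff _ _) cK).
have nK : nbhs x (~` K) by exact: open_nbhs_nbhs.
rewrite /partial -[RHS](derive_cst (0 : R) x (e_ i)); apply: near_eq_derive => /=.
by apply: filterS nK => y /psi0.
Qed.

Lemma weak_gradientB Omega f g G H : open Omega ->
  is_weak_gradient Omega f G -> is_weak_gradient Omega g H ->
  is_weak_gradient Omega (f \- g) (fun x => G x - H x).
Proof.
move=> oO [lf lG wG] [lg lH wH]; have mO := open_measurable_rV oO; split.
- exact: loc_integrableB.
- move=> i; rewrite (_ : (fun x => _) = (fun x => G x ord0 i) \- (fun x => H x ord0 i)).
    exact: loc_integrableB.
  by apply/funext => x; rewrite !mxE.
move=> psi i Cpsi; have [cpsi spsi] := Cpsi.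
have cp : continuous psi by move=> x; exact: (cpsi 0%N [::] x I).1.
have cdp : continuous (partial i psi) by move=> x; exact: (cpsi 1%N [:: i] x I).1.
have sdp := supported_in_partial i spsi.
have E1 := wG psi i Cpsi; have E2 := wH psi i Cpsi.
have If := loc_integrableM_supp oO lf cdp sdp; have Ig := loc_integrableM_supp oO lg cdp sdp.
have IG := loc_integrableM_supp oO (lG i) cp spsi; have IH := loc_integrableM_supp oO (lH i) cp spsi.
rewrite (eq_integral (fun x => (f x * partial i psi x)%:E - (g x * partial i psi x)%:E)%E); last first.
  by move=> x _; rewrite -EFinB /= mulrBl.
rewrite [in RHS](eq_integral (fun x => (G x ord0 i * psi x)%:E - (H x ord0 i * psi x)%:E)%E); last first.
  by move=> x _; rewrite -EFinB !mxE /= mulrBl.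
rewrite (integralB mO If Ig) (integralB mO IG IH) /= E1 E2 oppeK.
by rewrite [RHS]fin_num_oppeB//; apply: (integrable_fin_num mO); exact: IH.
Qed.

Lemma nbhd_compact_sub Omega (K : set 'rV[R]_n) : open Omega -> compact K -> K `<=` Omega ->
  exists2 e : R, 0 < e & forall x y, K x -> `|y - x| <= e -> Omega y.
Proof.
move=> oO /compact_near_coveringP cK KO.
have := cK R (at_right (0 : R)) (fun e x => forall y, `|y - x| <= e -> Omega y) _.
case=> [x Kx|].
  have /rV_nbhsP[r r0 Hr] : nbhs x Omega by apply: open_nbhs_nbhs; split=> //; exact: KO.
  exists ([set y | `|x - y| < r / 2], [set e | e < r / 2]).
    split=> /=; first by apply/rV_nbhsP; exists (r / 2); rewrite ?divr_gt0.
    by apply: nbhs_right_lt; rewrite divr_gt0.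
  move=> [y e] [/= xy er] z zy; apply: Hr.
  rewrite -(subrK y x) -addrA (le_lt_trans (ler_normD _ _))// [in X in _ + X]distrC.
  by rewrite [r]splitr ltrD// (le_lt_trans zy).
move=> r /= r0 H; exists (r / 2); first by rewrite divr_gt0.
move=> x y Kx; apply: H => //=; last by rewrite divr_gt0.
by rewrite sub0r normrN gtr0_norm ?divr_gt0// ltr_pdivrMr// mulr_natr mulr2n ltrDl.
Qed.

(** For q > 1 one has t <= 1 + t^q, and [Omega] has finite measure. *)
Lemma Lq_integrable Omega q f : measurable Omega -> (mu Omega < +oo)%E ->
  (forall x, Omega x -> 1 < q x) -> measurable_fun Omega q -> Lq Omega q f -> intg mu (f \_ Omega).
Proof.
move=> mO Ooo q1 mq [mf [lam l0 foo]].
have mP : measurable_fun Omega (fun x => `|lam * f x| `^ q x).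
  by apply: measurable_powR2 => //; apply: measurableT_comp => //; exact: measurable_funM.
have iP : mu.-integrable Omega (EFin \o (fun x => `|lam * f x| `^ q x)).
  apply/integrableP; split; first exact/measurable_EFinP.
  rewrite (eq_integral (fun x => (`|lam * f x| `^ q x)%:E)) => [|x _]; first exact: foo.
  by rewrite /= ger0_norm// powR_ge0.
have i1 := intgZ (lam^-1) (intgD (intg_indic mO Ooo) (proj1 (integrable_restrictT _ _ mO) iP)).
apply: (intg_le i1); first exact: (measurable_restrictT f mO).1.
move=> x; rewrite !patchE indicE; case: ifPn => [|_]; last by rewrite normr0 addr0 mulr0.
rewrite inE => Ox; rewrite -(ler_pM2l l0) mulVKf ?gt_eqF//.
have -> : lam * `|f x| = `|lam * f x| by rewrite normrM gtr0_norm.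
have := normr_ge0 (lam * f x); move: (`|lam * f x|) => t t0.
have [t1|t1] := leP t 1; first by rewrite (le_trans t1)// lerDl powR_ge0.
by rewrite ler_wpDl// -[X in X <= _]powRr1// ler_powR ?(ltW t1)// ltW// q1.
Qed.

End zero_extension.

(** * Modular convergence implies convergence in L^1 *)

Section modular.
Context {R : realType} {n : nat}.
Local Notation mu := (@lebesgue_rV R n).
Implicit Types (f g h u w q phi psi : 'rV[R]_n -> R) (G H : 'rV[R]_n -> 'rV[R]_n)
  (Omega : set 'rV[R]_n) (i : 'I_n) (x : 'rV[R]_n).

Lemma intg_modular Omega q h : measurable Omega -> (forall x, Omega x -> 1 < q x) ->
  measurable_fun Omega q -> measurable_fun Omega h -> (rho Omega q h < +oo)%E ->
  intg mu ((fun x => `|h x| `^ q x / q x) \_ Omega) /\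
  (rho Omega q h = (\int[mu]_x ((fun x => `|h x| `^ q x / q x) \_ Omega) x)%:E)%E.
Proof.
move=> mO q1 mq mh hoo.
have mP : measurable_fun Omega (fun x => `|h x| `^ q x / q x).
  apply: measurable_funM; last exact: measurable_fun_invr.
  by apply: measurable_powR2 => //; exact: measurableT_comp.
have iP : intg mu ((fun x => `|h x| `^ q x / q x) \_ Omega).
  apply/(integrable_restrictT _ _ mO)/integrableP; split; first exact/measurable_EFinP.
  rewrite (eq_integral (fun x => (`|h x| `^ q x / q x)%:E)) => [|x]; first exact: hoo.
  rewrite inE => Ox; rewrite /= ger0_norm// divr_ge0 ?powR_ge0//.
  by rewrite (le_trans _ (ltW (q1 _ Ox))).
split => //; rewrite -(intg_EFin iP) /rho [LHS]integral_mkcond; apply: eq_integral => x _.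
by rewrite /= !patchE; case: ifP.
Qed.

(* The exponents above M only cost an indicator, which is small in measure: this is
   what allows q to be unbounded. *)
Lemma le_modular (d M qx t : R) : 0 < d <= 1 -> 0 <= M -> 1 < qx -> 0 <= t ->
  t <= d + (M / d `^ (M - 1) + 1) * (t `^ qx / qx) + expR 1 * (M < qx)%R%:R.
Proof.
move=> /andP[d0 d1] M0 q1 t0; have q0 : 0 < qx by rewrite (lt_trans _ q1).
have P0 : 0 <= t `^ qx / qx by rewrite divr_ge0 ?powR_ge0// ltW.
have MD0 : 0 <= M / d `^ (M - 1) by rewrite divr_ge0// powR_ge0.
have tE : t `^ qx = t * t `^ (qx - 1) by rewrite mulr_powRB1.
have e0 : 0 <= expR 1 * (M < qx)%R%:R :> R by rewrite mulr_ge0// expR_ge0.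
have [td|dt] := leP t d.
  by rewrite -addrA (le_trans td)// lerDl addr_ge0// mulr_ge0// addr_ge0.
have [Mq|qM] := ltP M qx; rewrite /= ?mulr1 ?mulr0.
  have [te|et] := leP t (expR 1).
    by rewrite ler_wpDl// addr_ge0 ?(ltW d0)// mulr_ge0// addr_ge0.
  rewrite -addrA (ler_wpDl (ltW d0))// ler_wpDr// mulrDl mul1r (ler_wpDl (mulr_ge0 _ _))//.
  rewrite tE ler_pdivlMr// ler_wpM2l//.
  have h : expR (qx - 1) <= t `^ (qx - 1).
    have := @ge0_ler_powR R (qx - 1) _ (expR 1) t; rewrite -expRM mul1r => h; apply: h.
    - by rewrite subr_ge0 ltW.
    - by rewrite nnegrE expR_ge0.
    - by rewrite nnegrE.
    - exact: ltW.
  by apply: le_trans h; apply: le_trans (expR_ge1Dx _); rewrite addrC subrK.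
rewrite addr0 (ler_wpDl (ltW d0))// mulrDl mul1r (ler_wpDr P0)//.
have dM : 0 < d `^ (M - 1) by exact: powR_gt0.
(* For q <= M and t > d with d <= 1, t^(q-1) >= d^(q-1) >= d^(M-1), so t is at most M / d^(M-1)
   times t^q / q. *)
have h : d `^ (M - 1) <= t `^ (qx - 1).
  apply: (@le_trans _ _ (d `^ (qx - 1))).
    by apply: ger_powR; [rewrite d0|rewrite lerB].
  have := @ge0_ler_powR R (qx - 1) _ d t; rewrite !nnegrE => {}h; apply: h => //; try exact: ltW.
  by rewrite subr_ge0 ltW.
rewrite tE (_ : M / _ * _ = t * (M * t `^ (qx - 1) / (qx * d `^ (M - 1)))); last first.
  by field; rewrite !gt_eqF.
rewrite ler_peMr// ler_pdivlMr ?mulr_gt0// mul1r.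
exact: (ler_pM (ltW q0) (ltW dM) qM h).
Qed.

(** The three terms of [le_modular] each get a third of [eps]: k makes the set where q > k small,
    which is possible because these sets shrink to the empty set; d is chosen from the measure of
    [Omega]; [eta] comes last and depends on both. *)
Lemma modular_small Omega q (eps : R) : measurable Omega -> (mu Omega < +oo)%E ->
  (forall x, Omega x -> 1 < q x) -> measurable_fun Omega q -> 0 < eps ->
  exists2 eta : R, 0 < eta & forall h, measurable_fun Omega h -> (rho Omega q h < eta%:E)%E ->
    intg mu (h \_ Omega) -> \int[mu]_x `|(h \_ Omega) x| <= eps.
Proof.
move=> mO Ooo q1 mq e0; set m := fine (mu Omega).
have m0 : 0 <= m by rewrite fine_ge0.
pose g_ (k : nat) x : R := if k%:R < q x then 1 else 0.
pose f_ (k : nat) : 'rV[R]_n -> R := (g_ k) \_ Omega.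
have i1 := intg_indic mO Ooo.
have int1 : \int[mu]_x (\1_Omega x : R) = m by rewrite /Rintegral integral_indic// setIT.
have mf k : measurable_fun setT (f_ k).
  apply: (measurable_restrictT (g_ k) mO).1.
  apply: measurable_fun_if => //; try exact: measurable_cst.
  exact: measurable_fun_ltr.
have fB k x : `|f_ k x| <= \1_Omega x.
  by rewrite /f_ patchE indicE; case: ifP => _; rewrite ?normr0// /g_; case: ifP; rewrite ?normr1 ?normr0.
have f0 x : f_ k x @[k --> \oo] --> (0 : R).
  apply: cvg_near_cst; have : \forall k \near \oo, q x < k%:R by exact: nbhs_infty_gtr.
  apply: filterS => k qk; rewrite /f_ patchE; case: ifP => // _.
  by rewrite /g_ ltNge (ltW qk).
have [_ If] := int_dominated mf i1 fB f0.
rewrite int0 in If.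
have [k Hk] : exists k, \int[mu]_x f_ k x < eps / 3 / expR 1.
  have d0 : 0 < eps / 3 / expR 1 by rewrite !divr_gt0// expR_gt0.
  have := If [set t | t < eps / 3 / expR 1] (lt_nbhsl d0).
  by move=> [k _ H]; exists k; apply: H => /=.
pose d := Num.min 1 (eps / 3 / (m + 1)).
have d0 : 0 < d by rewrite lt_min ltr01 !divr_gt0// ltr_wpDl.
have dm : d * m <= eps / 3.
  have : d <= eps / 3 / (m + 1) by rewrite ge_min lexx orbT.
  by rewrite ler_pdivlMr ?ltr_wpDl// mulrDr; clear -d0; lra.
pose C := k%:R / d `^ (k%:R - 1) + 1.
have C0 : 0 < C by rewrite /C ltr_wpDl// divr_ge0// powR_ge0.
exists (eps / 3 / C); first by rewrite !divr_gt0.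
move=> h mh hrho ih.
have [iP EP] := intg_modular mO q1 mq mh (lt_trans hrho (ltry _)).
rewrite EP lte_fin in hrho.
have ifk : intg mu (f_ k) by exact: intg_le i1 (mf k) (fB k).
have iB := intgD (intgD (intgZ d i1) (intgZ C iP)) (intgZ (expR 1) ifk).
apply: (@le_trans _ _ (d * m + C * \int[mu]_x ((fun x => `|h x| `^ q x / q x) \_ Omega) x + expR 1 * \int[mu]_x f_ k x)).
  rewrite -int1 -(intZ d i1) -(intZ C iP) -(intZ (expR 1) ifk).
  rewrite -(intD (intgZ d i1) (intgZ C iP)) -(intD (intgD (intgZ d i1) (intgZ C iP)) (intgZ (expR 1) ifk)).
  apply: (int_le (intg_norm ih) iB) => x.
  rewrite /f_ !patchE indicE; case: ifPn => [|_]; last by rewrite normr0 !mulr0 !addr0.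
  rewrite inE => Ox; rewrite mulr1 (_ : g_ k x = (k%:R < q x)%R%:R); last by rewrite /g_; case: ifP.
  apply: le_modular => //; last exact: q1.
  by rewrite d0 ge_min lexx.
have h2 : C * \int[mu]_x ((fun x => `|h x| `^ q x / q x) \_ Omega) x <= eps / 3.
  by rewrite mulrC -ler_pdivlMr// ltW.
have h3 : expR 1 * \int[mu]_x f_ k x <= eps / 3.
  by rewrite mulrC -ler_pdivlMr ?expR_gt0// ltW.
move: dm h2 h3; clear; lra.
Qed.

End modular.

(** * Weak differentiability of the extension by zero *)

Section zero_extension_weak.
Context {R : realType} {n : nat}.
Local Notation mu := (@lebesgue_rV R n).
Implicit Types (f g h u v w q phi psi : 'rV[R]_n -> R) (G H : 'rV[R]_n -> 'rV[R]_n)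
  (Omega : set 'rV[R]_n) (i : 'I_n) (x : 'rV[R]_n).
Local Notation e_ i := (delta_mx ord0 i : 'rV[R]_n).

(* f has zero trace: its extension by zero is weakly differentiable on R^n. *)
Definition zext_weak Omega f := forall i (x0 : 'rV[R]_n) (r : R),
  ball_weak x0 r i (f \_ Omega) ((fun x => wgrad Omega f x ord0 i) \_ Omega).

Lemma int_ae0 f : measurable_fun setT f -> {ae mu, forall x, f x = 0} -> \int[mu]_x f x = 0.
Proof.
move=> mf f0; rewrite -[RHS](int0 mu); apply/esym.
by apply: (intg_ae mf _ (intg0 mu)).2; apply: filterS f0 => x ->.
Qed.

(** On the open set [Omega] minus [K] the function vanishes almost everywhere, so its gradient
    integrates to 0 against every test function supported there. *)
Lemma wgrad_ae0 Omega v (K : set 'rV[R]_n) i : open Omega -> compact K ->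
  (exists G, is_weak_gradient Omega v G) -> {ae mu, forall x, Omega x -> ~ K x -> v x = 0} ->
  {ae mu, forall x, Omega x -> ~ K x -> wgrad Omega v x ord0 i = 0}.
Proof.
move=> oO cK wex v0; have wG := wgradP wex; have [[mv _] lG _] := wG.
have mO := open_measurable_rV oO.
have oU : open (Omega `&` ~` K).
  by apply: openI => //; apply: closed_openC; exact: (compact_closed (@norm_hausdorff _ _) cK).
have mU := open_measurable_rV oU.
have UO : Omega `&` ~` K `<=` Omega by move=> x [].
have [mg ig] := loc_integrableS mO mU UO (lG i).
have H : {ae mu, forall x, (Omega `&` ~` K) x -> wgrad Omega v x ord0 i = 0}.
  apply: (fundamental_lemma oU mg ig) => a l r sa a0 sub.
  have t0 x : ~ cbox l r x -> tensor a x = 0 by exact: tensor_eq0.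
  have sub' := subset_trans sub UO.
  rewrite (Rintegral_cbox _ sub t0) -(Rintegral_cbox _ sub' t0).
  apply: oppr_inj; rewrite oppr0 -(weak_gradient_tensor i wG sa a0 sub') Rintegral_mkcond.
  have mT := smooth_tensor_measurable (smooth_tensor_derive i sa).
  apply: int_ae0.
    apply: (measurable_restrictT (fun x => v x * tensor (tensor_derive a i) x) mO).1.
    by apply: measurable_funM => //; exact: measurable_funTS.
  apply: filterS v0 => x vx; rewrite patchE; case: ifPn => //; rewrite inE => Ox.
  have [Kx|Kx] := pselect (K x); last by rewrite vx// mul0r.
  rewrite (@tensor_eq0 _ _ _ l r) ?mulr0//; first exact: tensor_derive_supp.
  by move=> /sub[].
by apply: filterS H => x Hx Ox Kx; exact: Hx.
Qed.

(** A test function on R^n is cut by a fine partition of unity. A piece whose box meets [K] is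
    supported in [Omega], where the weak identity is known; for any other piece, both sides
    vanish. *)
Lemma zext_weak_comp Omega q v : open Omega -> bounded_set Omega ->
  (forall x, Omega x -> 1 < q x) -> measurable_fun Omega q -> W1q_comp Omega q v -> zext_weak Omega v.
Proof.
move=> oO bO q1 mq [[Lv wex Lw] [K cK [KO v0]]] i x0 r a sa a0.
have mO := open_measurable_rV oO; have Ooo := bounded_lebesgue_lty mO bO.
have wG := wgradP wex; have G0 := wgrad_ae0 i oO cK wex v0.
set F := v \_ Omega; set Gi := _ \_ Omega.
have iF : intg mu F by exact: Lq_integrable Lv.
have iG : intg mu Gi by exact: Lq_integrable (Lw i).
have [e e0 He] := nbhd_compact_sub oO cK KO.
have [M [_ HM]] := bO.
(* A strict inequality, so that the partition of unity sums to 1 in a neighbourhood of each point of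
   [Omega] and the sum may be differentiated there. *)
have OM x : Omega x -> `|x| < M + 2.
  by move=> Ox; have /= := HM (M + 1) _ x Ox; rewrite ltrDl => /(_ ltr01) h; apply: le_lt_trans h _; lra.
(* Boxes of half-width e / 2 have diameter e: one that meets [K] stays in [Omega]. *)
have e20 : 0 < e / 2 by rewrite divr_gt0.
have [I [rh [p [srh _ rh0 rh1]]]] := @tensor_grid R n (M + 2) (e / 2) e20.
pose b k j t := a j t * rh k j t.
have sb k j : smooth (b k j) by exact: smoothM.
have b0 k j t : ~~ (p k ord0 j - e / 2 <= t <= p k ord0 j + e / 2) -> b k j t = 0.
  by move=> ht; rewrite /b (nball_suppE (rh0 k) ht) mulr0.
have tb k x : tensor (b k) x = tensor a x * tensor (rh k) x by rewrite /tensor big_split.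
have mT k := smooth_tensor_measurable (sb k).
have mD k := smooth_tensor_measurable (smooth_tensor_derive i (sb k)).
have iFk k : intg mu (fun x => F x * tensor (tensor_derive (b k) i) x).
  apply: intg_tensor iF (smooth_tensor_derive i (sb k)) _; exact: tensor_derive_supp (b0 k).
have iGk k : intg mu (fun x => Gi x * tensor (b k) x) by exact: intg_tensor iG (sb k) (b0 k).
have term k : \int[mu]_x (F x * tensor (tensor_derive (b k) i) x) = - \int[mu]_x (Gi x * tensor (b k) x).
  have patchM f g : (fun x => (f \_ Omega) x * g x) = (fun x => f x * g x) \_ Omega.
    by apply/funext => x; rewrite !patchE; case: ifP => //; rewrite mul0r.
  have [[z [Kz zp]]|noK] := pselect (exists z, K z /\ cbox (fun j => p k ord0 j - e / 2) (fun j => p k ord0 j + e / 2) z).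
    have sub : cbox (fun j => p k ord0 j - e / 2) (fun j => p k ord0 j + e / 2) `<=` Omega.
      move=> x xp; apply: (He z) => //; apply: rV_norm_le; first exact: ltW.
      move=> j; rewrite !mxE ler_norml; have /andP[? ?] := xp j; have /andP[? ?] := zp j.
      by apply/andP; split; lra.
    rewrite /F /Gi !patchM -2!Rintegral_mkcond.
    exact: weak_gradient_tensor i wG (sb k) (b0 k) sub.
  have Kp x : K x -> ~ cbox (fun j => p k ord0 j - e / 2) (fun j => p k ord0 j + e / 2) x.
    by move=> Kx xp; apply: noK; exists x.
  rewrite !int_ae0 ?oppr0//.
  - exact: intg_measurable (iGk k).
  - apply: filterS G0 => x Gx; rewrite /Gi patchE; case: ifPn; rewrite ?mul0r// inE => Ox.
    have [Kx|Kx] := pselect (K x); last by rewrite Gx// mul0r.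
    by rewrite (tensor_eq0 (b0 k)) ?mulr0//; exact: Kp.
  - exact: intg_measurable (iFk k).
  - apply: filterS v0 => x vx; rewrite /F patchE; case: ifPn; rewrite ?mul0r// inE => Ox.
    have [Kx|Kx] := pselect (K x); last by rewrite vx// mul0r.
    by rewrite (tensor_eq0 (tensor_derive_supp i (b0 k))) ?mulr0//; exact: Kp.
have sumT x : `|x| < M + 2 -> \sum_k tensor (b k) x = tensor a x.
  by move=> xM; under eq_bigr do rewrite tb; rewrite -mulr_sumr rh1 ?mulr1// ltW.
have sumD x : `|x| < M + 2 -> \sum_k tensor (tensor_derive (b k) i) x = tensor (tensor_derive a i) x.
  move=> xM; have h1 := is_derive_fsum (fun k => is_derive_smooth_tensor x i (sb k)).
  have h2 : is_derive x (e_ i) (tensor a) (\sum_k tensor (tensor_derive (b k) i) x).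
    apply: near_eq_is_derive h1 => /=.
    have nM : nbhs x [set y : 'rV[R]_n | `|y| < M + 2].
      by apply: (@norm_continuous _ _ x [set t | t < M + 2]); exact: lt_nbhsl.
    by apply: filterS nM => y yM; rewrite sumT.
  by rewrite -(@derive_val _ _ _ _ _ _ _ h2) (@derive_val _ _ _ _ _ _ _ (is_derive_smooth_tensor x i sa)).
rewrite (_ : (fun x => F x * _) = (fun x => \sum_k F x * tensor (tensor_derive (b k) i) x)); last first.
  apply/funext => x; rewrite -mulr_sumr /F patchE; case: ifPn => [|_]; last by rewrite !mul0r.
  by rewrite inE => /OM xM; rewrite sumD.
rewrite [in RHS](_ : (fun x => Gi x * _) = (fun x => \sum_k Gi x * tensor (b k) x)); last first.
  apply/funext => x; rewrite -mulr_sumr /Gi patchE; case: ifPn => [|_]; last by rewrite !mul0r.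
  by rewrite inE => /OM xM; rewrite sumT.
by rewrite (int_sum iFk) (int_sum iGk) -sumrN; apply: eq_bigr => k _; exact: term.
Qed.

Lemma rho_le Omega q f g : measurable Omega -> (forall x, Omega x -> 1 < q x) ->
  measurable_fun Omega q -> measurable_fun Omega f -> measurable_fun Omega g ->
  (forall x, `|f x| <= `|g x|) -> (rho Omega q f <= rho Omega q g)%E.
Proof.
move=> mO q1 mq mf mg fg.
have mP h : measurable_fun Omega h -> measurable_fun Omega (fun x => (`|h x| `^ q x / q x)%:E).
  move=> mh; apply/measurable_EFinP/measurable_funM; last exact: measurable_fun_invr.
  by apply: measurable_powR2 => //; exact: measurableT_comp.
have q0 x : Omega x -> 0 <= q x by move=> Ox; exact: le_trans ler01 (ltW (q1 _ Ox)).
apply: ge0_le_integral => //.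
- by move=> x Ox; rewrite lee_fin divr_ge0 ?powR_ge0 ?q0.
- exact: mP.
- exact: mP.
move=> x Ox; rewrite lee_fin ler_wpM2r ?invr_ge0 ?q0//.
by apply: ge0_ler_powR; rewrite ?nnegrE ?q0.
Qed.

Lemma rho_ge0 Omega q f : (forall x, Omega x -> 1 < q x) -> (0 <= rho Omega q f)%E.
Proof.
move=> q1; apply: integral_ge0 => x Ox; rewrite lee_fin divr_ge0 ?powR_ge0//.
by rewrite (le_trans ler01)// ltW// q1.
Qed.

(** Each component of a gradient is dominated by its Euclidean norm, and the gradient of the
    difference is almost everywhere the difference of the gradients, so [modular_small] applies to
    all components at once. *)
Lemma rho1_small Omega q (eps : R) : open Omega -> bounded_set Omega ->
  (forall x, Omega x -> 1 < q x) -> measurable_fun Omega q -> 0 < eps ->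
  exists2 eta : R, 0 < eta & forall f g, W1q Omega q f -> W1q Omega q g ->
    (rho1 Omega q (f \- g)%R < eta%:E)%E ->
    \int[mu]_x `|(f \_ Omega) x - (g \_ Omega) x| <= eps /\
    forall i, \int[mu]_x `|((fun x => wgrad Omega f x ord0 i) \_ Omega) x -
                ((fun x => wgrad Omega g x ord0 i) \_ Omega) x| <= eps.
Proof.
move=> oO bO q1 mq e0.
have mO := open_measurable_rV oO; have Ooo := bounded_lebesgue_lty mO bO.
have [eta eta0 Heta] := modular_small mO Ooo q1 mq e0.
exists eta => // f g [Lf wf Lwf] [Lg wg Lwg] small.
have patchB h k : (fun x => (h \_ Omega) x - (k \_ Omega) x) = (h \- k) \_ Omega.
  by apply/funext => x; rewrite !patchE; case: ifP => //; rewrite subr0.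
have ib h k : Lq Omega q h -> Lq Omega q k -> intg mu ((h \- k) \_ Omega).
  move=> Lh Lk; rewrite -patchB.
  exact: intgB (Lq_integrable mO Ooo q1 mq Lh) (Lq_integrable mO Ooo q1 mq Lk).
have [[mf _] [mg _]] := (Lf, Lg).
have wB := weak_gradientB oO (wgradP wf) (wgradP wg).
have wD := wgradP (ex_intro _ _ wB); have [_ lD _] := wD.
have mD i : measurable_fun Omega (fun x => wgrad Omega (f \- g)%R x ord0 i) by have [] := lD i.
have s1 : (rho Omega q (f \- g)%R < eta%:E)%E.
  by apply: le_lt_trans small; rewrite leeDl// rho_ge0.
have s2 i : (rho Omega q (fun x => wgrad Omega (f \- g)%R x ord0 i) < eta%:E)%E.
  apply: le_lt_trans small; apply: le_trans (_ : (rho_grad Omega q (f \- g)%R <= _)%E); last first.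
    by rewrite leeDr// rho_ge0.
  apply: rho_le => //; first exact: measurable_enorm.
  by move=> x; rewrite [leRHS]ger0_norm ?enorm_ge0// coord_le_enorm.
split.
  have -> : (fun x => `|(f \_ Omega) x - (g \_ Omega) x|) = (fun x => `|((f \- g) \_ Omega) x|).
    by apply/funext => x; rewrite -patchB.
  by apply: Heta s1 _; [exact: measurable_funB|exact: ib Lf Lg].
move=> i.
have aeD : {ae mu, forall x, Omega x -> wgrad Omega (f \- g)%R x = wgrad Omega f x - wgrad Omega g x}.
  by apply: weak_gradient_unique oO _ wD wB; exact: filterE.
set a := (fun x => wgrad Omega f x ord0 i); set b := (fun x => wgrad Omega g x ord0 i).
pose d x := wgrad Omega (f \- g)%R x ord0 i.
have mdT : measurable_fun setT (d \_ Omega) by apply: (measurable_restrictT d mO).1; exact: mD.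
have iab : intg mu ((a \- b) \_ Omega) := ib a b (Lwf i) (Lwg i).
have aed : {ae mu, forall x, ((a \- b) \_ Omega) x = (d \_ Omega) x}.
  apply: filterS aeD => x Hx; rewrite !patchE; case: ifP => //; rewrite inE => Ox.
  by rewrite /d Hx// !mxE.
have [idT _] := intg_ae mdT aed iab.
have -> : (fun x => `|(a \_ Omega) x - (b \_ Omega) x|) = (fun x => `|((a \- b) \_ Omega) x|).
  by apply/funext => x; rewrite -patchB.
have aed' : {ae mu, forall x, `|((a \- b) \_ Omega) x| = `|(d \_ Omega) x|}.
  by apply: filterS aed => x ->.
rewrite (intg_ae _ aed' (intg_norm iab)).2; last exact: measurableT_comp.
exact: Heta (s2 i) idT.
Qed.

Lemma zext_weak_U1q0 Omega q f : open Omega -> bounded_set Omega ->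
  (forall x, Omega x -> 1 < q x) -> measurable_fun Omega q -> U1q0 Omega q f ->
  W1q Omega q f /\ zext_weak Omega f.
Proof.
move=> oO bO q1 mq; have mO := open_measurable_rV oO; have Ooo := bounded_lebesgue_lty mO bO.
(* The closure is the smallest closed set containing the compactly supported functions; the first
   conjunct is kept because a closed set must lie in [W1q]. *)
suff H : rho1_closed Omega q [set f | W1q Omega q f /\ zext_weak Omega f].
  apply: (smallest_sub H) => v Cv; split; first by case: Cv.
  exact: zext_weak_comp Cv.
split; first by move=> g [].
move=> f_ g Zf Wg cvg; split=> // i x0 r a sa a0.
have suppa := nball_suppE a0.
have sD := smooth_tensor_derive i sa.
have [M1 M10 HM1] := cbox_tensor_bounded sa suppa.
have [M2 M20 HM2] := cbox_tensor_bounded sD (tensor_derive_supp i suppa).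
have zint h : W1q Omega q h -> intg mu (h \_ Omega) /\ intg mu ((fun x => wgrad Omega h x ord0 i) \_ Omega).
  by move=> [Lh _ Lwh]; split; [exact: (Lq_integrable mO Ooo q1 mq Lh)|exact: (Lq_integrable mO Ooo q1 mq (Lwh i))].
have [iF iG] := zint g Wg.
set F := g \_ Omega in iF *; set G := _ \_ Omega in iG *.
have iFD := intg_tensor iF sD (tensor_derive_supp i suppa).
have iGa := intg_tensor iG sa suppa.
apply/eqP; rewrite -addr_eq0 -normr_le0; apply/ler_addgt0Pr => e e0; rewrite add0r.
pose e' := e / (M2 + M1 + 1).
have Mp : 0 < M2 + M1 + 1 by rewrite ltr_wpDl// addr_ge0.
have e'0 : 0 < e' by rewrite divr_gt0.
have [eta eta0 Heta] := rho1_small oO bO q1 mq e'0.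
(* A single close enough term of the sequence suffices: both sides of the weak identity are
   continuous in L^1 for a fixed bounded test function. *)
have [k Hk] : exists k, (rho1 Omega q (f_ k \- g)%R < eta%:E)%E.
  have nb : nbhs (0 : \bar R) [set t | (t < eta%:E)%E] by exact: (@nbhs_open_ereal_lt R 0 (cst eta)).
  by have [k _ H] := cvg _ nb; exists k; apply: H => /=.
have [Wk Zk] := Zf k; have [dF /(_ i) dG] := Heta _ _ Wk Wg Hk.
have [iFk iGk] := zint _ Wk.
have := Zk i x0 r a sa a0.
set Fk := f_ k \_ Omega in dF iFk *; set Gk := _ \_ Omega in dG iGk *.
move=> EZ.
have iFkD := intg_tensor iFk sD (tensor_derive_supp i suppa).
have iGka := intg_tensor iGk sa suppa.
have E1 : `|\int[mu]_x (Fk x * tensor (tensor_derive a i) x) - \int[mu]_x (F x * tensor (tensor_derive a i) x)| <= M2 * e'.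
  rewrite -(intB iFkD iFD); apply: le_trans (ler_wpM2l M20 dF).
  rewrite -(intZ M2 (intg_norm (intgB iFk iF))).
  apply: (int_norm_le (intgB iFkD iFD) (intgZ M2 (intg_norm (intgB iFk iF)))) => x.
  by rewrite -mulrBl normrM mulrC ler_wpM2r.
have E2 : `|\int[mu]_x (Gk x * tensor a x) - \int[mu]_x (G x * tensor a x)| <= M1 * e'.
  rewrite -(intB iGka iGa); apply: le_trans (ler_wpM2l M10 dG).
  rewrite -(intZ M1 (intg_norm (intgB iGk iG))).
  apply: (int_norm_le (intgB iGka iGa) (intgZ M1 (intg_norm (intgB iGk iG)))) => x.
  by rewrite -mulrBl normrM mulrC ler_wpM2r.
have E3 : (M2 + M1) * e' <= e.
  by rewrite /e' mulrCA ler_piMr ?(ltW e0)// ler_pdivrMr// mul1r lerDl.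
move: EZ E1 E2 E3; clear.
move: (\int[mu]_x _) (\int[mu]_x _) (\int[mu]_x _) (\int[mu]_x _) => A B C D -> /ler_normlP[h1 h2] /ler_normlP[h3 h4] h5.
by apply/ler_normlP; split; lra.
Qed.

End zero_extension_weak.

(** * Boundary values *)

Section local_lipschitz.
Context {R : realType} {n : nat}.
Implicit Types (g : 'rV[R]_n -> R) (x y : 'rV[R]_n).
Local Notation e_ i := (delta_mx ord0 i : 'rV[R]_n).

Lemma coord_increment_le g dg i x (d B r : R) (x0 : 'rV[R]_n) :
  (forall y, is_derive y (e_ i) g (dg y)) -> (forall y, `|y - x0| <= r -> `|dg y| <= B) ->
  `|x - x0| <= r -> `|x + d *: e_ i - x0| <= r -> `|g (x + d *: e_ i) - g x| <= B * `|d|.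
Proof.
move=> Hg HB xr xdr.
have seg t y : 0 <= t <= `|d| -> `|y - x0| <= r -> `|y + `|d| *: e_ i - x0| <= r -> `|t *: e_ i + y - x0| <= r.
  move=> /andP[t0 td] yr ydr; have r0 := le_trans (normr_ge0 _) yr.
  apply: rV_norm_le => // j; have h1 := le_trans (coord_le_norm _ j) yr.
  have h2 := le_trans (coord_le_norm _ j) ydr; move: h1 h2; rewrite !mxE.
  have : 0 <= ((ord0 == ord0 :> 'I_1) && (j == i))%:R :> R by exact: ler0n.
  move: (_%:R : R) => k k0.
  have p1 := mulr_ge0 t0 k0; have p2 := ler_wpM2r k0 td.
  rewrite !ler_norml => /andP[h1 h2] /andP[h3 h4]; clear -p1 p2 h1 h2 h3 h4.
  by apply/andP; split; lra.
have pos y : 0 < `|d| -> `|y - x0| <= r -> `|y + `|d| *: e_ i - x0| <= r -> `|g (`|d| *: e_ i + y) - g y| <= B * `|d|.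
  move=> d0 yr ydr; have [t tt ->] := MVT_dir (df := dg) d0 (fun t _ => Hg (t *: e_ i + y)).
  by rewrite normrM normr_id mulrC ler_wpM2r// HB// seg.
have [d0|d0|d0] := ltgtP d 0.
- have dn : 0 < `|d| by rewrite normr_gt0 lt_eqF.
  have E : x + d *: e_ i + `|d| *: e_ i = x by rewrite -addrA -scalerDl ltr0_norm// subrr scale0r addr0.
  have := pos (x + d *: e_ i) dn xdr; rewrite E => /(_ xr).
  by rewrite [`|d| *: _ + _]addrC E distrC.
- have dn : 0 < `|d| by rewrite normr_gt0 gt_eqF.
  have := pos x dn xr; rewrite gtr0_norm// => /(_ xdr); by rewrite [d *: _ + _]addrC.
- by rewrite d0 scale0r addr0 subrr normr0 mulr0.
Qed.

(** Points that mix coordinates of x0 and y stay in the sup-norm ball, so n one-coordinate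
    increments suffice and the constant is n B. *)
Lemma locally_lipschitz g (x0 : 'rV[R]_n) : Ck 1 setT g ->
  exists2 L : R, 0 <= L & forall y, `|y - x0| <= 1 -> `|g y - g x0| <= L * `|y - x0|.
Proof.
move=> g1.
have cdg i : continuous (partial i g) by move=> y; exact: (g1 [:: i] y I).1.
have Hg i y : is_derive y (e_ i) g (partial i g y) by apply/derivableP; exact: (g1 [::] y I).2.
pose S y := \sum_i `|partial i g y|.
have [B B0 HB] : exists2 B : R, 0 <= B & forall i y, `|y - x0| <= 1 -> `|partial i g y| <= B.
  have cS : continuous S.
    by move=> y; apply: continuous_fsum => i; apply: continuous_comp; [exact: cdg|exact: norm_continuous].
  have [B B0 H] := compact_bounded_fun (@compact_nball _ _ x0 1) (continuous_subspaceT cS).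
  exists B => // i y /H; apply: le_trans.
  by rewrite [leRHS]ger0_norm ?sumr_ge0// /S (bigD1 i)//= lerDl sumr_ge0.
exists (n%:R * B) => [|y y1]; first by rewrite mulr_ge0.
(* x0 is joined to y by changing one coordinate at a time. *)
pose mix (s : seq 'I_n) : 'rV[R]_n := \row_j (if j \in s then y ord0 j else x0 ord0 j).
have mixB s : `|mix s - x0| <= `|y - x0|.
  apply: rV_norm_le => // j; have := coord_le_norm (y - x0) j; rewrite !mxE.
  by case: ifP => // _; rewrite subrr normr0.
have step1 s : `|g (mix s) - g x0| <= (size s)%:R * (B * `|y - x0|).
  elim: s => [|k s IH].
    by rewrite (_ : mix [::] = x0) ?subrr ?normr0 ?mul0r//; apply/rowP => j; rewrite mxE.
  have [ks|ks] := boolP (k \in s).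
    rewrite (_ : mix (k :: s) = mix s); last first.
      by apply/rowP => j; rewrite !mxE in_cons; have [->|] := eqVneq j k; rewrite ?ks.
    by apply: le_trans IH _; rewrite ler_wpM2r ?mulr_ge0// ler_nat.
  have E : mix (k :: s) = mix s + (y ord0 k - x0 ord0 k) *: e_ k.
    apply/rowP => j; rewrite !mxE in_cons eqxx /=; have [->|jk] := eqVneq j k.
      by rewrite (negbTE ks) /= mulr1 addrC subrK.
    by rewrite /= mulr0 addr0.
  rewrite -(subrK (g (mix s)) (g (mix (k :: s)))) -addrA (le_trans (ler_normD _ _))//.
  rewrite -natr1 mulrDl mul1r [leRHS]addrC lerD//.
  have h1 : `|mix s - x0| <= 1 by exact: le_trans (mixB s) y1.
  have h2 : `|mix (k :: s) - x0| <= 1 by exact: le_trans (mixB _) y1.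
  rewrite E in h2 *; apply: le_trans (coord_increment_le (Hg k) (HB k) h1 h2) _.
  by rewrite ler_wpM2l//; have := coord_le_norm (y - x0) k; rewrite !mxE.
have := step1 (enum 'I_n); rewrite size_enum_ord mulrA (_ : mix _ = y)//.
by apply/rowP => j; rewrite mxE mem_enum.
Qed.

End local_lipschitz.

(** * A bump with two separate slopes *)

Section flat_bump.
Context {R : realType}.
Local Notation s := (@step R).

Lemma derive1_step_eq0 (t : R) : ~~ (0 <= t <= 1) -> derive1 s t = 0.
Proof.
rewrite negb_and -!ltNge => t01.
suff [_ <-] : is_derive t (1 : R) s 0 by rewrite derive1E.
have [t0|t0] := ltP t 0.
  apply: (@near_eq_is_derive _ _ _ (fun=> 0)).
  by near=> u; rewrite step_le0//; apply: ltW; near: u; exact: lt_nbhsl.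
apply: (@near_eq_is_derive R R R (fun=> (1 : R))).
move: t01; rewrite ltNge t0 /= => t1.
by near=> u; rewrite step_ge1//; apply: ltW; near: u; exact: lt_nbhsr.
Unshelve. all: by end_near.
Qed.

(** As [step] rises from 0 to 1 over a unit interval, its derivative equals 1 somewhere inside and
    exceeds 1/2 nearby. *)
Lemma derive1_step_gt : exists al be : R, [/\ 0 < al, al < be, be < 1 &
  forall t, al < t < be -> 2^-1 < derive1 s t].
Proof.
have [c] := MVT ltr01 (fun z _ => smooth_is_derive z (@smooth_step R))
  (continuous_subspaceT (smooth_continuous (@smooth_step R))).
rewrite in_itv /= => /andP[c0 c1]; rewrite step_ge1// step_le0// !subr0 mulr1 => c'.
have cs : {for c, continuous (derive1 s)} by apply: smooth_continuous; exact: smooth_derive1 smooth_step.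
have : \forall t \near c, [/\ 2^-1 < derive1 s t, 0 < t & t < 1].
  have N1 : \forall t \near c, 2^-1 < derive1 s t.
    have h : derive1 s t @[t --> c] --> derive1 s c by exact: cs.
    by apply: (h [set t | 2^-1 < t]); apply: lt_nbhsr; rewrite -c' invf_lt1// ltr1n.
  have N2 : \forall t \near c, 0 < t by exact: lt_nbhsr.
  have N3 : \forall t \near c, t < 1 by exact: lt_nbhsl.
  by apply: filterS3 N1 N2 N3 => t ? ? ?; split.
move=> [d /= d0 Hd]; exists (c - d / 2), (c + d / 2).
have ball t : `|t - c| < d -> [/\ 2^-1 < derive1 s t, 0 < t & t < 1] by move=> h; apply: Hd; rewrite /= distrC.
have [_ h1 _] : [/\ 2^-1 < derive1 s (c - d / 2), 0 < c - d / 2 & c - d / 2 < 1].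
  by apply: ball; rewrite addrC addKr normrN gtr0_norm ?divr_gt0//; lra.
have [_ _ h2] : [/\ 2^-1 < derive1 s (c + d / 2), 0 < c + d / 2 & c + d / 2 < 1].
  by apply: ball; rewrite addrC addKr gtr0_norm ?divr_gt0//; lra.
split => //; first by lra.
by move=> t /andP[t1 t2]; have [] : [/\ 2^-1 < derive1 s t, 0 < t & t < 1] by apply: ball; rewrite ltr_norml; apply/andP; split; lra.
Qed.

(** Increasing on [-2, -1], constant on [-1, 1], decreasing on [1, 2]. The flat middle separates the
    slopes, so that only one of them meets the domain at a boundary point. *)
Definition flat_bump (t : R) : R := s (t + 2) - s (t - 1).

Lemma flat_bump_eq1 t : `|t| <= 1 -> flat_bump t = 1.
Proof. by rewrite ler_norml => /andP[? ?]; rewrite /flat_bump step_ge1 ?step_le0 ?subr0//; lra. Qed.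

Lemma flat_bump_eq0 t : 2 < `|t| -> flat_bump t = 0.
Proof.
rewrite /flat_bump lter_normr => /orP[?|?]; first by rewrite !step_ge1 ?subrr//; lra.
by rewrite !step_le0 ?subrr//; lra.
Qed.

Lemma flat_bump_ge0 t : 0 <= flat_bump t.
Proof. by rewrite subr_ge0 step_ndecr//; lra. Qed.

Lemma flat_bump_le1 t : flat_bump t <= 1.
Proof. by rewrite /flat_bump; have := step_le1 (t + 2); have := step_ge0 (t - 1); lra. Qed.

Lemma is_derive_flat_bump t : is_derive t (1 : R) flat_bump (derive1 s (t + 2) - derive1 s (t - 1)).
Proof.
have h (c : R) : is_derive t (1 : R) (fun t => s (t + c)) (derive1 s (t + c)).
  have h := is_derive_comp_affine (c := 1) (d := c) (x := t) (smooth_is_derive (1 * t + c) (@smooth_step R)).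
  rewrite (_ : (fun t => s (t + c)) = (fun t => s (1 * t + c))); last by apply/funext => u; rewrite mul1r.
  by apply: is_derive_eq h _; rewrite !mul1r.
exact: is_deriveB (h 2) (h (-1)).
Qed.

Lemma smooth_flat_bump : smooth flat_bump.
Proof.
have h (c : R) : smooth (fun t => s (t + c)).
  rewrite (_ : (fun t => s (t + c)) = (fun t => s (1 * t + c))); last by apply/funext => u; rewrite mul1r.
  exact: smooth_comp_affine smooth_step.
exact: smoothB (h 2) (h (-1)).
Qed.

End flat_bump.

(** If t > K then t^(p-1) >= K^(p-1), so that t <= K^(1-p) t^p. *)
Lemma le_powR_split (R : realType) (t K p : R) : 0 <= t -> 0 < K -> 1 < p -> t <= K + K `^ (1 - p) * t `^ p.
Proof.
move=> t0 K0 p1; have [tK|Kt] := leP t K.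
  by rewrite ler_wpDr// mulr_ge0// powR_ge0.
rewrite ler_wpDl ?(ltW K0)// -(opprB p 1) powRN mulrC ler_pdivlMr ?powR_gt0//.
rewrite -[leRHS](mulr_powRB1 t0) ?(lt_trans _ p1)// ler_wpM2l//.
by apply: ge0_ler_powR; rewrite ?nnegrE ?subr_ge0 ?(ltW p1) ?(ltW K0)// ltW.
Qed.

(** Locates the slope facing the domain: T lies in (-2, -1) when the domain is below the graph, in
    (1, 2) when it is above. *)
Lemma bump_interval (R : realType) (b : bool) (al be T : R) : 0 < al -> be < 1 ->
  al < T + (if b then 2 else -1) < be -> `|T| <= 2 /\ (if b then T < -1 else 1 < T).
Proof.
move=> al0 be1; by case: b => /andP[h1 h2]; rewrite ler_norml; (split; first by apply/andP; split; lra); lra.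
Qed.

(** * Testing with a bump at a boundary point *)

Section boundary_test.
Context {R : realType} {n : nat}.
Local Notation mu := (@lebesgue_rV R n).
Local Notation s := (@step R).
Implicit Types (x : 'rV[R]_n) (j : 'I_n).
Variables (x0 : 'rV[R]_n) (i : 'I_n) (b : bool) (L h : R).
Hypotheses (L1 : 1 <= L) (h0 : 0 < h).

Let tau j : R := if j == i then L * h else h.

Let L0 : 0 < L. Proof. exact: lt_le_trans ltr01 L1. Qed.

Let tau0 j : 0 < tau j.
Proof. by rewrite /tau; case: ifP => // _; exact: mulr_gt0. Qed.

Let tauL j : tau j <= L * h.
Proof. by rewrite /tau; case: ifP => // _; rewrite ler_peMl// ltW. Qed.

(* The width L h across the graph bounding the domain exceeds its oscillation over
   a ball of radius 2 h. *)
Definition bdry_test j (t : R) : R := flat_bump ((tau j)^-1 * t + - ((tau j)^-1 * x0 ord0 j)).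

Let scaled j (t : R) : (tau j)^-1 * t + - ((tau j)^-1 * x0 ord0 j) = (t - x0 ord0 j) / tau j.
Proof. by rewrite -mulrBr mulrC. Qed.

Lemma smooth_bdry_test j : smooth (bdry_test j).
Proof. exact: smooth_comp_affine smooth_flat_bump. Qed.

Let norm_scaled j (t : R) : `|(t - x0 ord0 j) / tau j| = `|t - x0 ord0 j| / tau j.
Proof. by rewrite normrM normfV [`|tau j|]gtr0_norm. Qed.

Let bdry_test_eq0' j (t : R) : 2 * tau j < `|t - x0 ord0 j| -> bdry_test j t = 0.
Proof. by move=> ht; rewrite /bdry_test scaled flat_bump_eq0// norm_scaled ltr_pdivlMr. Qed.

Lemma bdry_test_eq0 j (t : R) : 2 * (L * h) < `|t - x0 ord0 j| -> bdry_test j t = 0.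
Proof. by move=> ht; apply: bdry_test_eq0'; apply: le_lt_trans ht; rewrite ler_pM2l. Qed.

Let bdry_test_eq1 j (t : R) : `|t - x0 ord0 j| <= tau j -> bdry_test j t = 1.
Proof. by move=> ht; rewrite /bdry_test scaled flat_bump_eq1// norm_scaled ler_pdivrMr// mul1r. Qed.

Let T x : R := (x ord0 i - x0 ord0 i) / (L * h).
Let P x : R := \prod_(j < n | j != i) bdry_test j (x ord0 j).
(** The size of the slope facing the domain; [sigma] is its sign, rising below the graph and falling
    above it. *)
Let psi x : R := (L * h)^-1 * derive1 s (T x + (if b then 2 else -1)) * P x.
Let sigma : R := if b then 1 else -1.

Let tau_i : tau i = L * h. Proof. by rewrite /tau eqxx. Qed.

Let P_ge0 x : 0 <= P x.
Proof. by apply: prodr_ge0 => j _; exact: flat_bump_ge0. Qed.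

Let psi_ge0 x : 0 <= psi x.
Proof.
apply: mulr_ge0 => //; apply: mulr_ge0; last exact: derive1_step_ge0.
by rewrite invr_ge0 ltW// mulr_gt0.
Qed.

Let tensor_derive_testE x : tensor (tensor_derive bdry_test i) x =
  (L * h)^-1 * (derive1 s (T x + 2) - derive1 s (T x - 1)) * P x.
Proof.
rewrite /tensor (bigD1 i)//=; congr (_ * _); last first.
  by apply: eq_bigr => j /negbTE ji; rewrite /tensor_derive ji.
rewrite /tensor_derive eqxx.
have h1 t : is_derive t (1 : R) (bdry_test i)
    ((tau i)^-1 * (derive1 s ((t - x0 ord0 i) / tau i + 2) - derive1 s ((t - x0 ord0 i) / tau i - 1))).
  have := is_derive_comp_affine (c := (tau i)^-1) (d := - ((tau i)^-1 * x0 ord0 i)) (x := t) (is_derive_flat_bump _).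
  by rewrite scaled.
by rewrite (is_derive_derive1 h1) tau_i.
Qed.

(** Over the support, [Om] stays on its own side of x0_i + L h or x0_i - L h, while the other slope
    begins only there; its derivative is therefore 0 on [Om]. *)
Let sidedness (Om : set 'rV[R]_n) x :
  (Om x -> (forall j, j != i -> `|x ord0 j - x0 ord0 j| <= 2 * h) ->
    if b then x ord0 i < x0 ord0 i + L * h else x0 ord0 i - L * h < x ord0 i) ->
  Om x -> tensor (tensor_derive bdry_test i) x = sigma * psi x.
Proof.
move=> H Ox; rewrite tensor_derive_testE /psi.
have [->|Pn] := eqVneq (P x) 0; first by rewrite !mulr0.
have xj j : j != i -> `|x ord0 j - x0 ord0 j| <= 2 * h.
  move=> ji; rewrite leNgt; apply: contra_neqN Pn => xh.
  by rewrite /P (bigD1 j)//= bdry_test_eq0' ?mul0r// /tau (negbTE ji).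
have Lh0 : 0 < L * h by exact: mulr_gt0.
have := H Ox xj; rewrite /sigma; case: b => xi.
  have T1 : T x < 1 by rewrite /T ltr_pdivrMr// mul1r; lra.
  rewrite [X in _ - X]derive1_step_eq0 ?subr0 ?mul1r//.
  by rewrite negb_and -!ltNge; apply/orP; left; lra.
have T1 : -1 < T x by rewrite /T ltr_pdivlMr// mulN1r; lra.
rewrite [X in X - _]derive1_step_eq0 ?sub0r; last first.
  by rewrite negb_and -!ltNge; apply/orP; right; lra.
by rewrite mulrN mulNr mulN1r.
Qed.

Let tensor_test_ge0 x : 0 <= tensor bdry_test x.
Proof. by apply: prodr_ge0 => j _; exact: flat_bump_ge0. Qed.

Let tensor_test_le1 x : tensor bdry_test x <= 1.
Proof. by apply: prodr_ile1 => j _; rewrite flat_bump_ge0 flat_bump_le1. Qed.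

(** Both sides estimate one weak identity. On [Bl], of volume L h (be - al) (2h)^(n-1), the slope is
    at least 1/(2 L h) and |F| at least |c| / 2, which gives the left side. The right side bounds
    the integral of [G] over the support, with K left free for the final scaling. *)
Lemma boundary_test_ineq (Om : set 'rV[R]_n) (F G : 'rV[R]_n -> R) (c al be p K : R) :
  0 < al -> al < be -> be < 1 -> (forall t, al < t < be -> 2^-1 < derive1 s t) ->
  (forall x, `|x - x0| <= 2 * (L * h) -> Om x -> (forall j, j != i -> `|x ord0 j - x0 ord0 j| <= 2 * h) ->
    if b then x ord0 i < x0 ord0 i + L * h else x0 ord0 i - L * h < x ord0 i) ->
  (forall x, `|x - x0| <= 2 * (L * h) -> (forall j, j != i -> `|x ord0 j - x0 ord0 j| <= 2 * h) ->
    (if b then x ord0 i < x0 ord0 i - L * h else x0 ord0 i + L * h < x ord0 i) -> Om x) ->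
  (forall x, ~ Om x -> F x = 0) ->
  {ae mu, forall x, Om x -> `|x - x0| <= 2 * (L * h) -> `|c| / 2 <= Num.sg c * F x} ->
  ball_weak x0 (2 * (L * h)) i F G -> intg mu F -> intg mu G -> intg mu (fun x => `|G x| `^ p) ->
  0 < K -> 1 < p ->
  `|c| * (be - al) / 4 * (2 * h) ^+ n.-1 <=
    K * (6 * (L * h)) ^+ n + K `^ (1 - p) * \int[mu]_x (`|G x| `^ p).
Proof.
move=> al0 albe be1 Hs H1 H2 F0 HF wFG iF iG iGp K0 p1.
have Lh0 : 0 < L * h by exact: mulr_gt0.
set r := 2 * (L * h) in H1 H2 HF wFG *.
have r0 : 0 < r by rewrite mulr_gt0.
have W := wFG bdry_test smooth_bdry_test bdry_test_eq0.
have supp := nball_suppE bdry_test_eq0.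
have sD := smooth_tensor_derive i smooth_bdry_test.
have iFD := intg_tensor iF sD (tensor_derive_supp i supp).
have iGt := intg_tensor iG smooth_bdry_test supp.
have D0 x : r < `|x - x0| -> tensor (tensor_derive bdry_test i) x = 0.
  move=> xr; apply: (tensor_eq0 (tensor_derive_supp i supp)) => xB.
  by move: xr; rewrite ltNge => /negP; apply; have : nball x0 r x by rewrite nballE// ltW.
(* |G| <= K + K^(1-p) |G|^p replaces Hoelder's inequality. *)
pose B6 := box (fun j => x0 ord0 j - 3 * (L * h)) (fun j => x0 ord0 j + 3 * (L * h)).
have mB6 : measurable B6 by exact: measurable_box.
have B6E : mu B6 = ((6 * (L * h)) ^+ n)%:E.
  rewrite lebesgue_box; congr (_%:E).
  rewrite (eq_bigr (fun=> 6 * (L * h))) ?prodr_const ?card_ord// => j _.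
  by rewrite max_r; lra.
have B6oo : (mu B6 < +oo)%E by rewrite B6E ltry.
have i6 := intg_indic mB6 B6oo.
have int6 : \int[mu]_x (\1_B6 x : R) = (6 * (L * h)) ^+ n.
  transitivity (fine (mu B6)); last by rewrite B6E.
  by rewrite /Rintegral integral_indic// setIT.
have UB : `|\int[mu]_x (G x * tensor bdry_test x)| <= K * (6 * (L * h)) ^+ n + K `^ (1 - p) * \int[mu]_x (`|G x| `^ p).
  rewrite -int6 -(intZ K i6) -(intZ _ iGp) -(intD (intgZ K i6) (intgZ _ iGp)).
  apply: (int_norm_le iGt (intgD (intgZ K i6) (intgZ _ iGp))) => x.
  have [xB|xB] := pselect (B6 x).
    rewrite indicE mem_set// mulr1; apply: le_trans (le_powR_split (normr_ge0 _) K0 p1).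
    by rewrite normrM ler_piMr// ger0_norm.
  have xr : r < `|x - x0|.
    rewrite ltNge; apply/negP => xr; apply: xB => j; have := le_trans (coord_le_norm _ j) xr.
    by rewrite !mxE ler_norml /r => /andP[h1 h2]; apply/andP; split; lra.
  rewrite (tensor_supp0 (ltW r0) bdry_test_eq0 xr) mulr0 normr0 indicE memNset// mulr0 add0r.
  by rewrite mulr_ge0// powR_ge0.
have {UB} UB : `|\int[mu]_x (F x * tensor (tensor_derive bdry_test i) x)| <=
    K * (6 * (L * h)) ^+ n + K `^ (1 - p) * \int[mu]_x (`|G x| `^ p) by rewrite W normrN.
apply: le_trans UB.
(* Only one slope of the test function meets Om, and there F keeps the sign of c;
   Bl is a box on which that slope is steep. *)
pose sh : R := if b then 2 else -1.
pose Bl := box (fun j => x0 ord0 j + (if j == i then L * h * (al - sh) else - h))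
               (fun j => x0 ord0 j + (if j == i then L * h * (be - sh) else h)).
have mBl : measurable Bl by exact: measurable_box.
have BlE : mu Bl = (L * h * (be - al) * (2 * h) ^+ n.-1)%:E.
  rewrite lebesgue_box; congr (_%:E); rewrite (bigD1 i)//= eqxx; congr (_ * _).
    rewrite max_r; first by ring.
    by rewrite subr_ge0 lerD2l ler_pM2l// lerD2r ltW.
  rewrite (eq_bigr (fun=> 2 * h)) => [|j /negbTE ji]; last first.
    by rewrite /= ji (_ : _ - (_ - h) = 2 * h); [rewrite max_r// mulr_ge0// ltW|ring].
  by rewrite prodr_const (_ : #|_| = n.-1)// cardC1 card_ord.
have Bloo : (mu Bl < +oo)%E by rewrite BlE ltry.
have il := intg_indic mBl Bloo.
have intl : \int[mu]_x (\1_Bl x : R) = L * h * (be - al) * (2 * h) ^+ n.-1.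
  transitivity (fine (mu Bl)); last by rewrite BlE.
  by rewrite /Rintegral integral_indic// setIT.
(* The least size |c| / 2 of [F] times the least slope 1/(2 L h) on [Bl]. *)
pose kk := `|c| / 2 * ((L * h)^-1 * 2^-1).
have kkE : `|c| * (be - al) / 4 * (2 * h) ^+ n.-1 = kk * \int[mu]_x (\1_Bl x : R).
  by rewrite intl /kk; field; rewrite !gt_eqF.
rewrite kkE -(intZ kk il).
have sg1 : `|Num.sg c * sigma| <= 1.
  rewrite normrM normr_sg /sigma; case: b; rewrite ?normrN normr1 mulr1; by case: (c == 0).
apply: (@le_trans _ _ (Num.sg c * sigma * \int[mu]_x (F x * tensor (tensor_derive bdry_test i) x))); last first.
  by apply: le_trans (ler_norm _) _; rewrite normrM ler_piMl.
rewrite -(intZ _ iFD); apply: (int_le_ae (intgZ kk il) (intgZ _ iFD)).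
have BlT x : Bl x -> al < T x + sh < be.
  move=> /(_ i); rewrite eqxx => /andP[h1 h2]; rewrite /T -ltrBlDr ltr_pdivlMr// -ltrBrDr ltr_pdivrMr//.
  by apply/andP; split; lra.
have Blj x j : Bl x -> j != i -> `|x ord0 j - x0 ord0 j| <= h.
  move=> /(_ j) + /negbTE ji; rewrite ji => /andP[h1 h2].
  by rewrite ler_norml; apply/andP; split; lra.
have Bli x : Bl x -> `|x ord0 i - x0 ord0 i| <= r /\
    (if b then x ord0 i < x0 ord0 i - L * h else x0 ord0 i + L * h < x ord0 i).
  move=> /BlT /(bump_interval al0 be1)[T2 Tb].
  have -> : x ord0 i = x0 ord0 i + L * h * T x by rewrite /T; field; rewrite !gt_eqF.
  rewrite [X in `|X| <= _]addrC addKr normrM gtr0_norm// /r mulrC ler_pM2r//; split => //.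
  move: Tb; case: (b) => Tb; rewrite ltrD2l.
    by rewrite -[ltRHS]mulrN1 ltr_pM2l.
  by rewrite -[ltLHS]mulr1 ltr_pM2l.
have Blr x : Bl x -> `|x - x0| <= r.
  move=> xB; apply: rV_norm_le => [|j]; first exact: ltW.
  rewrite !mxE; have [->|ji] := eqVneq j i; first by have [] := Bli x xB.
  apply: le_trans (Blj x j xB ji) _; rewrite /r.
  by have := ler_peMl (ltW h0) L1; lra.
have BlO x : Bl x -> Om x.
  move=> xB; apply: H2; [exact: Blr| |by have [] := Bli x xB].
  by move=> j ji; apply: le_trans (Blj x j xB ji) _; rewrite ler_peMl ?ler1n// ltW.
apply: filterS HF => x HFx.
have [Ox|Ox] := pselect (Om x); last first.
  rewrite F0// mul0r mulr0 indicE memNset ?mulr0//; by move/BlO.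
have [xr|xr] := leP `|x - x0| r; last first.
  rewrite D0// mulr0 mulr0 indicE memNset ?mulr0//; move/Blr; by rewrite leNgt xr.
have -> : tensor (tensor_derive bdry_test i) x = sigma * psi x.
  by apply: (@sidedness Om) => // _; exact: H1.
have -> : Num.sg c * sigma * (F x * (sigma * psi x)) = Num.sg c * F x * psi x.
  rewrite (_ : _ * (F x * _) = sigma ^+ 2 * (Num.sg c * F x * psi x)); last by ring.
  by rewrite /sigma; case: b; rewrite ?sqrrN expr1n mul1r.
apply: le_trans (ler_wpM2r (psi_ge0 x) (HFx Ox xr)).
rewrite /kk -[leLHS]mulrA (ler_wpM2l (divr_ge0 (normr_ge0 c) (ler0n R 2)))// indicE.
have [xB|_] := boolP (x \in Bl); last by rewrite mulr0.
rewrite inE in xB; rewrite mulr1 /psi (_ : P x = 1); last first.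
  apply: big1 => j ji; apply: bdry_test_eq1; rewrite /tau (negbTE ji); exact: Blj.
rewrite mulr1 ler_wpM2l ?invr_ge0 ?(ltW Lh0)//; apply: ltW; apply: Hs.
exact: BlT.
Qed.

End boundary_test.

(** * Vanishing of boundary values *)

Section boundary_values.
Context {R : realType} {n : nat}.
Local Notation mu := (@lebesgue_rV R n).
Implicit Types (x y : 'rV[R]_n) (Omega : set 'rV[R]_n) (f z q : 'rV[R]_n -> R).

(** With K = e / h and e = D / (2C), the first term is half of D h^(m-1). The second is e^(1-p) I
    h^(p-m) times h^(m-1), and p > m makes its coefficient smaller than D / 2 for small h. *)
Lemma scaling_choice (D C I p h0 : R) (m : nat) : 0 < D -> 0 < C -> 0 <= I -> (0 < m)%N -> m%:R < p -> 0 < h0 ->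
  exists h K : R, [/\ 0 < h, h < h0, 0 < K & K * (C * h ^+ m) + K `^ (1 - p) * I < D * h ^+ m.-1].
Proof.
move=> D0 C0 I0 m0 mp hh0; pose e := D / (2 * C).
have e0 : 0 < e by rewrite divr_gt0// mulr_gt0.
have pm : 0 < p - m%:R by rewrite subr_gt0.
pose eta := D / 2 / (e `^ (1 - p) * I + 1).
have den0 : 0 < e `^ (1 - p) * I + 1 by rewrite ltr_wpDl// mulr_ge0// powR_ge0.
have eta0 : 0 < eta by rewrite !divr_gt0.
have N1 : \forall h \near (0 : R)^'+, h `^ (p - m%:R) < eta.
  have hc : h `^ (p - m%:R) @[h --> (0 : R)^'+] --> (0 : R) by exact: powR_cvg0.
  by apply: (hc [set t | t < eta]); exact: lt_nbhsl.
have N2 : \forall h \near (0 : R)^'+, h < h0 by exact: nbhs_right_lt.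
have N3 : \forall h \near (0 : R)^'+, 0 < h by exact: nbhs_right_gt.
have N : \forall h \near (0 : R)^'+, [/\ h `^ (p - m%:R) < eta, h < h0 & 0 < h].
  by apply: filterS3 N1 N2 N3 => h ? ? ?; split.
have [h [hp hh0' hgt]] : exists h, [/\ h `^ (p - m%:R) < eta, h < h0 & 0 < h].
  exact: (@filter_ex _ _ (at_right_proper_filter (0 : R)) _ N).
exists h, (e / h); split => //; first exact: divr_gt0.
have -> : h ^+ m = h * h ^+ m.-1 by rewrite -exprS prednK.
have hm0 : 0 < h ^+ m.-1 by exact: exprn_gt0.
have -> : (e / h) `^ (1 - p) = e `^ (1 - p) * (h `^ (p - m%:R) * h ^+ m.-1).
  rewrite powRM ?invr_ge0 ?(ltW e0) ?(ltW hgt)//; congr (_ * _).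
  rewrite -powR_mulrn ?(ltW hgt)// -powRD; last by rewrite (gt_eqF hgt) implybT.
  rewrite -[h^-1]powR_inv1 ?(ltW hgt)// -powRrM; congr (_ `^ _).
  have E : m%:R = m.-1%:R + 1 :> R by rewrite natr1 prednK.
  by rewrite E; ring.
have -> : e / h * (C * (h * h ^+ m.-1)) = D / 2 * h ^+ m.-1.
  by rewrite /e; field; rewrite !gt_eqF.
have : e `^ (1 - p) * I * h `^ (p - m%:R) < D / 2.
  have : h `^ (p - m%:R) * (e `^ (1 - p) * I + 1) < D / 2 by rewrite -ltr_pdivlMr.
  have := powR_ge0 h (p - m%:R); move: (e `^ _ * I) (h `^ _) => A B B0; rewrite mulrDr mulr1 mulrC; lra.
rewrite -(ltr_pM2r hm0); move: (e `^ _) (h `^ _) (h ^+ _) => A B E; clear => H.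
rewrite (_ : D * E = D / 2 * E + D / 2 * E); last by field.
by rewrite ltrD2l (_ : A * (B * E) * I = A * I * B * E)//; ring.
Qed.

(** As 0 < p <= q, t^p <= 1 + t^q; the scale [lam] comes out as a constant factor. *)
Lemma Lq_intg_powR Omega q f (p : R) : measurable Omega -> (mu Omega < +oo)%E ->
  (forall x, Omega x -> p <= q x) -> 0 < p -> measurable_fun Omega q -> Lq Omega q f ->
  intg mu (fun x => `|(f \_ Omega) x| `^ p).
Proof.
move=> mO Ooo pq p0 mq [mf [lam l0 foo]].
have mP : measurable_fun Omega (fun x => `|lam * f x| `^ q x).
  by apply: measurable_powR2 => //; apply: measurableT_comp => //; exact: measurable_funM.
have iP : mu.-integrable Omega (EFin \o (fun x => `|lam * f x| `^ q x)).
  apply/integrableP; split; first exact/measurable_EFinP.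
  rewrite (eq_integral (fun x => (`|lam * f x| `^ q x)%:E)) => [|x _]; first exact: foo.
  by rewrite /= ger0_norm// powR_ge0.
have i1 := intgZ (lam^-1 `^ p) (intgD (intg_indic mO Ooo) (proj1 (integrable_restrictT _ _ mO) iP)).
have mfO : measurable_fun setT (f \_ Omega) by exact: (measurable_restrictT f mO).1.
apply: (intg_le i1).
  apply: measurable_powR2; [exact: measurableT|exact: measurableT_comp|exact: measurable_cst].
move=> x; rewrite [leLHS]ger0_norm ?powR_ge0// !patchE indicE.
case: ifPn => [|_]; last by rewrite normr0 powR0 ?gt_eqF// addr0 mulr0.
rewrite inE => Ox; have -> : `|f x| = lam^-1 * `|lam * f x|.
  by rewrite normrM gtr0_norm// mulKf// gt_eqF.
rewrite powRM ?invr_ge0 ?(ltW l0)// ler_wpM2l ?powR_ge0//.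
have := normr_ge0 (lam * f x); move: (`|lam * f x|) => t t0.
have [t1|t1] := leP t 1.
  rewrite ler_wpDr ?powR_ge0//; have := @ge0_ler_powR R p (ltW p0) t 1; rewrite !nnegrE powR1; exact.
by rewrite ler_wpDl// ler_powR ?(ltW t1)// pq.
Qed.

Lemma boundary_value0 Omega q f z (p : R) (x0 : 'rV[R]_n) : (0 < n)%N -> open Omega -> bounded_set Omega ->
  C2_boundary Omega -> measurable_fun Omega q -> (forall x, Omega x -> 1 < q x) ->
  n%:R < p -> (forall x, Omega x -> p <= q x) -> W1q Omega q f -> zext_weak Omega f ->
  {within closure Omega, continuous z} -> {ae mu, forall x, Omega x -> z x = f x} ->
  boundary Omega x0 -> z x0 = 0.
Proof.
move=> n0 oO bO C2O mq q1 np pq [Lf _ Lwf] zf cz zfae bx0.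
have mO := open_measurable_rV oO; have Ooo := bounded_lebesgue_lty mO bO.
apply/eqP/negPn/negP => c0; set c := z x0 in c0.
have [clx0 nix0] := bx0.
have [i [b [g [g2]]]] := C2O x0 bx0.
move=> /rV_nbhsP[r1 r10 Hg].
have g1 : Ck 1 setT g.
  move=> s x _; have [h1 h2] := g2 s x I; split=> hs; [apply: h1|apply: h2]; exact: leq_trans hs _.
have [Lg Lg0 HLg] := locally_lipschitz (col' i x0) g1.
have col_le x d : 0 <= d -> (forall j, j != i -> `|x ord0 j - x0 ord0 j| <= d) -> `|col' i x - col' i x0| <= d.
  move=> d0 H; apply: rV_norm_le => // k; rewrite !mxE; apply: H.
  by rewrite eq_sym neq_lift.
have coordB x j : `|x ord0 j - x0 ord0 j| <= `|x - x0|.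
  by have := coord_le_norm (x - x0) j; rewrite !mxE.
have col_leN x : `|col' i x - col' i x0| <= `|x - x0| by apply: col_le.
(* A boundary point lies on the graph: otherwise x_i - g would keep its sign near x0 by the
   Lipschitz bound, and x0 would be interior to [Omega] or to its complement. *)
have x0g : x0 ord0 i = g (col' i x0).
  apply/eqP/negPn/negP => dn; pose d := x0 ord0 i - g (col' i x0).
  have d0 : 0 < `|d| by rewrite normr_gt0 subr_eq0.
  pose r := Num.min (Num.min 1 r1) (`|d| / (Lg + 2)).
  have L2 : 0 < Lg + 2 by rewrite ltr_wpDl.
  have r0 : 0 < r by rewrite !lt_min ltr01 r10 divr_gt0.
  have same y : `|x0 - y| < r -> `|(y ord0 i - g (col' i y)) - d| < `|d|.
    move=> yr; have y1 : `|y - x0| <= 1.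
      by rewrite distrC (le_trans (ltW yr))// !ge_min lexx.
    have yd : (Lg + 2) * `|y - x0| < `|d|.
      by rewrite mulrC -ltr_pdivlMr// distrC (lt_le_trans yr)// !ge_min lexx orbT.
    have h1 := HLg _ (le_trans (col_leN y) y1); have h2 := coordB y i.
    have h3 : Lg * `|col' i y - col' i x0| <= Lg * `|y - x0| by rewrite ler_wpM2l.
    have -> : y ord0 i - g (col' i y) - d = (y ord0 i - x0 ord0 i) - (g (col' i y) - g (col' i x0)).
      by rewrite /d; ring.
    apply: le_lt_trans (ler_normB _ _) _; have := normr_ge0 (y - x0).
    move: yd h1 h2 h3; rewrite mulrDl; clear; lra.
  have yr1 y : `|x0 - y| < r -> `|x0 - y| < r1.
    by move=> /lt_le_trans; apply; rewrite !ge_min lexx orbT.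
  have [inn|out] := boolP (if b then x0 ord0 i < g (col' i x0) else g (col' i x0) < x0 ord0 i).
    apply: nix0; apply/rV_nbhsP; exists r => // y yr.
    apply/(Hg y (yr1 y yr)); move: inn (same y yr); rewrite /d.
    case: (b) => h; [rewrite [`|x0 ord0 i - g _|]ltr0_norm ?subr_lt0//|rewrite [`|x0 ord0 i - g _|]gtr0_norm ?subr_gt0//]; rewrite ltr_norml => /andP[? ?]; lra.
  have nb : nbhs x0 [set y | `|x0 - y| < r] by apply/rV_nbhsP; exists r.
  have [y [Oy yr]] := clx0 _ nb.
  have /(Hg y (yr1 y yr)) := Oy; move: out dn (same y yr); rewrite /d.
  case: (b); rewrite -leNgt le_eqVlt => /predU1P[->|h]; rewrite ?eqxx// => _.
    by rewrite [`|x0 ord0 i - g _|]gtr0_norm ?subr_gt0// ltr_norml => /andP[? ?] ?; lra.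
  by rewrite [`|x0 ord0 i - g _|]ltr0_norm ?subr_lt0// ltr_norml => /andP[? ?] ?; lra.
(* Within distance |c| / 2 of c, z has the sign of c and absolute value at least |c| / 2. *)
have [de de0 Hde] : exists2 de, 0 < de & forall y, `|x0 - y| < de -> closure Omega y -> `|z y - c| < `|c| / 2.
  have c20 : 0 < `|c| / 2 by rewrite divr_gt0// normr_gt0.
  have nz : nbhs (z x0) [set t | `|t - c| < `|c| / 2].
    exists (`|c| / 2) => // t /= ht; by rewrite distrC.
  have : within (closure Omega) (nbhs x0) [set y | `|z y - c| < `|c| / 2].
    by rewrite nbhs_subspace_in//; exact: cz x0 _ nz.
  move=> /rV_nbhsP[de de0 H].
  by exists de => // y yd cy; exact: H.
have [al [be [al0 albe be1 Hs]]] := @derive1_step_gt R.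
(* Over a ball of radius 2 h the graph moves by at most 2 Lg h, strictly less than L h. *)
pose L := 2 * Lg + 1.
have L1 : 1 <= L by rewrite lerDr mulr_ge0.
have Lp : 0 < L by exact: lt_le_trans ltr01 L1.
set F := f \_ Omega; set G := (fun x => wgrad Omega f x ord0 i) \_ Omega.
have p0 : 0 < p by apply: le_lt_trans np; exact: ler0n.
have p1 : 1 < p by apply: le_lt_trans np; rewrite ler1n.
have iF : intg mu F by exact: (Lq_integrable mO Ooo q1 mq Lf).
have iG : intg mu G by exact: (Lq_integrable mO Ooo q1 mq (Lwf i)).
have iGp : intg mu (fun x => `|G x| `^ p) by exact: (Lq_intg_powR mO Ooo pq p0 mq (Lwf i)).
pose D := `|c| * (be - al) / 4 * 2 ^+ n.-1.
have D0 : 0 < D.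
  by rewrite /D mulr_gt0 ?exprn_gt0// divr_gt0// mulr_gt0 ?normr_gt0// subr_gt0.
have C0 : 0 < (6 * L) ^+ n by rewrite exprn_gt0// mulr_gt0.
have I0 : 0 <= \int[mu]_x (`|G x| `^ p) by apply: int_ge0 => x; exact: powR_ge0.
(* Below this size of h, the bump lies where the domain is a graph and where z is close to c, and 2
   h stays within the unit radius of the Lipschitz bound. *)
pose m := Num.min (Num.min 1 r1) de / (2 * L + 2).
have mp : 0 < m by rewrite divr_gt0 ?lt_min ?ltr01 ?r10// ltr_wpDl// mulr_ge0// ltW.
have [h [K [h0 hm K0 contra]]] := scaling_choice D0 C0 I0 n0 np mp.
have hL : (2 * L + 2) * h < Num.min (Num.min 1 r1) de.
  by rewrite mulrC -ltr_pdivlMr// ltr_wpDl// mulr_ge0// ltW.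
have [h_1 h_r h_d] : [/\ 2 * h < 1, 2 * (L * h) < r1 & 2 * (L * h) < de].
  have Lh : 0 < L * h by exact: mulr_gt0.
  move: hL; rewrite !lt_min mulrDl -mulrA; move: h0 Lh; clear => ? ? /andP[/andP[? ?] ?]; split; lra.
have gb x : (forall j, j != i -> `|x ord0 j - x0 ord0 j| <= 2 * h) -> `|g (col' i x) - x0 ord0 i| < L * h.
  move=> H; have h20 : 0 <= 2 * h by rewrite mulr_ge0// ltW.
  have xh := col_le x _ h20 H; rewrite x0g; apply: le_lt_trans (HLg _ _) _.
    by apply: le_trans xh _; exact: ltW.
  apply: le_lt_trans (ler_wpM2l Lg0 xh) _; rewrite /L; move: h0; clear; lra.
have Hside x : `|x - x0| <= 2 * (L * h) -> (Omega x <-> (if b then x ord0 i < g (col' i x) else g (col' i x) < x ord0 i)).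
  by move=> xr; apply: Hg; rewrite distrC; apply: le_lt_trans h_r.
have ineq : `|c| * (be - al) / 4 * (2 * h) ^+ n.-1 <=
    K * (6 * (L * h)) ^+ n + K `^ (1 - p) * \int[mu]_x (`|G x| `^ p).
  apply: (@boundary_test_ineq _ _ x0 i b L h L1 h0 Omega F G c al be p K al0 albe be1 Hs _ _ _ _ _ iF iG iGp K0 p1).
  - move=> x /Hside[+ _] Ox H => /(_ Ox); have := gb x H; rewrite ltr_norml => /andP[].
    by move: (x ord0 i) (x0 ord0 i) (g _) (L * h); case: (b); clear => *; lra.
  - move=> x /Hside[_ +] H inn; apply; have := gb x H; rewrite ltr_norml => /andP[].
    by move: inn; move: (x ord0 i) (x0 ord0 i) (g _) (L * h); case: (b); clear => *; lra.
  - by move=> x Ox; rewrite /F patchE memNset.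
  - apply: filterS zfae => x Hx Ox xr; rewrite /F patchE mem_set// -Hx//.
    have cx : closure Omega x by exact: subset_closure.
    have xd : `|x0 - x| < de by rewrite distrC; apply: le_lt_trans h_d.
    have := Hde x xd cx; have : `|Num.sg c| = 1 by rewrite normr_sg c0.
    move: (z x) => t s1 tc.
    have h1 : Num.sg c * c = `|c| by rewrite -normrEsg.
    have h2 : `|Num.sg c * (t - c)| < `|c| / 2 by rewrite normrM s1 mul1r.
    move: h2; rewrite mulrBr h1 ltr_norml => /andP[h2 _]; move: h2; clear; lra.
  exact: zf.
move: contra; rewrite ltNge => /negP; apply.
move: ineq; rewrite /D !exprMn; congr (_ <= _); ring.
Qed.

End boundary_values.

Theorem proposition5p1 (R : realType) (n : nat) (n_ge2 : (2 <= n)%N)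
  (Omega : set 'rV[R]_n)
  (Omega_neq0 : Omega !=set0) (Omega_open : open Omega)
  (Omega_connected : connected Omega) (Omega_bounded : bounded_set Omega)
  (Omega_C2 : C2_boundary Omega)
  (q : 'rV[R]_n -> R)
  (q_C1 : Ck 1 Omega q)
  (q_gt1 : forall x, Omega x -> 1 < q x)
  (q_inf : n%:R < inf [set q x | x in Omega])
  (phi : 'rV[R]_n -> R)
  (phi_W : W1q Omega q phi)
  (phi_fin : (rho_grad Omega q phi < +oo)%E)
  (u : 'rV[R]_n -> R)
  (u_sol : weak_solution Omega q phi u)
  (ubar : 'rV[R]_n -> R) (u_rep : continuous_representative Omega u ubar)
  (phibar : 'rV[R]_n -> R)
  (phi_rep : continuous_representative Omega phi phibar) :
  viscosity_solution Omega (minus_qx_laplacian q) phibar ubar.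
Proof.
have [Wu [U0 weak goo _]] := u_sol.
have [cu uae] := u_rep; have [cphi phiae] := phi_rep.
have mO := open_measurable_rV Omega_open.
have mq : measurable_fun Omega q.
  apply: continuous_measurable_rV => //; apply: continuous_in_subspaceT => x; rewrite inE => Ox.
  exact: (q_C1 [::] x Ox).1.
have [Wz zf] := zext_weak_U1q0 Omega_open Omega_bounded q_gt1 mq U0.
apply: (viscosity_solution_of_boundary Omega_open Omega_bounded q_C1 q_gt1 Wu cu uae goo weak) => x bx.
(* The midpoint of n and inf q: strictly above n, as the scaling requires, and below every value of
   [q]. *)
pose p := (n%:R + inf [set q x | x in Omega]) / 2.
have np : n%:R < p by rewrite /p; lra.
have pq y : Omega y -> p <= q y.
  move=> Oy; have h : inf [set q x | x in Omega] <= q y.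
    apply: ge_inf; last by exists y.
    by exists 1 => _ [t Ot <-]; exact/ltW/q_gt1.
  by rewrite /p; lra.
have n0 : (0 < n)%N by exact: leq_trans n_ge2.
have cz : {within closure Omega, continuous (ubar \- phibar)}.
  by move=> y; apply: continuousB; [exact: cu|exact: cphi].
have zae : {ae @lebesgue_rV R n, forall x, Omega x -> (ubar \- phibar) x = (u \- phi) x}.
  by apply: filterS2 uae phiae => y h1 h2 Oy /=; rewrite h1// h2.
(* [ubar \- phibar] is a continuous representative of [u \- phi], whose extension by zero is weakly
   differentiable; its vanishing on the boundary is the required equality. *)
have := boundary_value0 n0 Omega_open Omega_bounded Omega_C2 mq q_gt1 np pq Wz zf cz zae bx.
by move=> /eqP; rewrite subr_eq0 => /eqP.
Qed.
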